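(* There exists an $\mathbb{S}^2\times\mathbb{S}^2$ wildly embedded in the twistor space $P^3_{\mathbb{C}}$ of $\mathbb{S}^4$ which is dynamically defined; that is, there is a complex Kleinian group $\Gamma\subset Aut_{hol}(P^3_{\mathbb{C}})$ whose limit set is a subset of $P^3_{\mathbb{C}}$ homeomorphic to $\mathbb{S}^2\times\mathbb{S}^2$ and wildly embedded in $P^3_{\mathbb{C}}$.
   Context: Twistor fibration. Identify $\mathbb{S}^4$ with the quaternionic projective line $P^1_{\mathcal{H}}$ of right quaternionic lines in $\mathcal{H}^2$, and $\mathcal{H}^2$ with $\mathbb{C}^4$ via $q_1=z_1+z_2\mathbf{j}$, $q_2=z_3+z_4\mathbf{j}$. Each right quaternionic line is invariant under right multiplication by $\mathbf{i}$, hence is a complex plane $\mathbb{C}^2$; sending a complex line in $\mathbb{C}^4$ to the right quaternionic line containing it defines the twistor (Calabi–Penrose) fibration $\pi:P^3_{\mathbb{C}}\to\mathbb{S}^4$ with fiber $P^1_{\mathbb{C}}$. The group $Conf_+(\mathbb{S}^4)\cong PSL(2,\mathcal{H})$ of orientation-preserving conformal automorphisms of $\mathbb{S}^4$ is naturally a subgroup of $PSL(4,\mathbb{C})$, so each of its subgroups has a canonical lifting to a group of holomorphic transformations of $P^3_{\mathbb{C}}$ carrying twistor lines (fibers of $\pi$) to twistor lines. Kleinian groups. For a discrete subgroup $G\subset Conf_+(\mathbb{S}^4)$, the discontinuity set is the set of points $x\in\mathbb{S}^4$ having a neighbourhood $U$ with $U\cap g(U)=\emptyset$ for all but finitely many $g\in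 G$, and its complement is the limit set $\Lambda(G)$; $G$ is Kleinian if the discontinuity set is non-empty. A complex Kleinian group is a discrete subgroup of the group $Aut_{hol}(P^3_{\mathbb{C}})$ of holomorphic automorphisms acting on $P^3_{\mathbb{C}}$ with non-empty region of discontinuity $\Omega$, an open invariant set on which the group acts properly and discontinuously; its limit set is the complement of $\Omega$. It is called a twistor Kleinian group if it is a lifting of a conformal Kleinian group acting on $\mathbb{S}^4$. For the canonical lifting of a discrete group $G\subset Conf_+(\mathbb{S}^4)$, the limit set in $P^3_{\mathbb{C}}$ is $\pi^{-1}(\Lambda(G))$. A closed subset of $P^3_{\mathbb{C}}$ homeomorphic to $\mathbb{S}^2\times\mathbb{S}^2$ is wildly embedded if it is not tame, i.e. no homeomorphism of $P^3_{\mathbb{C}}$ carries it onto a subpolyhedron (for a smooth triangulation of $P^3_{\mathbb{C}}$). *)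

(* Defs.v *)
From HB Require Import structures.
From mathcomp Require Import all_boot all_order all_algebra finmap.
From mathcomp Require Import complex.
From mathcomp Require Import all_classical all_reals all_analysis.
Set Implicit Arguments.
Unset Strict Implicit.
Unset Printing Implicit Defensive.
Import Order.TTheory GRing.Theory Num.Theory.
Import numFieldNormedType.Exports.
Local Open Scope classical_set_scope.
Local Open Scope ring_scope.

Section homeomorphism.
Context {X Y : topologicalType}.

(* [f] is total on [X]; only its restriction to [A] matters. *)
Definition homeomorphism (A : set X) (B : set Y) (f : X -> Y) : Prop :=
  [/\ {within A, continuous f}, set_bij A B f &
      exists g : Y -> X, {within B, continuous g} /\ {in A, cancel f g}].

Definition homeomorphic (A : set X) (B : set Y) : Prop :=
  exists f : X -> Y, homeomorphism A B f.

End homeomorphism.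

(* Projective 3-space over a field [K]: the quotient of the space of nonzero
   vectors of K^4 by proportionality, with the quotient topology.  It is set
   up over an arbitrary [numFieldType] because the norm topology is attached to
   an abstract numeric field, not to the concrete type [R[i]]; it is then used
   at K = R[i]. *)
Section projective_space.
Context {K : numFieldType}.

Definition nonzero_vector : Type :=
  set_type [set v : 'rV[K]_4 | v != 0].
HB.instance Definition _ := Topological.on nonzero_vector.
HB.instance Definition _ := Choice.on nonzero_vector.

Definition proportional (u v : nonzero_vector) : bool :=
  `[< exists2 c : K, c != 0 & set_val v = c *: set_val u >].

Lemma proportional_refl : reflexive proportional.
Proof. by move=> u; apply/asboolP; exists 1; rewrite ?oner_eq0 // scale1r. Qed.

Lemma proportional_sym : symmetric proportional.
Proof.
have H u v : proportional u v -> proportional v u.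
  move=> /asboolP[c c0 E]; apply/asboolP; exists c^-1; first by rewrite invr_eq0.
  by rewrite E scalerA mulVf // scale1r.
by move=> u v; apply/idP/idP; exact: H.
Qed.

Lemma proportional_trans : transitive proportional.
Proof.
move=> v u w /asboolP[c c0 E] /asboolP[d d0 F]; apply/asboolP.
by exists (d * c); [rewrite mulf_neq0 | rewrite F E scalerA].
Qed.

Canonical proportional_equiv :=
  EquivRel proportional proportional_refl proportional_sym proportional_trans.

Definition proj3 : Type := quotient_topology {eq_quot proportional_equiv}%qT.
HB.instance Definition _ := Topological.on proj3.
HB.instance Definition _ := Quotient.on proj3.

Definition homog (p : proj3) : 'rV[K]_4 := set_val (repr p).

Definition affine_domain (j : 'I_4) : set proj3 := [set p | homog p 0 j != 0].

(* Independent of the representative [homog p]; a chart on [affine_domain j]. *)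
Definition affine_coord (j : 'I_4) (p : proj3) : 'rV[K]_3 :=
  \row_k (homog p 0 (lift j k) / homog p 0 j).

Definition affine_vector (j : 'I_4) (w : 'rV[K]_3) : 'rV[K]_4 :=
  \row_i (if unlift j i is Some k then w 0 k else 1).

Lemma affine_vector_neq0 j w :
  affine_vector j w \in [set v : 'rV[K]_4 | v != 0].
Proof.
apply/mem_set/eqP => /(congr1 (fun v : 'rV[K]_4 => v 0 j)).
by rewrite !mxE unlift_none => /eqP; rewrite oner_eq0.
Qed.

(* The inverse of the chart [affine_coord j]. *)
Definition affine_param (j : 'I_4) (w : 'rV[K]_3) : proj3 :=
  \pi_proj3%qT (SigSub (affine_vector_neq0 j w) : nonzero_vector).

(* [differentiable] is over [K]; at K = R[i] it is complex differentiability. *)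
Definition holomorphic (f : proj3 -> proj3) : Prop :=
  continuous f /\
  forall (i j : 'I_4) (w : 'rV[K]_3), affine_domain j (f (affine_param i w)) ->
    differentiable (affine_coord j \o f \o affine_param i) w.

Definition Aut_hol : set (proj3 -> proj3) :=
  [set f | holomorphic f /\
     exists g, [/\ holomorphic g, cancel f g & cancel g f]].

End projective_space.
Arguments nonzero_vector : clear implicits.
Arguments proj3 : clear implicits.
Arguments Aut_hol : clear implicits.

Section actions.
Context {X : topologicalType}.
Implicit Types (Gam : set (X -> X)) (Om : set X).

Definition transformation_group Gam : Prop :=
  [/\ Gam id, forall f g, Gam f -> Gam g -> Gam (f \o g) &
      forall f, Gam f -> exists g, [/\ Gam g, cancel f g & cancel g f]].

Definition discrete Gam : Prop :=
  forall g, Gam g -> exists2 W : set {compact-open, X -> X},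
    open W & W `&` Gam = [set g].

Definition region_of_discontinuity Gam : set X :=
  [set x | exists2 U : set X, nbhs x U &
     finite_set [set g | Gam g /\ U `&` (g @` U) !=set0]].

Definition limit_set Gam : set X := ~` region_of_discontinuity Gam.

Definition properly_discontinuous Gam Om : Prop :=
  forall C : set X, compact C -> C `<=` Om ->
    finite_set [set g | Gam g /\ C `&` (g @` C) !=set0].

End actions.

(* By local compactness the discontinuity set contains every open invariant set
   on which the group acts properly discontinuously; asking that the action on
   the discontinuity set itself be properly discontinuous thus makes it the
   largest such set, and leaves no choice for the limit set. *)
Definition complex_kleinian (R : realType)
    (Gam : set (proj3 R[i] -> proj3 R[i])) : Prop :=
  let Om := region_of_discontinuity Gam in
  [/\ Gam `<=` Aut_hol R[i], transformation_group Gam, discrete Gam, Om !=set0 &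
      [/\ open Om, forall g, Gam g -> g @` Om = Om &
          properly_discontinuous Gam Om]].

Section polyhedra.
Context {R : realType} {N : nat}.
Local Notation V := 'rV[R]_N.

(* A simplex is given by its finite set of vertices. *)
Implicit Types (s : {fset V}) (T L : {fset {fset V}}).

Definition simplex s : set V :=
  [set x | exists w : V -> R,
     [/\ forall v, v \in s -> 0 <= w v, \sum_(v <- s) w v = 1 &
         \sum_(v <- s) w v *: v = x]].

Definition affinely_independent s : Prop :=
  forall w : V -> R, \sum_(v <- s) w v = 0 -> \sum_(v <- s) w v *: v = 0 ->
    forall v, v \in s -> w v = 0.

(* The last clause covers disjoint simplices: [simplex fset0] is empty. *)
Definition simplicial_complex T : Prop :=
  [/\ forall s, s \in T -> s != fset0 /\ affinely_independent s,
      forall s s', s \in T -> (s' `<=` s)%fset -> s' != fset0 -> s' \in T &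
      forall s s', s \in T -> s' \in T ->
        simplex s `&` simplex s' = simplex (s `&` s')%fset].

Definition polyhedron T : set V :=
  [set x | exists2 s, s \in T & simplex s x].

Definition subdivision T' T : Prop :=
  [/\ simplicial_complex T', polyhedron T' = polyhedron T &
      forall s', s' \in T' ->
        exists2 s, s \in T & simplex s' `<=` simplex s].

Definition subpolyhedron T (P : set V) : Prop :=
  exists T' L, [/\ subdivision T' T, (L `<=` T')%fset, simplicial_complex L &
    polyhedron L = P].

End polyhedra.

Section smoothness.
Context {R : realType} {U V : normedModType R}.

Fixpoint Ck (k : nat) (W : set U) (f : U -> V) : Prop :=
  match k with
  | 0%N => forall x, W x -> {for x, continuous f}
  | k'.+1 => forall v : U,
      (forall x, W x -> derivable f x v) /\ Ck k' W ('D_v f)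
  end.

Definition smooth (W : set U) (f : U -> V) : Prop := forall k, Ck k W f.

End smoothness.

Section triangulations.
Context {R : realType}.

Definition realify (w : 'rV[R[i]]_3) : 'rV[R]_(3 + 3) :=
  row_mx (map_mx (@complex.Re R) w) (map_mx (@complex.Im R) w).

(* Smoothness on the closed simplex [s] is the existence of local smooth
   extensions to open sets of R^N; [t] is moreover an immersion of [s]: in each
   chart the differential is injective on the direction space of [s], where it
   does not depend on the extension. *)
Definition smooth_on_simplex (N : nat) (s : {fset 'rV[R]_N})
    (t : 'rV[R]_N -> proj3 R[i]) : Prop :=
  forall (x : 'rV[R]_N) (j : 'I_4), simplex s x -> affine_domain j (t x) ->
  exists (W : set 'rV[R]_N) (F : 'rV[R]_N -> 'rV[R]_(3 + 3)),
    [/\ open W, W x, smooth W F,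
        forall y, W y -> simplex s y ->
          affine_domain j (t y) /\ F y = realify (affine_coord j (t y)) &
        forall w : 'rV[R]_N -> R, \sum_(v <- s) w v = 0 ->
          'D_(\sum_(v <- s) w v *: v) F x = 0 -> \sum_(v <- s) w v *: v = 0].

Definition smooth_triangulation (N : nat) (T : {fset {fset 'rV[R]_N}})
    (t : 'rV[R]_N -> proj3 R[i]) : Prop :=
  [/\ simplicial_complex T, homeomorphism (polyhedron T) [set: proj3 R[i]] t &
      forall s, s \in T -> smooth_on_simplex s t].

Definition tame (S : set (proj3 R[i])) : Prop :=
  exists (N : nat) (T : {fset {fset 'rV[R]_N}}) (t : 'rV[R]_N -> proj3 R[i])
      (h : proj3 R[i] -> proj3 R[i]) (P : set 'rV[R]_N),
    [/\ smooth_triangulation T t,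
        homeomorphism [set: proj3 R[i]] [set: proj3 R[i]] h,
        subpolyhedron T P & h @` S = t @` P].

Definition sphere2 : set 'rV[R]_3 := [set x | \sum_i x 0 i ^+ 2 = 1].

Definition wildly_embedded_S2xS2 (S : set (proj3 R[i])) : Prop :=
  [/\ closed S, homeomorphic S (sphere2 `*` sphere2) & ~ tame S].

End triangulations.

(* Main.v *)
(* Let Sigma be the cuspidal curve t |-> (t^2, t^3) in C^2 = H; its complement
   near the cusp retracts to the complement of a trefoil knot.  Choose a null
   sequence of disjoint round balls centred on Sigma, dense along Sigma and
   missing the cusp, so small that inside each of them Sigma is nearly flat and
   the inversion in the ball is matched by an involution of the parameter t.
   The even products of these inversions form a Kleinian group on S^4 whose
   limit set is a 2-sphere: reflecting Sigma into the balls again and again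
   converges to an embedding f of C, closed up by the point at infinity.  The
   lift to P^3 has as limit set the union of the twistor lines over this sphere,
   and the twistor bundle is trivial over it because it misses a point of S^4.

   Wildness.  If the limit set were tame, some neighbourhood of every point p
   could be contracted towards p by a homotopy that stays in the complement of
   the limit set until it is as close to p as we please (cones over the star of
   a vertex).  Take p over the fixed point of R_0 R_1, where R_i is the inversion
   in the i-th ball B_i, and the loops (R_0 R_1)^n (K), where K is the loop
   |w| = 1 of points (0, w); they converge to p.  Contracting one of them and
   applying (R_0 R_1)^-n makes K homotopic, in the complement of the limit set,
   to a loop in B_0.  Map that complement to {x^3 <> y^2}, by folding it onto the
   fundamental domain outside B_0 and by collapsing B_0 into the neighbourhood of
   a smooth arc of Sigma, and look at the roots of z^3 - 3 x z + 2 y, whose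
   discriminant is 108 (x^3 - y^2).  Over B_0 there is a continuous root, over K
   the equation is z^3 = - 2 w and there is none; but having a continuous root is
   invariant under homotopy. *)

(* The monodromy of the cubic is the map of the trefoil group onto the symmetric group on three
   letters. A meridian of a smooth arc acts as a transposition, which fixes a root; the loop K acts
   as a 3-cycle, which fixes none. Speaking of continuous roots rather than of fundamental groups
   also removes base points: a free homotopy is enough.

   For the embedding the obstacle is that infinitely many inversions do not contract uniformly. Each
   ball is therefore chosen after the earlier ones and is tiny compared with its distance to them:
   reflecting an earlier ball into a later one contracts strongly, while reflecting a later ball
   into an earlier one need only not expand, since the later ball is already small.

   The balls have to be dense along Sigma because the group acts discontinuously near a point of
   Sigma outside the balls at which no balls accumulate. They miss the whole axis of points (0, w),
   so that K lies in the fundamental domain and folding leaves it alone. *)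
Require Import Defs.
From mathcomp Require Import all_boot all_order all_algebra finmap.
From mathcomp Require Import complex.
From mathcomp Require Import all_classical all_reals all_analysis.
From mathcomp Require Import ring lra.
Set Implicit Arguments.
Unset Strict Implicit.
Unset Printing Implicit Defensive.
Import Order.TTheory GRing.Theory Num.Theory.
Import numFieldNormedType.Exports.
Local Open Scope classical_set_scope.
Local Open Scope ring_scope.

(** * The complex and the quaternionic plane *)

(* [R[i]] under its [numFieldType] structure, which carries the norm topology. *)
Definition Cx (R : realType) : numFieldType := R[i].

Section complex_plane.
Context {R : realType}.
Local Notation C := (Cx R).
Implicit Types (z w : C) (a b : R).

Definition re z : R := complex.Re z.
Definition im z : R := complex.Im z.
Definition rc a : C := real_complex R a.
Definition mkc a b : C := Complex a b.
Definition cj z : C := conjc z.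
Definition cabs z : R := Num.sqrt (re z ^+ 2 + im z ^+ 2).

Lemma mkcE z : z = mkc (re z) (im z). Proof. by case: z. Qed.
Lemma cxP z w : re z = re w -> im z = im w -> z = w.
Proof. by case: z => a b; case: w => c d /= -> ->. Qed.
Lemma reD z w : re (z + w) = re z + re w. Proof. by case: z w => ? ? []. Qed.
Lemma imD z w : im (z + w) = im z + im w. Proof. by case: z w => ? ? []. Qed.
Lemma reN z : re (- z) = - re z. Proof. by case: z. Qed.
Lemma imN z : im (- z) = - im z. Proof. by case: z. Qed.
Lemma reM z w : re (z * w) = re z * re w - im z * im w.
Proof. by case: z w => ? ? []. Qed.
Lemma imM z w : im (z * w) = re z * im w + im z * re w.
Proof. by case: z w => ? ? []. Qed.
Lemma re_rc a : re (rc a) = a. Proof. by []. Qed.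
Lemma im_rc a : im (rc a) = 0. Proof. by []. Qed.
Lemma re_cj z : re (cj z) = re z. Proof. by case: z. Qed.
Lemma im_cj z : im (cj z) = - im z. Proof. by case: z. Qed.
Lemma re0 : re 0 = 0. Proof. by []. Qed.
Lemma im0 : im 0 = 0. Proof. by []. Qed.
Lemma re1 : re 1 = 1. Proof. by []. Qed.
Lemma im1 : im 1 = 0. Proof. by []. Qed.
Definition cxE := (reD, imD, reN, imN, reM, imM, re_rc, im_rc, re_cj, im_cj,
  re0, im0, re1, im1).

Lemma rcD a b : rc (a + b) = rc a + rc b.
Proof. by apply: cxP; rewrite !cxE ?addr0. Qed.
Lemma rcN a : rc (- a) = - rc a.
Proof. by apply: cxP; rewrite !cxE ?oppr0. Qed.
Lemma rcM a b : rc (a * b) = rc a * rc b.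
Proof. by apply: cxP; rewrite !cxE; ring. Qed.
Lemma rc0 : rc 0 = 0. Proof. by []. Qed.
Lemma rc1 : rc 1 = 1. Proof. by []. Qed.
Lemma rc_eq0 a : (rc a == 0) = (a == 0).
Proof. by apply/eqP/eqP => [/(congr1 re)|->]. Qed.
Lemma rcX a n : rc (a ^+ n) = rc a ^+ n.
Proof. by elim: n => [|n IH]; rewrite ?expr0 // !exprS rcM IH. Qed.
Lemma rc_nat n : rc n%:R = n%:R.
Proof. by elim: n => [|n IH] //; rewrite !mulrS rcD IH. Qed.
Lemma rcV a : rc a^-1 = (rc a)^-1.
Proof.
have [->|a0] := eqVneq a 0; first by rewrite rc0 !invr0.
by apply: (@mulfI _ (rc a)); rewrite ?rc_eq0 // -rcM !divff ?rc_eq0.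
Qed.

Lemma cjD z w : cj (z + w) = cj z + cj w.
Proof. by apply: cxP; rewrite !cxE; ring. Qed.
Lemma cjN z : cj (- z) = - cj z.
Proof. by apply: cxP; rewrite !cxE; ring. Qed.
Lemma cjM z w : cj (z * w) = cj z * cj w.
Proof. by apply: cxP; rewrite !cxE; ring. Qed.
Lemma cjK z : cj (cj z) = z.
Proof. by apply: cxP; rewrite !cxE; ring. Qed.
Lemma cj_rc a : cj (rc a) = rc a.
Proof. by apply: cxP; rewrite !cxE; ring. Qed.
Lemma cj_eq0 z : (cj z == 0) = (z == 0).
Proof. by apply/eqP/eqP => [/(congr1 cj)|->]; rewrite ?cjK // -rc0 cj_rc. Qed.

Lemma sqr_cabs z : cabs z ^+ 2 = re z ^+ 2 + im z ^+ 2.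
Proof. by rewrite sqr_sqrtr // addr_ge0 // sqr_ge0. Qed.
Lemma mul_cj z : z * cj z = rc (cabs z ^+ 2).
Proof. by apply: cxP; rewrite sqr_cabs !cxE; ring. Qed.
Lemma cabs_ge0 z : 0 <= cabs z. Proof. exact: sqrtr_ge0. Qed.
Lemma normr_cabs z : `|z| = rc (cabs z) :> C.
Proof. by have := normc_def (z : R[i]). Qed.
Lemma cabs_eq0 z : (cabs z == 0) = (z == 0).
Proof. by rewrite -rc_eq0 -normr_cabs normr_eq0. Qed.
Lemma cabs0 : cabs 0 = 0. Proof. by apply/eqP; rewrite cabs_eq0. Qed.
Lemma rcI : injective rc. Proof. by move=> a b /(congr1 re). Qed.
Lemma cabsM z w : cabs (z * w) = cabs z * cabs w.
Proof. by apply: rcI; rewrite rcM -!normr_cabs normrM. Qed.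
Lemma cabsN z : cabs (- z) = cabs z.
Proof. by apply: rcI; rewrite -!normr_cabs normrN. Qed.
Lemma cabsB z w : cabs (z - w) = cabs (w - z).
Proof. by rewrite -cabsN opprB. Qed.
Lemma cabsX z n : cabs (z ^+ n) = cabs z ^+ n.
Proof. by apply: rcI; rewrite rcX -!normr_cabs normrX. Qed.
Lemma cabsV z : cabs (z^-1) = (cabs z)^-1.
Proof. by apply: rcI; rewrite rcV -!normr_cabs normfV. Qed.
Lemma cabs_rc a : cabs (rc a) = `|a|.
Proof. by rewrite /cabs !cxE expr0n addr0 sqrtr_sqr. Qed.
Lemma cabs_cj z : cabs (cj z) = cabs z.
Proof. by rewrite /cabs !cxE sqrrN. Qed.
Lemma cabs1 : cabs 1 = 1. Proof. by rewrite -rc1 cabs_rc normr1. Qed.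
Lemma cabs_nat n : cabs n%:R = n%:R.
Proof. by rewrite -rc_nat cabs_rc normr_nat. Qed.
Lemma rc_le a b : (rc a <= rc b) = (a <= b).
Proof. exact: (lecR a b). Qed.
Lemma rc_lt a b : (rc a < rc b) = (a < b).
Proof. exact: (ltcR a b). Qed.
Lemma cabsD z w : cabs (z + w) <= cabs z + cabs w.
Proof. by rewrite -rc_le rcD -!normr_cabs ler_normD. Qed.
Lemma cabs_tri z w v : cabs (z - w) <= cabs (z - v) + cabs (v - w).
Proof. by rewrite (_ : z - w = (z - v) + (v - w)) ?cabsD //; ring. Qed.
Lemma cabs_sub z w : cabs z - cabs w <= cabs (z - w).
Proof. by rewrite lerBlDr (le_trans _ (cabsD _ _)) // subrK. Qed.
Lemma re_le z : `|re z| <= cabs z.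
Proof.
by rewrite -(@ler_pXn2r _ 2) ?nnegrE ?cabs_ge0 // sqr_cabs real_normK ?num_real // lerDl sqr_ge0.
Qed.
Lemma im_le z : `|im z| <= cabs z.
Proof.
by rewrite -(@ler_pXn2r _ 2) ?nnegrE ?cabs_ge0 // sqr_cabs real_normK ?num_real // lerDr sqr_ge0.
Qed.
Lemma cabs_le z : cabs z <= `|re z| + `|im z|.
Proof.
rewrite -(@ler_pXn2r _ 2) ?nnegrE ?cabs_ge0 ?addr_ge0 // sqr_cabs sqrrD.
rewrite !real_normK ?num_real //.
have : 0 <= `|re z| * `|im z| by rewrite mulr_ge0.
lra.
Qed.

(** The balls of the norm topology on [C] have complex radii, which are real because they are
    positive; the estimates below use real radii only. *)
Lemma nbhsC z (A : set C) :
  nbhs z A <-> exists2 e : R, 0 < e & forall w, cabs (w - z) < e -> A w.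
Proof.
split.
  move=> /nbhs_ballP[e /= e0 H].
  have eE : e = rc (re e).
    apply: cxP => //; rewrite im_rc.
    by have := ger0_Im (ltW e0 : (0 : R[i]) <= e).
  exists (re e) => [|w hw]; first by rewrite -rc_lt -eE.
  by apply: H; rewrite -ball_normE /ball_/= normr_cabs eE rc_lt cabsB.
move=> [e e0 H]; apply/nbhs_ballP; exists (rc e) => /=; first by rewrite rc_lt.
move=> w; rewrite -ball_normE /ball_/= normr_cabs rc_lt cabsB; exact: H.
Qed.

End complex_plane.

Section quaternionic_plane.
Context {R : realType}.
Local Notation C := (Cx R).
Local Notation Q := (C * C)%type.
Implicit Types (p q s : Q) (a b : R).

Definition nq q : R := Num.sqrt (cabs q.1 ^+ 2 + cabs q.2 ^+ 2).
Definition dotq p q : R := re (p.1 * cj q.1) + re (p.2 * cj q.2).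

Lemma sqr_nq q : nq q ^+ 2 = cabs q.1 ^+ 2 + cabs q.2 ^+ 2.
Proof. by rewrite sqr_sqrtr // addr_ge0 // sqr_ge0. Qed.
Lemma nq_ge0 q : 0 <= nq q. Proof. exact: sqrtr_ge0. Qed.
Lemma nq_eq0 q : (nq q == 0) = (q == 0).
Proof.
rewrite -sqrf_eq0 sqr_nq paddr_eq0 ?sqr_ge0 // !sqrf_eq0 !cabs_eq0.
by case: q.
Qed.
Lemma nq0 : nq 0 = 0. Proof. by apply/eqP; rewrite nq_eq0. Qed.
Lemma nqN q : nq (- q) = nq q.
Proof. by rewrite /nq /= !cabsN. Qed.
Lemma nqB p q : nq (p - q) = nq (q - p).
Proof. by rewrite -nqN opprB. Qed.
Lemma nqZ a q : nq (rc a *: q) = `|a| * nq q.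
Proof.
rewrite /nq /= !cabsM !cabs_rc !exprMn -mulrDr sqrtrM ?sqr_ge0 //.
by rewrite sqrtr_sqr normr_id.
Qed.
Lemma sqr_nqD p q : nq (p + q) ^+ 2 = nq p ^+ 2 + nq q ^+ 2 + 2 * dotq p q.
Proof. by rewrite /dotq !sqr_nq !sqr_cabs /= !cxE; ring. Qed.
Lemma dotqN p q : dotq p (- q) = - dotq p q.
Proof. by rewrite /dotq /= !cjN !mulrN !reN; ring. Qed.
Lemma dotqZr a p q : dotq p (rc a *: q) = a * dotq p q.
Proof. by rewrite /dotq /= !cxE; ring. Qed.
Lemma dotqC p q : dotq p q = dotq q p.
Proof. by rewrite /dotq !cxE; ring. Qed.
Lemma sqr_nqB p q : nq (p - q) ^+ 2 = nq p ^+ 2 + nq q ^+ 2 - 2 * dotq p q.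
Proof. by rewrite sqr_nqD nqN dotqN mulrN. Qed.
Lemma dotq_le p q : dotq p q <= nq p * nq q.
Proof.
have [p0|p0] := eqVneq p 0.
  by rewrite p0 nq0 mul0r /dotq /= !mul0r addr0.
have [q0|q0] := eqVneq q 0.
  by rewrite q0 nq0 mulr0 dotqC /dotq /= !mul0r addr0.
have np : 0 < nq p by rewrite lt_neqAle nq_ge0 eq_sym nq_eq0 p0.
have nq' : 0 < nq q by rewrite lt_neqAle nq_ge0 eq_sym nq_eq0 q0.
have : 0 <= nq (rc (nq q) *: p - rc (nq p) *: q) ^+ 2 by rewrite sqr_ge0.
rewrite sqr_nqB !nqZ !ger0_norm ?nq_ge0 // dotqZr dotqC dotqZr dotqC => H.
have {}H : 0 <= 2 * (nq p * nq q) * (nq p * nq q - dotq p q).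
  by apply: le_trans H _; rewrite le_eqVlt; apply/orP; left; apply/eqP; ring.
by rewrite pmulr_rge0 ?subr_ge0 // in H; rewrite !mulr_gt0.
Qed.
Lemma nqD p q : nq (p + q) <= nq p + nq q.
Proof.
rewrite -(@ler_pXn2r _ 2) ?nnegrE ?nq_ge0 ?addr_ge0 ?nq_ge0 // sqr_nqD sqrrD.
have := dotq_le p q; lra.
Qed.
Lemma nq_tri p q s : nq (p - q) <= nq (p - s) + nq (s - q).
Proof. by rewrite (_ : p - q = (p - s) + (s - q)) ?nqD // addrA subrK. Qed.
Lemma nq_sub p q : nq p - nq q <= nq (p - q).
Proof. by rewrite lerBlDr (le_trans _ (nqD _ _)) // subrK. Qed.
Lemma nq_fst q : cabs q.1 <= nq q.
Proof.
by rewrite -(@ler_pXn2r _ 2) ?nnegrE ?cabs_ge0 ?nq_ge0 // sqr_nq lerDl sqr_ge0.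
Qed.
Lemma nq_snd q : cabs q.2 <= nq q.
Proof.
by rewrite -(@ler_pXn2r _ 2) ?nnegrE ?cabs_ge0 ?nq_ge0 // sqr_nq lerDr sqr_ge0.
Qed.
Lemma nq_le q : nq q <= cabs q.1 + cabs q.2.
Proof.
rewrite -(@ler_pXn2r _ 2) ?nnegrE ?nq_ge0 ?addr_ge0 ?cabs_ge0 // sqr_nq sqrrD.
have : 0 <= cabs q.1 * cabs q.2 by rewrite mulr_ge0 ?cabs_ge0.
lra.
Qed.

Lemma nbhsQ q (A : set Q) :
  nbhs q A <-> exists2 e : R, 0 < e & forall p, nq (p - q) < e -> A p.
Proof.
split.
  case=> [[A1 A2] [/= /nbhsC[e e0 He] /nbhsC[d d0 Hd]] HA].
  exists (Num.min e d) => [|p]; first by rewrite lt_min e0.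
  rewrite lt_min => /andP[pe pd]; apply: HA; split => /=.
    by apply: He; rewrite (le_lt_trans _ pe) // (nq_fst (p - q)).
  by apply: Hd; rewrite (le_lt_trans _ pd) // (nq_snd (p - q)).
move=> [e e0 He].
have e20 : 0 < e / 2 by rewrite divr_gt0.
exists ([set z | cabs (z - q.1) < e / 2], [set z | cabs (z - q.2) < e / 2]) => /=.
  by split; apply/nbhsC; exists (e / 2).
move=> p [/= p1 p2]; apply: He; apply: le_lt_trans (nq_le _) _.
rewrite /=; lra.
Qed.

End quaternionic_plane.

(** * Continuity, compactness and completeness in the plane and in [Q] *)

Section continuity.
Context {R : realType}.
Local Notation C := (Cx R).
Local Notation Q := (C * C)%type.

Lemma cvgCI {T : Type} (F : set_system T) {FF : Filter F} (f : T -> C) (l : C) :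
  (forall e : R, 0 < e -> \forall x \near F, cabs (f x - l) < e) -> f @ F --> l.
Proof.
move=> H A /nbhsC[e e0 He].
by apply: (@filterS _ F FF _ _ _ (H e e0)) => x; exact: He.
Qed.

Lemma cvgCE {T : Type} (F : set_system T) {FF : Filter F} (f : T -> C) (l : C) (e : R) :
  f @ F --> l -> 0 < e -> \forall x \near F, cabs (f x - l) < e.
Proof.
move=> H e0.
by apply: (H [set z | cabs (z - l) < e]); apply/nbhsC; exists e.
Qed.

Lemma cvgQI {T : Type} (F : set_system T) {FF : Filter F} (f : T -> Q) (l : Q) :
  (forall e : R, 0 < e -> \forall x \near F, nq (f x - l) < e) -> f @ F --> l.
Proof.
move=> H A /nbhsQ[e e0 He].
by apply: (@filterS _ F FF _ _ _ (H e e0)) => x; exact: He.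
Qed.

Lemma cvgQE {T : Type} (F : set_system T) {FF : Filter F} (f : T -> Q) (l : Q) (e : R) :
  f @ F --> l -> 0 < e -> \forall x \near F, nq (f x - l) < e.
Proof.
move=> H e0.
by apply: (H [set z | nq (z - l) < e]); apply/nbhsQ; exists e.
Qed.

Lemma contC_lip (f : C -> C) : (forall z w, cabs (f z - f w) <= cabs (z - w)) ->
  continuous f.
Proof.
move=> H z; apply: (@cvgCI _ (nbhs z)) => e e0; apply/nbhsC; exists e => // w zw.
exact: le_lt_trans (H _ _) zw.
Qed.

Lemma continuous_cj : continuous (@cj R).
Proof. by apply: contC_lip => z w; rewrite -cjN -cjD cabs_cj. Qed.

Lemma continuous_rc : continuous (@rc R).
Proof.
move=> a; apply: cvgCI => e e0; near=> x.
rewrite -rcN -rcD cabs_rc distrC.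
by near: x; apply: cvgr_dist_lt.
Unshelve. all: by end_near. Qed.

Lemma cont_cabs (z : C) : {for z, continuous (@cabs R)}.
Proof.
apply/(@cvgrPdist_lt _ _ _ (nbhs z)) => e e0; apply/nbhsC; exists e => // w zw.
rewrite ltr_norml.
have := cabs_sub w z; have := cabs_sub z w; rewrite (cabsB z w).
by move: zw; lra.
Qed.

Lemma cont_nq (q : Q) : {for q, continuous (@nq R)}.
Proof.
apply/(@cvgrPdist_lt _ _ _ (nbhs q)) => e e0; apply/nbhsQ; exists e => // w zw.
rewrite ltr_norml.
have := nq_sub w q; have := nq_sub q w; rewrite (nqB q w).
by move: zw; lra.
Qed.

Lemma cvg_mkc {T : Type} (F : set_system T) {FF : Filter F} (f g : T -> R) (a b : R) :
  f @ F --> a -> g @ F --> b -> (fun x => mkc (f x) (g x) : C) @ F --> (mkc a b : C).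
Proof.
move=> fa gb; apply: cvgCI => e e0.
have e20 : 0 < e / 2 by rewrite divr_gt0.
near=> x; apply: le_lt_trans (cabs_le _) _.
rewrite reD imD reN imN /= (splitr e) ltrD // distrC.
  by near: x; move/cvgrPdist_lt : fa; apply.
by near: x; move/cvgrPdist_lt : gb; apply.
Unshelve. all: by end_near. Qed.

Lemma mkc_continuous : continuous (fun p : R * R => mkc p.1 p.2 : C).
Proof. by move=> p; apply: cvg_mkc; [exact: cvg_fst|exact: cvg_snd]. Qed.

Lemma compact_disc (M : R) : compact [set z : C | cabs z <= M].
Proof.
have cK : compact ((fun p : R * R => mkc p.1 p.2 : C) @` (`[- M, M] `*` `[- M, M])).
  apply: continuous_compact.
    by apply: continuous_subspaceT; exact: mkc_continuous.
  by apply: compact_setX; exact: segment_compact.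
apply: subclosed_compact cK _.
  rewrite (_ : [set _ | _] = @cabs R @^-1` [set x | x <= M]) //.
  apply: closed_comp; last exact: closed_le.
  by move=> z _; exact: cont_cabs.
move=> z /= zM; exists (re z, im z); rewrite /= -?mkcE //.
by split; rewrite /= in_itv /= -ler_norml; apply: le_trans zM; [exact: re_le|exact: im_le].
Qed.

Definition circle : set C := [set z | cabs z = 1].

Lemma compact_circle : compact circle.
Proof.
apply: subclosed_compact (compact_disc (M := 1)) _; last by move=> z /= ->.
rewrite (_ : circle = @cabs R @^-1` [set x | x = 1]) //.
apply: closed_comp; last exact: closed_eq.
by move=> z _; exact: cont_cabs.
Qed.

Lemma connected_circle : connected circle.
Proof.
pose half (s : R) := (fun x : R => mkc x (s * Num.sqrt (1 - x ^+ 2)) : C) @` `[-1, 1].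
have ch s : connected (half s).
  apply: connected_continuous_connected; first exact: segment_connected.
  apply: continuous_subspaceT => x.
  apply: cvg_mkc; first exact: cvg_id.
  apply: cvgM; first exact: cvg_cst.
  apply: continuous_cvg; first exact: sqrt_continuous.
  by apply: cvgB; [exact: cvg_cst|apply: exprn_continuous].
have -> : circle = half 1 `|` half (-1).
  apply/seteqP; split => z.
    rewrite /circle /= => z1.
    have zz : re z ^+ 2 + im z ^+ 2 = 1 by rewrite -sqr_cabs z1 expr1n.
    have zi : re z \in `[-1, 1].
      by rewrite in_itv /= -ler_norml -z1 re_le.
    have si : Num.sqrt (1 - re z ^+ 2) = `|im z|.
      by rewrite -zz addrAC subrr add0r sqrtr_sqr.
    have [i0|i0] := leP 0 (im z); [left|right]; exists (re z) => //; rewrite si;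
      apply: cxP => //.
      by rewrite ger0_norm // mul1r.
    by rewrite ltr0_norm // mulN1r opprK.
  have K s : s ^+ 2 = 1 -> half s `<=` circle.
    move=> s1 _ [x xI <-]; rewrite /circle /= /cabs /re /im /=.
    have x1 : 0 <= 1 - x ^+ 2.
      move: xI; rewrite /= in_itv /= => /andP[x1 x2].
      have : 0 <= (1 - x) * (1 + x) by rewrite mulr_ge0 //; lra.
      lra.
    by rewrite exprMn s1 mul1r sqr_sqrtr // addrC subrK sqrtr1.
  by move=> [|]; apply: K; rewrite ?sqrrN expr1n.
apply: connectedU => //; exists (mkc 1 0).
have P s : half s (mkc 1 0).
  exists 1; first by rewrite /= in_itv /= lexx andbT; lra.
  by rewrite expr1n subrr sqrtr0 mulr0.
by split.
Qed.

Lemma half_expS (n : nat) : (2^-1 : R) ^+ n = 2 * 2^-1 ^+ n.+1.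
Proof. by rewrite exprS mulrA divff ?mul1r. Qed.

Lemma real_geom_complete (u : nat -> R) :
  (forall n, `|u n.+1 - u n| <= 2^-1 ^+ n) ->
  exists l, forall n, `|l - u n| <= 2 * 2^-1 ^+ n.
Proof.
move=> H.
have K n m : `|u (n + m)%N - u n| <= 2 * 2^-1 ^+ n - 2 * 2^-1 ^+ (n + m).
  elim: m => [|m IH]; first by rewrite addn0 !subrr normr0.
  rewrite addnS.
  have -> : u (n + m).+1 - u n = (u (n + m).+1 - u (n + m)%N) + (u (n + m)%N - u n) by ring.
  apply: le_trans (ler_normD _ _) _.
  have := H (n + m)%N; have := half_expS (n + m); move: IH.
  set a := 2^-1 ^+ _; set b := 2^-1 ^+ _; set c := 2^-1 ^+ _; lra.
have hp n : 0 < (2^-1 : R) ^+ n by rewrite exprn_gt0 // invr_gt0.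
have K' n m : (n <= m)%N -> `|u m - u n| <= 2 * 2^-1 ^+ n.
  move=> /subnKC <-; apply: le_trans (K _ _) _.
  by have := hp (n + (m - n))%N; lra.
have cu : cvgn u.
  apply/cauchy_cvgP/cauchy_exP => e e0.
  have h0 : (fun n => 2 * (2^-1 : R) ^+ n) @ \oo --> (0 : R).
    rewrite -[X in _ --> X](mulr0 2); apply: cvgM; first exact: cvg_cst.
    by apply: cvg_expr; rewrite ger0_norm ?invr_ge0 // invf_lt1 // ltr1n.
  have /cvgrPdist_lt/(_ e e0)[N _ HN] := h0.
  exists (u N); exists N => // m /= Nm; rewrite /ball /= distrC.
  apply: le_lt_trans (K' _ _ Nm) _.
  by have := HN N (leqnn N); rewrite /= sub0r normrN ger0_norm // mulr_ge0 // ltW.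
exists (limn u) => n.
have cu' : (fun m => `|u m - u n|) @ \oo --> `|limn u - u n|.
  by apply: cvg_norm; apply: cvgB => //; exact: cvg_cst.
rewrite -(cvg_lim _ cu') //.
apply: limr_le; first by apply/cvg_ex; eexists; exact: cu'.
by exists n => // m /= nm; exact: K'.
Qed.

(** The constant 8 adds up the bound 2 for each of the four real coordinates. *)
Lemma Q_geom_complete (u : nat -> Q) :
  (forall n, nq (u n.+1 - u n) <= 2^-1 ^+ n) ->
  exists l, forall n, nq (l - u n) <= 8 * 2^-1 ^+ n.
Proof.
move=> H.
have H1 n : cabs ((u n.+1).1 - (u n).1) <= 2^-1 ^+ n.
  exact: le_trans (nq_fst (u n.+1 - u n)) (H n).
have H2 n : cabs ((u n.+1).2 - (u n).2) <= 2^-1 ^+ n.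
  exact: le_trans (nq_snd (u n.+1 - u n)) (H n).
have K (g : C -> R) (z : nat -> C) : (forall z w, `|g z - g w| <= cabs (z - w)) ->
    (forall n, cabs (z n.+1 - z n) <= 2^-1 ^+ n) ->
    exists l, forall n, `|l - g (z n)| <= 2 * 2^-1 ^+ n.
  by move=> Hg Hz; apply: real_geom_complete => n; exact: le_trans (Hg _ _) (Hz n).
have Kr (z w : C) : `|re z - re w| <= cabs (z - w) by rewrite -reN -reD re_le.
have Ki (z w : C) : `|im z - im w| <= cabs (z - w) by rewrite -imN -imD im_le.
have [a Ha] := K _ _ Kr H1; have [b Hb] := K _ _ Ki H1.
have [c Hc] := K _ _ Kr H2; have [d Hd] := K _ _ Ki H2.
exists (mkc a b, mkc c d) => n; apply: le_trans (nq_le _) _ => /=.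
have := cabs_le (mkc a b - (u n).1); have := cabs_le (mkc c d - (u n).2).
rewrite !reD !imD !reN !imN /=.
have := Ha n; have := Hb n; have := Hc n; have := Hd n; rewrite /re /im; lra.
Qed.

End continuity.

(** * Inversions *)

Section inversion.
Context {R : realType}.
Local Notation C := (Cx R).
Local Notation Q := (C * C)%type.
Implicit Types (c p q : Q) (r a b : R) (z w : C).

(** Division by zero sends the centre to itself instead of to infinity. The map is thus an
    involution of the whole of [Q], but it is not continuous at [c]. *)
Definition inversion c r q : Q := c + rc (r ^+ 2 / nq (q - c) ^+ 2) *: (q - c).

Lemma inversion_center c r : inversion c r c = c.
Proof. by rewrite /inversion subrr scaler0 addr0. Qed.

Lemma nq_gt0 q : (0 < nq q) = (q != 0).
Proof. by rewrite lt_neqAle nq_ge0 eq_sym nq_eq0 andbT. Qed.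

Lemma nqB_gt0 p q : (0 < nq (p - q)) = (p != q).
Proof. by rewrite nq_gt0 subr_eq0. Qed.

Lemma nq_inversion c r q : nq (inversion c r q - c) = r ^+ 2 / nq (q - c).
Proof.
rewrite /inversion addrC addKr nqZ ger0_norm ?divr_ge0 ?sqr_ge0 //.
have [->|n0] := eqVneq (nq (q - c)) 0; first by rewrite mulr0 invr0 mulr0.
by field.
Qed.

Lemma rcZA a b q : rc a *: (rc b *: q) = rc (a * b) *: q.
Proof. by rewrite scalerA rcM. Qed.

Lemma inversionK c r : r != 0 -> involutive (inversion c r).
Proof.
move=> r0 q; have [->|qc] := eqVneq q c; first by rewrite !inversion_center.
rewrite {1}/inversion nq_inversion.
rewrite (_ : inversion c r q - c = rc (r ^+ 2 / nq (q - c) ^+ 2) *: (q - c)); last first.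
  by rewrite /inversion addrAC subrr add0r.
rewrite rcZA.
have n0 : nq (q - c) != 0 by rewrite nq_eq0 subr_eq0.
rewrite (_ : _ * _ = 1); first by rewrite rc1 scale1r addrC subrK.
by field; rewrite n0.
Qed.

Lemma inversion_sphere c r q : nq (q - c) = r -> inversion c r q = q.
Proof.
move=> <-; rewrite /inversion.
have [->|n0] := eqVneq q c; first by rewrite subrr scaler0 addr0.
rewrite divff; last by rewrite sqrf_eq0 nq_eq0 subr_eq0.
by rewrite rc1 scale1r addrC subrK.
Qed.

Lemma inversion_dist c r p q : p != c -> q != c ->
  nq (inversion c r p - inversion c r q) =
  r ^+ 2 * nq (p - q) / (nq (p - c) * nq (q - c)).
Proof.
move=> pc qc.
have np : 0 < nq (p - c) by rewrite nqB_gt0.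
have nq0 : 0 < nq (q - c) by rewrite nqB_gt0.
apply/eqP; rewrite -(@eqrXn2 _ 2) ?nq_ge0 //; last first.
  by apply: divr_ge0; apply: mulr_ge0; rewrite ?sqr_ge0 ?nq_ge0.
apply/eqP; rewrite expr_div_n !exprMn.
have -> : inversion c r p - inversion c r q =
    rc (r ^+ 2 / nq (p - c) ^+ 2) *: (p - c) - rc (r ^+ 2 / nq (q - c) ^+ 2) *: (q - c).
  by rewrite /inversion opprD addrACA subrr add0r.
rewrite (sqr_nqB (rc _ *: _)) !nqZ !exprMn dotqZr [dotq (rc _ *: _) _]dotqC dotqZr.
rewrite (_ : p - q = (p - c) - (q - c)); last by rewrite opprB addrA subrK.
rewrite (sqr_nqB (p - c) (q - c)) !real_normK ?num_real //.
by rewrite (dotqC (q - c)); field; rewrite !gt_eqF.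
Qed.

Lemma cvgQ_fst {T : Type} (F : set_system T) {FF : Filter F} (g : T -> Q) q :
  g @ F --> q -> (fun x => (g x).1) @ F --> q.1.
Proof.
move=> gq; apply: cvgCI => e e0; apply: filterS (cvgQE gq e0) => x.
exact: le_lt_trans (nq_fst (g x - q)).
Qed.

Lemma cvgQ_snd {T : Type} (F : set_system T) {FF : Filter F} (g : T -> Q) q :
  g @ F --> q -> (fun x => (g x).2) @ F --> q.2.
Proof.
move=> gq; apply: cvgCI => e e0; apply: filterS (cvgQE gq e0) => x.
exact: le_lt_trans (nq_snd (g x - q)).
Qed.

Lemma cvgQ_pair {T : Type} (F : set_system T) {FF : Filter F} (f g : T -> C) z w :
  f @ F --> z -> g @ F --> w -> (fun x => (f x, g x) : Q) @ F --> ((z, w) : Q).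
Proof.
move=> fz gw; apply: cvgQI => e e0.
have e20 : 0 < e / 2 by rewrite divr_gt0.
near=> x; apply: le_lt_trans (nq_le _) _; rewrite /= (splitr e) ltrD //.
  by near: x; exact: cvgCE fz e20.
by near: x; exact: cvgCE gw e20.
Unshelve. all: by end_near. Qed.

Lemma cvg_scaleQ {T : Type} (F : set_system T) {FF : Filter F} (f : T -> R) (g : T -> Q) a q :
  f @ F --> a -> g @ F --> q -> (fun x => rc (f x) *: g x) @ F --> rc a *: q.
Proof.
move=> fa gq.
have fa' : (fun x => rc (f x)) @ F --> (rc a : C).
  by apply: continuous_cvg => //; exact: continuous_rc.
have g1 : (fun x => (g x).1) @ F --> q.1 by apply: cvgQ_fst.
have g2 : (fun x => (g x).2) @ F --> q.2 by apply: cvgQ_snd.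
have -> : (fun x => rc (f x) *: g x) = (fun x => (rc (f x) * (g x).1, rc (f x) * (g x).2)).
  by apply/funext => x; case: (g x).
have -> : rc a *: q = (rc a * q.1, rc a * q.2) by case: (q).
apply: cvgQ_pair; [exact: (cvgM fa' g1)|exact: (cvgM fa' g2)].
Qed.

Lemma cvgQ_D {T : Type} (F : set_system T) {FF : Filter F} (f g : T -> Q) p q :
  f @ F --> p -> g @ F --> q -> (fun x => f x + g x) @ F --> p + q.
Proof.
move=> fp gq; apply: cvgQI => e e0.
have e20 : 0 < e / 2 by rewrite divr_gt0.
near=> x; rewrite opprD addrACA.
apply: le_lt_trans (nqD _ _) _; rewrite (splitr e) ltrD //.
  by near: x; exact: cvgQE fp e20.
by near: x; exact: cvgQE gq e20.
Unshelve. all: by end_near. Qed.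

Lemma cvgQ_cst {T : Type} (F : set_system T) {FF : Filter F} q :
  (fun _ : T => q) @ F --> q.
Proof. by apply: cvgQI => e e0; near=> x; rewrite subrr nq0.
Unshelve. all: by end_near. Qed.

Lemma cont_inversion c r q : q != c -> {for q, continuous (inversion c r)}.
Proof.
move=> qc.
have h : (fun x : Q => x - c) @ nbhs q --> q - c.
  by apply: (@cvgQ_D _ (nbhs q)); [exact: cvg_id|exact: cvgQ_cst].
have n : (fun x => nq (x - c)) @ nbhs q --> nq (q - c).
  by apply: continuous_cvg => //; exact: cont_nq.
have n2 : (fun x => r ^+ 2 / nq (x - c) ^+ 2) @ nbhs q --> r ^+ 2 / nq (q - c) ^+ 2.
  apply: cvgM; first exact: cvg_cst.
  apply: cvgV; first by rewrite sqrf_eq0 nq_eq0 subr_eq0.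
  exact: (cvg_comp _ _ n (@exprn_continuous R 2 (nq (q - c)))).
have sc := @cvg_scaleQ _ (nbhs q) _ _ _ _ _ n2 h.
by apply: (@cvgQ_D _ (nbhs q)); [exact: cvgQ_cst|exact: sc].
Qed.

Lemma cjV z : cj z^-1 = (cj z)^-1.
Proof.
have [->|z0] := eqVneq z 0; first by rewrite invr0 -rc0 cj_rc rc0 invr0.
apply: (@mulfI _ (cj z)); rewrite ?cj_eq0 // -cjM !divff ?cj_eq0 //.
by rewrite -rc1 cj_rc.
Qed.

(** The inversion of the plane in the circle of radius [r] about [0], again with [0] sent to
    itself. *)
Definition pinv r z : C := rc (r ^+ 2) / cj z.

Lemma pinvK r : r != 0 -> involutive (pinv r).
Proof.
move=> r0 z; rewrite /pinv cjM cjV cjK cj_rc invfM invrK mulrA divff ?mul1r //.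
by rewrite rc_eq0 expf_neq0.
Qed.

Lemma cabs_pinv r z : cabs (pinv r z) = r ^+ 2 / cabs z.
Proof. by rewrite cabsM cabsV cabs_rc cabs_cj ger0_norm ?sqr_ge0. Qed.

Lemma pinv_circle r z : 0 < r -> cabs z = r -> pinv r z = z.
Proof.
move=> r0 zr; have z0 : z != 0 by rewrite -cabs_eq0 zr gt_eqF.
by rewrite /pinv -zr -mul_cj mulfK // cj_eq0.
Qed.

Lemma pinv_dist r z w : z != 0 -> w != 0 ->
  cabs (pinv r z - pinv r w) = r ^+ 2 * cabs (z - w) / (cabs z * cabs w).
Proof.
move=> z0 w0.
have -> : pinv r z - pinv r w = rc (r ^+ 2) * (cj (w - z)) / (cj z * cj w).
  by rewrite /pinv cjD cjN; field; rewrite !cj_eq0 z0 w0.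
by rewrite !cabsM cabsV cabsM !cabs_cj cabs_rc ger0_norm ?sqr_ge0 // cabsB.
Qed.

Lemma cont_pinv r z : z != 0 -> {for z, continuous (pinv r)}.
Proof.
move=> z0.
have h : (fun x => (cj x)^-1) @ nbhs z --> (cj z)^-1.
  by apply: (@cvgV _ _ (nbhs z)); [rewrite cj_eq0|exact: (@continuous_cj R z)].
exact: (cvgM (cvg_cst _) h).
Qed.

End inversion.

(** * The limit sphere *)

Section cusp.
Context {R : realType}.
Local Notation C := (Cx R).
Local Notation Q := (C * C)%type.

Definition cusp (t : C) : Q := (t ^+ 2, t ^+ 3).

Lemma cusp_inj : injective cusp.
Proof.
move=> s t [e2 e3]; have [s0|s0] := eqVneq s 0.
  by move: e2; rewrite s0 expr0n => /esym/eqP; rewrite sqrf_eq0 => /eqP ->.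
apply: (@mulfI _ (s ^+ 2)); first by rewrite expf_neq0.
by rewrite -exprSr e3 e2 -exprSr.
Qed.

Lemma cvg_exp {T : Type} (F : set_system T) {FF : Filter F} (f : T -> C) (z : C) n :
  f @ F --> z -> (fun x => f x ^+ n) @ F --> z ^+ n.
Proof.
move=> fz; elim: n => [|n IH].
  rewrite expr0 (_ : (fun _ => _) = cst 1); first exact: cvg_cst.
  by apply/funext => x; rewrite expr0.
rewrite exprS (_ : (fun _ => _) = (fun x => f x * f x ^+ n)); first exact: cvgM.
by apply/funext => x; rewrite exprS.
Qed.

Lemma cont_cusp t : {for t, continuous cusp}.
Proof.
have h : (fun x : C => x) @ nbhs t --> t by exact: cvg_id.
exact: (@cvgQ_pair _ _ _ _ _ _ _ _ (@cvg_exp _ _ _ _ _ 2 h) (@cvg_exp _ _ _ _ _ 3 h)).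
Qed.

Lemma cusp_proper t : cabs t <= 1 + nq (cusp t).
Proof.
have h : cabs t ^+ 2 <= nq (cusp t).
  by rewrite -cabsX; exact: (nq_fst (cusp t)).
have := sqr_ge0 (cabs t - 1); have := cabs_ge0 t; move: h; nra.
Qed.

Lemma cusp0 : cusp 0 = 0. Proof. by rewrite /cusp !expr0n. Qed.

End cusp.

(* Balls with centre [cusp (bt i)] and radius [br i].  The involution [bk i] of
   the parameter does to the curve what the inversion in the ball does to space:
   it fixes the trace of the sphere and exchanges its two sides.  By [b_local]
   the slope [x.2 / x.1] is a good approximation of the parameter in a ball. *)
Record ball_system (R : realType) := BallSystem {
  bt : nat -> Cx R;
  br : nat -> R;
  bk : nat -> Cx R -> Cx R;
  br_gt0 : forall i, 0 < br i;
  br_le : forall i, br i <= 2^-1 ^+ i.+1;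
  br_sep : forall i j x, (j < i)%N -> nq (x - cusp (bt j)) <= br j ->
    2 ^+ i.+1 * br i <= nq (x - cusp (bt i));
  bkK : forall i, involutive (bk i);
  bk_center : forall i, bk i (bt i) = bt i;
  bk_sphere : forall i t, nq (cusp t - cusp (bt i)) = br i -> bk i t = t;
  bk_in : forall i t, t != bt i -> nq (cusp t - cusp (bt i)) < br i ->
    br i < nq (cusp (bk i t) - cusp (bt i));
  bk_out : forall i t, br i < nq (cusp t - cusp (bt i)) ->
    nq (cusp (bk i t) - cusp (bt i)) < br i;
  bk_cont : forall i t, t != bt i -> {for t, continuous (bk i)};
  bk_infty : forall i M, exists2 d : R, 0 < d &
    forall t, t != bt i -> cabs (t - bt i) < d -> M <= cabs (bk i t);
  bk_lip1 : forall i s t, br i <= nq (cusp s - cusp (bt i)) ->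
    br i <= nq (cusp t - cusp (bt i)) ->
    cabs (bk i s - bk i t) <= 4 * cabs (s - t);
  bk_lip2 : forall i j s t, (j < i)%N -> nq (cusp s - cusp (bt j)) <= br j ->
    nq (cusp t - cusp (bt j)) <= br j ->
    cabs (bk i s - bk i t) <= 8^-1 ^+ i.+1 * cabs (s - t);
  bk_diam : forall i t, nq (cusp t - cusp (bt i)) <= br i ->
    cabs (t - bt i) <= 8^-1 ^+ i;
  b_local : forall i x, nq (x - cusp (bt i)) <= br i ->
    [/\ x.1 != 0, x.2 != 0 &
        cabs (x.1 - (x.2 / x.1) ^+ 2) <= cabs (x.2 / x.1) ^+ 2 / 64];
  b_dense : forall (z : Cx R) (e : R), 0 < e -> exists j s,
    nq (cusp s - cusp (bt j)) < br j /\ cabs (s - z) < e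
}.

Section limit_sphere.
Context {R : realType} (S : ball_system R).
Local Notation C := (Cx R).
Local Notation Q := (C * C)%type.
Implicit Types (i j n : nat) (s t z : C) (x y p q : Q).

Definition bc i : Q := cusp (bt S i).
Definition rad i x : R := nq (x - bc i).
Lemma radE i x : rad i x = nq (x - bc i). Proof. by []. Qed.
Local Notation r := (br S).
Definition refl i : Q -> Q := inversion (bc i) (r i).

Lemma half_gt0 n : 0 < (2^-1 : R) ^+ n.
Proof. by rewrite exprn_gt0 // invr_gt0. Qed.
Lemma half_le1 n : (2^-1 : R) ^+ n <= 1.
Proof. by apply: exprn_ile1; rewrite ?invr_ge0 ?invf_le1 ?ler1n. Qed.

Lemma le_half_le0 (a M : R) : (forall n, a <= M * 2^-1 ^+ n) -> a <= 0.
Proof.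
move=> H; rewrite leNgt; apply/negP => a0.
have h0 : (fun n => M * (2^-1 : R) ^+ n) @ \oo --> (0 : R).
  rewrite -[X in _ --> X](mulr0 M); apply: cvgM; first exact: cvg_cst.
  by apply: cvg_expr; rewrite ger0_norm ?invr_ge0 // invf_lt1 // ltr1n.
have /cvgrPdist_lt/(_ a a0)[N _ HN] := h0.
have := HN N (leqnn N); rewrite /= sub0r normrN => h.
have := le_lt_trans (le_trans (H N) (ler_norm _)) h.
by rewrite ltxx.
Qed.

Lemma exists_half_lt (e : R) : 0 < e -> exists N, 2^-1 ^+ N < e.
Proof.
move=> e0; apply: contrapT => H.
have : e <= 0.
  apply: (@le_half_le0 _ 1) => n; rewrite mul1r leNgt; apply/negP => h.
  by apply: H; exists n.
by rewrite leNgt e0.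
Qed.

Lemma half_mono n m : (n <= m)%N -> (2^-1 : R) ^+ m <= 2^-1 ^+ n.
Proof. by move=> h; apply: ler_wiXn2l; rewrite ?invr_ge0 ?invf_le1 ?ler1n. Qed.

Lemma refl_center i : refl i (bc i) = bc i. Proof. exact: inversion_center. Qed.
Lemma reflK i : involutive (refl i).
Proof. by apply: inversionK; rewrite gt_eqF // br_gt0. Qed.
Lemma rad_refl i x : rad i (refl i x) = r i ^+ 2 / rad i x.
Proof. exact: nq_inversion. Qed.
Lemma rad_gt0 i x : (0 < rad i x) = (x != bc i). Proof. exact: nqB_gt0. Qed.
Lemma refl_sphere i x : rad i x = r i -> refl i x = x.
Proof. exact: inversion_sphere. Qed.

Lemma refl_in i x : x != bc i -> rad i x < r i -> r i < rad i (refl i x).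
Proof.
rewrite -rad_gt0 rad_refl => x0 xr.
by rewrite ltr_pdivlMr // expr2 ltr_pM2l // br_gt0.
Qed.
Lemma refl_out i x : r i < rad i x -> rad i (refl i x) < r i.
Proof.
rewrite rad_refl => xr; have r0 := br_gt0 S i.
by rewrite ltr_pdivrMr ?(lt_trans r0) // expr2 ltr_pM2l.
Qed.
Lemma refl_out_le i x : r i <= rad i x -> rad i (refl i x) <= r i.
Proof.
rewrite rad_refl => xr; have r0 := br_gt0 S i.
by rewrite ler_pdivrMr ?(lt_le_trans r0) // expr2 ler_pM2l.
Qed.

Lemma refl_lip1 i x y : r i <= rad i x -> r i <= rad i y ->
  nq (refl i x - refl i y) <= nq (x - y).
Proof.
move=> xr yr; have r0 := br_gt0 S i.
have x0 : 0 < rad i x by exact: lt_le_trans xr.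
have y0 : 0 < rad i y by exact: lt_le_trans yr.
rewrite inversion_dist -?rad_gt0 // -!/(rad i _).
rewrite ler_pdivrMr ?mulr_gt0 // mulrC ler_wpM2l ?nq_ge0 // expr2.
by rewrite ler_pM // ltW.
Qed.

(** Separation is imposed on a later ball with respect to the earlier ones; as its factor exceeds 1,
    disjointness follows in both orders. *)
Lemma ball_disjoint i j x : i != j -> rad j x <= r j -> r i < rad i x.
Proof.
wlog : i j / (j < i)%N.
  move=> H; case: ltngtP => // h _; first last.
    by apply: H => //; rewrite gt_eqF.
  move=> xj; rewrite ltNge; apply/negP => xi.
  have := H j i h; rewrite gtn_eqF // => /(_ isT xi).
  by rewrite ltNge xj.
move=> ji _ xj; apply: lt_le_trans (br_sep ji xj).
rewrite ltr_pMl ?br_gt0 // exprn_egt1 // ltr1n //.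
Qed.

(** Both points are at distance at least [2 ^+ i.+1] radii from the centre, and an inversion
    contracts by the product of these two relative distances. *)
Lemma refl_lip2 i j x y : (j < i)%N -> rad j x <= r j -> rad j y <= r j ->
  nq (refl i x - refl i y) <= 4^-1 ^+ i.+1 * nq (x - y).
Proof.
move=> ji xj yj.
have hx := br_sep ji xj; have hy := br_sep ji yj.
have r0 := br_gt0 S i.
have p0 : 0 < 2 ^+ i.+1 * r i by rewrite mulr_gt0 // exprn_gt0.
have x0 : 0 < rad i x by exact: lt_le_trans hx.
have y0 : 0 < rad i y by exact: lt_le_trans hy.
rewrite inversion_dist -?rad_gt0 // -!/(rad i _).
rewrite ler_pdivrMr ?mulr_gt0 // [leRHS]mulrAC ler_wpM2r ?nq_ge0 //.
apply: (@le_trans _ _ (4^-1 ^+ i.+1 * ((2 ^+ i.+1 * r i) * (2 ^+ i.+1 * r i)))).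
  have -> : 2 ^+ i.+1 * r i * (2 ^+ i.+1 * r i) = 4 ^+ i.+1 * r i ^+ 2.
    rewrite (_ : (4 : R) = 2 * 2); last by ring.
    by rewrite exprMn; ring.
  by rewrite mulrA -exprMn mulVf // expr1n mul1r.
rewrite ler_wpM2l ?exprn_ge0 ?invr_ge0 //.
by apply: ler_pM => //; rewrite ltW.
Qed.

(** The distance allowed between two points of the [i]-th ball whose itineraries agree for [n]
    further reflections; for [n = 0] it bounds the diameter of the ball. *)
Definition wt n i : R := 2^-1 ^+ i * 2^-1 ^+ n.

Lemma wt_gt0 n i : 0 < wt n i. Proof. by rewrite mulr_gt0 ?half_gt0. Qed.

Lemma wt_le n i : wt n i <= 2^-1 ^+ n.
Proof. by rewrite ler_piMl ?half_le1 // ltW ?half_gt0. Qed.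

Lemma ball_diam i x y : rad i x <= r i -> rad i y <= r i -> nq (x - y) <= wt 0 i.
Proof.
move=> xi yi; apply: le_trans (nq_tri x y (bc i)) _.
rewrite (nqB (bc i)) -!/(rad i _) /wt expr0 mulr1.
have := br_le S i; have := half_expS (R := R) i.
by move: xi yi; lra.
Qed.

(** If [j < i], the reflection itself contracts, by [refl_lip2]. If [i < j], it merely does not
    expand, but replacing [2^-1 ^+ j] by [2^-1 ^+ i] already gains the required factor 2. *)
Lemma refl_contract i j n x y : i != j -> rad j x <= r j -> rad j y <= r j ->
  nq (x - y) <= wt n j -> nq (refl i x - refl i y) <= wt n.+1 i.
Proof.
move=> ij xj yj xy.
have xi := ltW (ball_disjoint ij xj); have yi := ltW (ball_disjoint ij yj).
have n0 := half_gt0 n.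
have [ji|ij'] := ltnP j i; last first.
  have {}ij' : (i < j)%N by rewrite ltn_neqAle ij.
  apply: le_trans (refl_lip1 xi yi) _; apply: le_trans xy _.
  rewrite /wt (half_expS n) mulrA (ler_wpM2r (ltW (half_gt0 n.+1))) //.
  apply: (@le_trans _ _ (2^-1 ^+ i.+1 * 2)); first by rewrite ler_wpM2r // half_mono.
  by rewrite mulrC -half_expS.
apply: le_trans (refl_lip2 ji xj yj) _.
have h4 : 0 <= (4^-1 : R) ^+ i.+1 by rewrite exprn_ge0 ?invr_ge0.
apply: (@le_trans _ _ (4^-1 ^+ i.+1 * 2^-1 ^+ n)).
  by rewrite ler_wpM2l // (le_trans xy) // wt_le.
rewrite /wt (half_expS n) mulrA (ler_wpM2r (ltW (half_gt0 n.+1))) //.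
have -> : (4^-1 : R) = 2^-1 * 2^-1 by field.
rewrite exprMn (half_expS i).
have := half_le1 i.+1; have := half_gt0 i.+1; nra.
Qed.

End limit_sphere.

(** * The limit map of the parameter plane and its injectivity *)

Section limit_map.
Context {R : realType} (S : ball_system R).
Local Notation C := (Cx R).
Local Notation Q := (C * C)%type.
Implicit Types (i j n : nat) (s t z : C) (x y p q : Q).
Local Notation r := (br S).
Local Notation k := (bk S).
Local Notation t_ := (bt S).
Local Notation c := (bc S).
Local Notation rad := (rad S).
Local Notation refl := (refl S).
Local Notation d i t := (rad i (cusp t)).

Definition loc t : option nat :=
  if pselect (exists i, d i t < r i) is left h then Some (projT1 (cid h)) else None.

Lemma ball_uniq i j x : rad i x <= r i -> rad j x <= r j -> i = j.
Proof.
move=> xi xj; apply/eqP; apply: contraT => ij.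
by have := ball_disjoint ij xj; rewrite ltNge xi.
Qed.

Lemma loc_some i t : d i t < r i -> loc t = Some i.
Proof.
move=> ti; rewrite /loc; case: pselect => [h|[]]; last by exists i.
by congr Some; apply: ball_uniq (ltW ti); exact: ltW (projT2 (cid h)).
Qed.

Variant loc_spec t : option nat -> Prop :=
| LocSome i of d i t < r i : loc_spec t (Some i)
| LocNone of (forall i, r i <= d i t) : loc_spec t None.

Lemma locP t : loc_spec t (loc t).
Proof.
case E : (loc t) => [i|]; constructor.
  by move: E; rewrite /loc; case: pselect => // h [<-]; exact: projT2 (cid h).
move=> i; rewrite leNgt; apply/negP => ti.
by rewrite (loc_some ti) in E.
Qed.

Lemma rad_center i : rad i (c i) = 0. Proof. by rewrite !radE subrr nq0. Qed.

Lemma center_in i : d i (t_ i) < r i.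
Proof. by rewrite -/(c i) rad_center br_gt0. Qed.

(* Inside the [i]-th ball the curve is replaced by the reflection of its part
   outside, [n] times. *)
Fixpoint approx n t : Q :=
  if n is m.+1 then
    if loc t is Some i then refl i (approx m (k i t)) else cusp t
  else cusp t.

Lemma approxS n t : approx n.+1 t =
  if loc t is Some i then refl i (approx n (k i t)) else cusp t.
Proof. by []. Qed.

Lemma approx_center n i : approx n (t_ i) = c i.
Proof.
elim: n => [//|n IH] /=.
by rewrite (loc_some (center_in i)) bk_center IH refl_center.
Qed.

Lemma approx_in n i t : d i t < r i -> rad i (approx n t) < r i.
Proof.
elim: n i t => [//|n IH] i t ti /=; rewrite (loc_some ti).
have [->|tc] := eqVneq t (t_ i).
  by rewrite bk_center approx_center refl_center rad_center br_gt0.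
apply: refl_out; have := bk_in tc ti; rewrite -!/(rad i _) => h.
case: n IH => [//|n] IH /=.
case: (locP (k i t)) => [j kj|_] //.
have ij : i != j.
  by apply/eqP => e; move: kj; rewrite -e ltNge ltW.
apply: (ball_disjoint ij); have := IH j (k i t) kj.
by rewrite /= (loc_some kj) => /ltW.
Qed.

Lemma approx_out n i t : r i < d i t -> r i < rad i (approx n t).
Proof.
case: n => [//|n] ti /=.
case: (locP t) => [j kj|_] //.
have ij : i != j.
  by apply/eqP => e; move: ti; rewrite e ltNge ltW.
apply: (ball_disjoint ij); have := @approx_in n.+1 j t kj.
by rewrite /= (loc_some kj) => /ltW.
Qed.

(** The two approximations first differ after [n] reflections along the same itinerary, and each of
    these pays one factor through [refl_contract]. *)
Lemma approx_step n t : nq (approx n.+1 t - approx n t) <=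
  if loc t is Some i then wt n i else 0.
Proof.
elim: n t => [|n IH] t.
  rewrite /=; case: (locP t) => [i ti|_]; last by rewrite subrr nq0.
  apply: (ball_diam (S := S) (i := i)); last exact: ltW.
  have := @approx_in 1 i t ti; rewrite /= (loc_some ti) => /ltW; exact.
have [->|] := eqVneq (approx n.+2 t) (approx n.+1 t).
  by rewrite subrr nq0; case: (loc t) => // i; rewrite ltW // wt_gt0.
rewrite (approxS n.+1 t) (approxS n t).
case: (locP t) => [i ti|_]; last by rewrite eqxx.
have [->|tc _] := eqVneq t (t_ i).
  by rewrite bk_center !approx_center eqxx.
have h := bk_in tc ti; rewrite -!/(rad i _) in h.
have := IH (k i t).
case: (locP (k i t)) => [j kj|_] hj.
  have ij : i != j.
    by apply/eqP => e; move: kj; rewrite -e ltNge ltW.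
  by apply: (refl_contract ij _ _ hj); rewrite ltW // approx_in.
have /eqP : nq (approx n.+1 (k i t) - approx n (k i t)) = 0.
  by apply/eqP; rewrite eq_le hj nq_ge0.
by rewrite nq_eq0 subr_eq0 => /eqP ->; rewrite subrr nq0 ltW // wt_gt0.
Qed.

Lemma approx_cvg t : exists l, forall n, nq (l - approx n t) <= 8 * 2^-1 ^+ n.
Proof.
apply: Q_geom_complete => n; apply: le_trans (approx_step _ _) _.
by case: (loc t) => [i|]; [exact: wt_le|rewrite ltW // half_gt0].
Qed.

Definition limap t : Q := projT1 (cid (approx_cvg t)).
Local Notation f := limap.

Lemma limapP t n : nq (f t - approx n t) <= 8 * 2^-1 ^+ n.
Proof. exact: (projT2 (cid (approx_cvg t))). Qed.

Lemma nq_eq_half p q (M : R) : (forall n, nq (p - q) <= M * 2^-1 ^+ n) -> p = q.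
Proof.
move=> /le_half_le0 h; apply/eqP; rewrite -subr_eq0 -nq_eq0.
by rewrite eq_le h nq_ge0.
Qed.

Lemma limap_cusp t : (forall i, r i <= d i t) -> f t = cusp t.
Proof.
move=> h; apply: (@nq_eq_half _ _ 8) => n.
have -> : cusp t = approx n t; last exact: limapP.
case: n => //= n; case: (locP t) => // i ti.
by have := h i; rewrite leNgt ti.
Qed.

Lemma limap_center i : f (t_ i) = c i.
Proof.
by apply: (@nq_eq_half _ _ 8) => n; rewrite -(approx_center n i); exact: limapP.
Qed.

Lemma limap_in_le i t : d i t < r i -> rad i (f t) <= r i.
Proof.
move=> ti; rewrite -subr_le0; apply: (@le_half_le0 _ _ 8) => n.
rewrite lerBlDr; apply: le_trans (nq_tri _ _ (approx n t)) _.
apply: lerD; first exact: limapP.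
by apply: ltW; apply: approx_in.
Qed.

Lemma limap_out i t : r i < d i t -> r i < rad i (f t).
Proof.
move=> ti; case: (locP t) => [j tj|h]; last by rewrite limap_cusp.
have ij : i != j.
  by apply/eqP => e; move: ti; rewrite e ltNge ltW.
by apply: (ball_disjoint ij); exact: limap_in_le.
Qed.

Lemma bk_in' i t : t != t_ i -> d i t < r i -> r i < d i (k i t).
Proof. exact: bk_in. Qed.

(** The functional equation that characterizes the limit map. It passes from the approximations to
    the limit because [refl i] does not expand distances outside its ball. *)
Lemma limap_refl i t : d i t < r i -> f t = refl i (f (k i t)).
Proof.
move=> ti; have [->|tc] := eqVneq t (t_ i).
  by rewrite bk_center limap_center refl_center.
have h := bk_in' tc ti.
apply: (@nq_eq_half _ _ 16) => n.
apply: le_trans (nq_tri _ _ (approx n.+1 t)) _.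
have h1 := limapP t n.+1; have h2 := limapP (k i t) n.
have h3 : nq (approx n.+1 t - refl i (f (k i t))) <= nq (f (k i t) - approx n (k i t)).
  rewrite /= (loc_some ti) nqB; apply: refl_lip1; apply: ltW.
    exact: limap_out.
  exact: approx_out.
have := half_expS (R := R) n; have := half_gt0 (R := R) n.
move: h1 h2 h3; lra.
Qed.

Lemma limap_in i t : d i t < r i -> rad i (f t) < r i.
Proof.
move=> ti; have [->|tc] := eqVneq t (t_ i).
  by rewrite limap_center rad_center br_gt0.
by rewrite (limap_refl ti); apply: refl_out; apply: limap_out; exact: bk_in'.
Qed.

Lemma limap_sphere i t : d i t = r i -> f t = cusp t.
Proof.
move=> ti; apply: limap_cusp => j; have [->|ji] := eqVneq j i; first by rewrite ti.
by rewrite ltW // (ball_disjoint ji) // ti.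
Qed.

Lemma limap_refl_le i t : d i t <= r i -> f t = refl i (f (k i t)).
Proof.
rewrite le_eqVlt => /orP[/eqP ti|]; last exact: limap_refl.
have -> : k i t = t by exact: bk_sphere.
by rewrite (limap_sphere ti) refl_sphere.
Qed.

Lemma limap_out_le i t : r i <= d i t -> r i <= rad i (f t).
Proof.
rewrite le_eqVlt => /orP[/eqP ti|/limap_out/ltW//].
by rewrite (limap_sphere (esym ti)) ti.
Qed.

Lemma limap_near t : nq (f t - cusp t) <= 1.
Proof.
case: (locP t) => [i ti|h]; last by rewrite limap_cusp // subrr nq0.
apply: le_trans (ball_diam (ltW (limap_in ti)) (ltW ti)) _.
by apply: le_trans (wt_le _ _) _; rewrite expr0.
Qed.

Lemma limap_proper t : cabs t <= 2 + nq (f t).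
Proof.
have := cusp_proper t; have := limap_near t; have := nq_sub (cusp t) (f t).
by rewrite (nqB (f t)); lra.
Qed.

(* The discs shrink along an itinerary, so two points with the same image,
   hence the same itinerary, coincide. *)
Lemma limap_inj_disc n i s t : d i s < r i -> d i t < r i -> f s = f t ->
  cabs (s - t) <= 2 * 8^-1 ^+ i * 2^-1 ^+ n.
Proof.
have p8 m : 0 < (8^-1 : R) ^+ m by rewrite exprn_gt0 // invr_gt0.
have W0 m j : 0 <= 2 * 8^-1 ^+ j * (2^-1 : R) ^+ m.
  by rewrite !mulr_ge0 // ltW // ?p8 ?half_gt0.
have base j u v : d j u < r j -> d j v < r j -> cabs (u - v) <= 2 * 8^-1 ^+ j.
  move=> uj vj; apply: le_trans (cabs_tri u v (t_ j)) _.
  rewrite (cabsB (t_ j)).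
  have := bk_diam (ltW uj); have := bk_diam (ltW vj); lra.
elim: n i s t => [|n IH] i s t si ti st.
  by rewrite expr0 mulr1 base.
have fc u : d i u < r i -> (f u == c i) = (u == t_ i).
  move=> ui; apply/eqP/eqP => [|->]; last exact: limap_center.
  move=> e; apply/eqP; apply: contraT => uc.
  have := limap_out (bk_in' uc ui).
  by rewrite -(reflK S i (f (k i u))) -limap_refl // e refl_center rad_center ltNge ltW // br_gt0.
have [sc|sc] := eqVneq s (t_ i).
  have : t == t_ i by rewrite -fc // -st sc limap_center.
  by move=> /eqP ->; rewrite sc subrr cabs0.
have tc : t != t_ i by rewrite -fc // -st fc.
have hs := bk_in' sc si; have ht := bk_in' tc ti.
have E : f (k i s) = f (k i t).
  by apply: (inv_inj (reflK S i)); rewrite -!limap_refl.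
rewrite -(bkK S i s) -(bkK S i t).
case: (locP (k i s)) => [j sj|hn].
  have ij : i != j by apply/eqP => e; move: sj; rewrite -e ltNge ltW.
  have tj : d j (k i t) < r j.
    have := limap_in sj; rewrite E; rewrite !ltNge; apply: contra.
    exact: limap_out_le.
  have := IH j _ _ sj tj E.
  have [ji|ij'] := ltnP j i.
    move=> h; apply: le_trans (bk_lip2 ji (ltW sj) (ltW tj)) _.
    apply: le_trans (ler_wpM2l (ltW (p8 i.+1)) h) _.
    rewrite (half_expS n) (exprS _ i).
    have a1 : (8^-1 : R) ^+ j <= 1.
      by apply: exprn_ile1; rewrite ?invr_ge0 ?invf_le1 ?ler1n.
    have := mulr_ge0 (ltW (p8 i)) (ltW (half_gt0 (R := R) n.+1)).
    have := p8 j.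
    set a := 8^-1 ^+ i; set b := 8^-1 ^+ j; set e := 2^-1 ^+ _ => b0 ae.
    have : 0 <= a * e * (1 - b) by rewrite mulr_ge0 // subr_ge0.
    lra.
  have {}ij' : (i < j)%N by rewrite ltn_neqAle ij.
  move=> h; apply: le_trans (bk_lip1 (ltW hs) (ltW ht)) _.
  have a1 : (8^-1 : R) ^+ j <= 8^-1 ^+ i.+1.
    by apply: ler_wiXn2l => //; rewrite ?invr_ge0 ?invf_le1 ?ler1n.
  have := half_gt0 (R := R) n.+1.
  move: h a1; rewrite (half_expS n) (exprS _ i).
  set a := 8^-1 ^+ i; set b := 8^-1 ^+ j; set e := 2^-1 ^+ _ => h b1 e0.
  have : 0 <= e * (8^-1 * a - b) by rewrite mulr_ge0 ?(ltW e0) // subr_ge0.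
  lra.
have tn : forall j, r j <= d j (k i t).
  move=> j; rewrite leNgt; apply/negP => /limap_in; rewrite -E (limap_cusp hn).
  by rewrite ltNge hn.
have -> : k i s = k i t by apply: cusp_inj; rewrite -(limap_cusp hn) -(limap_cusp tn) E.
by rewrite subrr cabs0.
Qed.

Lemma limap_inj : injective f.
Proof.
move=> s t E; case: (locP s) => [i si|hs].
  have ti : d i t < r i.
    have := limap_in si; rewrite E; rewrite !ltNge; apply: contra.
    exact: limap_out_le.
  apply/eqP; rewrite -subr_eq0 -cabs_eq0 eq_le cabs_ge0 andbT.
  by apply/(@le_half_le0 _ _ (2 * 8^-1 ^+ i)) => n; exact: limap_inj_disc.
have ht : forall j, r j <= d j t.
  move=> j; rewrite leNgt; apply/negP => /limap_in; rewrite -E (limap_cusp hs).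
  by rewrite ltNge hs.
by apply: cusp_inj; rewrite -(limap_cusp hs) -(limap_cusp ht) E.
Qed.

End limit_map.

(** * Continuity of the limit map; its image and the fundamental domain *)

Section limit_map_continuity.
Context {R : realType} (S : ball_system R).
Local Notation C := (Cx R).
Local Notation Q := (C * C)%type.
Implicit Types (i j n : nat) (s t z : C) (x y p q : Q).
Local Notation r := (br S).
Local Notation k := (bk S).
Local Notation t_ := (bt S).
Local Notation c := (bc S).
Local Notation rad := (rad S).
Local Notation refl := (refl S).
Local Notation d i t := (rad i (cusp t)).
Local Notation f := (limap S).

Lemma cont_rad i x : {for x, continuous (rad i)}.
Proof.
apply/(@cvgrPdist_lt _ _ _ (nbhs x)) => e e0; apply/nbhsQ; exists e => // y xy.
rewrite ltr_norml !radE.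
have := nq_tri x (c i) y; have := nq_tri y (c i) x; rewrite (nqB x y).
by move: xy; lra.
Qed.

Lemma cont_disc i t : {for t, continuous (fun s => d i s)}.
Proof. exact: (cvg_comp _ _ (@cont_cusp _ t) (@cont_rad i (cusp t))). Qed.

Lemma near_gt {T : topologicalType} (g : T -> R) (a : R) (u : T) :
  {for u, continuous g} -> a < g u -> \forall v \near u, a < g v.
Proof.
by move=> h au; have := h _ (open_nbhs_nbhs (conj (@open_gt _ a) au)).
Qed.

Lemma near_lt {T : topologicalType} (g : T -> R) (a : R) (u : T) :
  {for u, continuous g} -> g u < a -> \forall v \near u, g v < a.
Proof.
by move=> h au; have := h _ (open_nbhs_nbhs (conj (@open_lt _ a) au)).
Qed.

Lemma near_ltn {T : Type} (F : set_system T) {FF : Filter F} (P : nat -> T -> Prop) n :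
  (forall j, \forall v \near F, P j v) ->
  \forall v \near F, forall j, (j < n)%N -> P j v.
Proof.
move=> H; elim: n => [|n IH]; first by near=> v => j.
near=> v => j; rewrite ltnS leq_eqVlt => /orP[/eqP ->|jn].
  by near: v; exact: H.
by move: j jn; near: v; exact: IH.
Unshelve. all: by end_near. Qed.

(** Continuity from outside the ball whose sphere passes through the point, if there is one: every
    other ball met near [t] has large index, hence small diameter. *)
Lemma limap_cont_out t e : (forall i, r i <= d i t) -> 0 < e ->
  \forall s \near t, (forall i, d i t <= r i -> r i <= d i s) ->
    nq (f s - cusp t) < e.
Proof.
move=> ht e0; have e20 : 0 < e / 2 by rewrite divr_gt0.
have [N HN] := exists_half_lt e20.
have h1 : \forall s \near t, nq (cusp s - cusp t) < e / 2.
  exact: (@cvgQE _ _ (nbhs t) _ _ _ _ (@cont_cusp _ t) e20).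
have h2 : \forall s \near t, forall j, (j < N)%N -> r j < d j t -> r j < d j s.
  apply: (@near_ltn _ (nbhs t) _ (fun j s => r j < d j t -> r j < d j s)) => j.
  have [tj|tj] := ltP (r j) (d j t).
    by apply: filterS (near_gt (@cont_disc j t) tj).
  by near=> s.
near=> s => hs.
have s1 : nq (cusp s - cusp t) < e / 2 by near: s.
have s2 : forall j, (j < N)%N -> r j < d j t -> r j < d j s by near: s.
case: (locP S s) => [j sj|hn]; last by rewrite limap_cusp //; move: s1; lra.
have Nj : (N <= j)%N.
  rewrite leqNgt; apply/negP => jN.
  have [tj|tj] := ltP (r j) (d j t).
    by have := s2 j jN tj; rewrite ltNge (ltW sj).
  by have := hs j tj; rewrite leNgt sj.
apply: le_lt_trans (nq_tri _ _ (cusp s)) _.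
have := ball_diam (ltW (limap_in sj)) (ltW sj).
rewrite /wt expr0 mulr1; have := half_mono (R := R) Nj.
by move: s1 HN; lra.
Unshelve. all: by end_near. Qed.

(** If [t] lies on the [i]-th sphere, the inner side is carried to the outer one by [k i], which
    fixes [t], and brought back by [refl i], which does not expand there. *)
Lemma limap_cont_cusp t e : (forall i, r i <= d i t) -> 0 < e ->
  \forall s \near t, nq (f s - cusp t) < e.
Proof.
move=> ht e0; have h1 := limap_cont_out ht e0.
have [[i ti]|hn] := pselect (exists i, d i t = r i); last first.
  apply: filterS h1 => s; apply => i.
  move: (ht i); rewrite le_eqVlt => /orP[/eqP ti|ti]; first by case: hn; exists i.
  by rewrite leNgt ti.
have tc : t != t_ i.
  by apply/eqP => e'; move: ti; rewrite e' rad_center => r0; have := br_gt0 S i; rewrite -r0 ltxx.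
have kt : k i t = t by exact: bk_sphere.
have h2 : \forall s \near t, (forall j, d j t <= r j -> r j <= d j (k i s)) ->
    nq (f (k i s) - cusp t) < e.
  have kc : k i @ nbhs t --> k i t by exact: bk_cont.
  by rewrite kt in kc; exact: (kc _ h1).
near=> s.
have s1 : (forall j, d j t <= r j -> r j <= d j s) -> nq (f s - cusp t) < e by near: s.
have s2 : (forall j, d j t <= r j -> r j <= d j (k i s)) ->
    nq (f (k i s) - cusp t) < e by near: s.
have uniq j : d j t <= r j -> j = i.
  by move=> tj; apply: (ball_uniq tj); rewrite ti.
have [si|si] := leP (r i) (d i s).
  by apply: s1 => j /uniq ->.
have sc : s != t_ i by near: s; apply/nbhsC; exists (cabs (t_ i - t)); [
  rewrite lt_neqAle cabs_ge0 eq_sym cabs_eq0 subr_eq0 eq_sym tc|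
  move=> w h; apply/eqP => e'; move: h; rewrite e' ltxx].
have ks := bk_in' sc si.
have {}s2 : nq (f (k i s) - cusp t) < e by apply: s2 => j /uniq ->; exact: ltW.
apply: le_lt_trans s2.
rewrite (limap_refl si) -[X in nq (_ - X)](@refl_sphere _ S i) //.
apply: refl_lip1; last by rewrite ti.
by apply: ltW; exact: limap_out.
Unshelve. all: by end_near. Qed.

Lemma near_neq s t : s != t -> \forall u \near s, u != t.
Proof.
move=> st; apply/nbhsC; exists (cabs (t - s)).
  by rewrite lt_neqAle cabs_ge0 eq_sym cabs_eq0 subr_eq0 eq_sym st.
by move=> w h; apply/eqP => e'; move: h; rewrite e' ltxx.
Qed.

(** Induction along the itinerary of [t]. It may stop at a centre, near which the map reflects a
    neighbourhood of infinity, or at a point outside all balls, which [limap_cont_cusp] handles. *)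
Lemma limap_cont_in n i t : d i t < r i ->
  \forall s \near t, nq (f s - f t) <= wt n i.
Proof.
elim: n i t => [|n IH] i t ti.
  apply: filterS (near_lt (@cont_disc i t) ti) => s si.
  by apply: (ball_diam (S := S)); apply: ltW; apply: limap_in.
have w0 := wt_gt0 (R := R) n.+1 i.
have [tc|tc] := eqVneq t (t_ i).
  (* Parameters of modulus at least [M] have images at distance at least [r i ^+ 2 / wt n.+1 i] from
     the centre, so their reflections land within [wt n.+1 i] of it; the 2 comes from
     [limap_proper]. *)
  pose M := r i ^+ 2 / wt n.+1 i + nq (c i) + 2.
  have [e e0 he] := bk_infty S i M.
  have h : \forall s \near t, cabs (s - t_ i) < e.
    by rewrite tc; apply/nbhsC; exists e.
  near=> s; have si : d i s < r i by near: s; exact: near_lt (@cont_disc i t) ti.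
  have [->|sc] := eqVneq s t; first by rewrite subrr nq0 ltW.
  rewrite tc in sc; rewrite tc limap_center (limap_refl si).
  have hM : M <= cabs (k i s) by apply: he => //; near: s.
  rewrite -/(rad i _) rad_refl.
  have hf : r i ^+ 2 / wt n.+1 i <= rad i (f (k i s)).
    have := limap_proper S (k i s); have := nq_sub (f (k i s)) (c i).
    by move: hM; rewrite /M !radE; lra.
  have m0 : 0 < r i ^+ 2 / wt n.+1 i by rewrite divr_gt0 // exprn_gt0 // br_gt0.
  rewrite ler_pdivrMr ?(lt_le_trans m0) //.
  by move: hf; rewrite ler_pdivrMr // mulrC.
have hk := bk_in' tc ti.
have h1 : \forall s \near t, nq (f (k i s) - f (k i t)) <=
    (if loc S (k i t) is Some j then wt n j else wt n.+1 i) /\ r i < d i (k i s) /\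
    (if loc S (k i t) is Some j then d j (k i s) < r j else True).
  have kc := @bk_cont _ S i t tc.
  suff h : \forall v \near k i t, nq (f v - f (k i t)) <=
    (if loc S (k i t) is Some j then wt n j else wt n.+1 i) /\ r i < d i v /\
    (if loc S (k i t) is Some j then d j v < r j else True).
    exact: (kc _ h).
  have h2 := near_gt (@cont_disc i (k i t)) hk.
  case: locP => [j kj|hn].
    have h3 := near_lt (@cont_disc j (k i t)) kj; have h4 := IH _ _ kj.
    by near=> v; split; last split; near: v.
  have h3 := limap_cont_cusp hn w0.
  near=> v; split; last by split => //; near: v.
  by rewrite [f (k i t)]limap_cusp // ltW //; near: v.
near=> s.
have si : d i s < r i by near: s; exact: near_lt (@cont_disc i t) ti.
have [s1 [s2 s3]] : nq (f (k i s) - f (k i t)) <=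
    (if loc S (k i t) is Some j then wt n j else wt n.+1 i) /\ r i < d i (k i s) /\
    (if loc S (k i t) is Some j then d j (k i s) < r j else True) by near: s.
rewrite (limap_refl si) (limap_refl ti).
case: locP s1 s3 => [j kj|hn] s1 s3.
  have ij : i != j by apply/eqP => e; move: kj; rewrite -e ltNge ltW.
  by apply: (refl_contract ij _ _ s1); apply: ltW; apply: limap_in.
apply: le_trans s1; apply: refl_lip1; apply: ltW; exact: limap_out.
Unshelve. all: by end_near. Qed.

Lemma cont_limap t : {for t, continuous f}.
Proof.
apply: (@cvgQI _ _ (nbhs t)) => e e0.
case: (locP S t) => [i ti|hn]; last by rewrite limap_cusp //; exact: limap_cont_cusp.
have [N HN] := exists_half_lt e0.
apply: filterS (limap_cont_in N ti) => s h.
by apply: le_lt_trans HN; apply: le_trans h (wt_le _ _).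
Qed.

Definition lam : set Q := range f.

(** The limit map is proper, so that only a compact disc of parameters can come close to [x]. *)
Lemma lam_away x : ~ lam x -> exists2 e : R, 0 < e & forall t, e <= nq (x - f t).
Proof.
move=> hx.
(* Beyond this disc [limap_proper] keeps the image at distance at least 1 from [x]. *)
have K := @compact_disc R (nq x + 3).
have /compact_near_coveringP/(_ nat \oo (fun n t => 2^-1 ^+ n < nq (x - f t))) := K.
case.
  move=> t _; have t0 : 0 < nq (x - f t).
    by rewrite nqB_gt0; apply/eqP => e; apply: hx; exists t.
  have [N HN] := exists_half_lt t0.
  have cn : {for t, continuous (fun s => nq (x - f s))}.
    apply/(@cvgrPdist_lt _ _ _ (nbhs t)) => e e0.
    apply: filterS (@cvgQE _ _ (nbhs t) _ _ _ _ (@cont_limap t) e0) => s h.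
    rewrite ltr_norml.
    have := nq_tri x (f t) (f s); have := nq_tri x (f s) (f t).
    by rewrite (nqB (f t) (f s)); move: h; lra.
  exists ([set s | 2^-1 ^+ N < nq (x - f s)], [set n | (N <= n)%N]).
    by split; [exact: (near_gt cn)|exists N].
  by move=> [s n] [/= h1 h2]; apply: le_lt_trans h1; exact: half_mono.
move=> N _ HN; exists (Num.min 1 (2^-1 ^+ N)) => [|t].
  by rewrite lt_min ltr01 half_gt0.
have [tK|tK] := leP (cabs t) (nq x + 3).
  by rewrite ge_min; apply/orP; right; apply: ltW; exact: (HN N (leqnn N) t tK).
rewrite ge_min; apply/orP; left.
have := limap_proper S t; have := nq_sub (f t) x; rewrite (nqB (f t)).
by move: tK; lra.
Qed.

Lemma lam_refl i x : lam x -> lam (refl i x).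
Proof.
move=> [t _ <-]; exists (k i t) => //.
have [ti|ti] := leP (d i t) (r i); first by rewrite (limap_refl_le ti) reflK.
by rewrite (limap_refl (bk_out ti)) bkK.
Qed.

Lemma lam_reflE i x : lam (refl i x) <-> lam x.
Proof. by split=> [/(@lam_refl i)|/lam_refl//]; rewrite reflK. Qed.

Definition fund : set Q := [set x | forall i, r i <= rad i x].

(** This axis carries the loop used for wildness, the base point of the group and the cusp
    itself. *)
Lemma fund0w (w : C) : fund (0, w).
Proof.
move=> i; rewrite leNgt; apply/negP => /ltW h.
by have [] := b_local h; rewrite eqxx.
Qed.

Lemma fund0 : fund 0. Proof. exact: fund0w. Qed.

Lemma limap0 : f 0 = 0.
Proof. by rewrite limap_cusp cusp0 //; exact: fund0. Qed.

Lemma lam0 : lam 0. Proof. by exists 0 => //; exact: limap0. Qed.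

Lemma lam_fund x : fund x -> lam x -> exists2 t, x = cusp t & f t = x.
Proof.
move=> hx [t _ ft]; exists t => //; rewrite -ft limap_cusp // => i.
rewrite leNgt; apply/negP => /limap_in; rewrite ft; apply/negP.
by rewrite -leNgt; exact: hx.
Qed.

Lemma cusp_fund_lam t : fund (cusp t) -> lam (cusp t).
Proof. by move=> h; exists t => //; exact: limap_cusp. Qed.

(* Balls accumulate only at the limit set. *)
Lemma fund_near x : fund x -> ~ lam x ->
  \forall y \near x, forall i, rad i y < r i -> rad i x = r i.
Proof.
move=> hx hl.
have [e e0 he] := lam_away hl.
have e40 : 0 < e / 4 by rewrite divr_gt0.
have [N HN] := exists_half_lt e40.
have h2 : \forall y \near x, forall j, (j < N)%N -> r j < rad j x -> r j < rad j y.
  apply: (@near_ltn _ (nbhs x) _ (fun j y => r j < rad j x -> r j < rad j y)) => j.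
  have [tj|tj] := ltP (r j) (rad j x).
    by apply: filterS (near_gt (@cont_rad j x) tj).
  by near=> y.
have h3 : \forall y \near x, nq (y - x) < e / 4 by apply/nbhsQ; exists (e / 4).
near=> y => i yi.
have [iN|iN] := ltnP i N.
  apply/eqP; rewrite eq_le hx andbT leNgt; apply/negP => xi.
  have : r i < rad i y by move: (i) iN xi; near: y.
  by rewrite ltNge ltW.
have : nq (x - f (t_ i)) <= nq (x - y) + rad i y.
  by rewrite limap_center; exact: nq_tri.
have := he (t_ i); have yx : nq (y - x) < e / 4 by near: y.
rewrite (nqB x y) => h1 h4.
have := half_mono (R := R) iN; have := br_le S i; have := half_mono (R := R) (leqnSn i).
move: yx HN yi h1 h4; lra.
Unshelve. all: by end_near. Qed.

End limit_map_continuity.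

(** * Tiles of the reflection group *)

Section words.
Implicit Types (a b w : seq nat).

(** Normal forms in the free product of groups of order two, one for each letter. *)
Definition reduced a : bool := sorted (fun i j => i != j) a.

Definition word_cons (i : nat) a : seq nat :=
  if a is j :: b then if i == j then b else i :: a else [:: i].
Definition reduce a : seq nat := foldr word_cons [::] a.

Lemma reduced_tail i a : reduced (i :: a) -> reduced a.
Proof. by case: a => //= j a /andP[]. Qed.

Lemma reduced_reduce a : reduced (reduce a).
Proof.
elim: a => //= i a; case: (reduce a) => //= j b h.
case: eqVneq => [_|ij] /=; last by rewrite ij.
by apply: (@reduced_tail j).
Qed.

(** Stated for arbitrary involutions because it serves both the inversions of [Q] and their lifts to
    projective space. *)
Lemma foldr_reduce {T : Type} (g : nat -> T -> T) a x :
  (forall i, involutive (g i)) -> foldr g x (reduce a) = foldr g x a.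
Proof.
move=> gK; elim: a => //= i a <-; case: (reduce a) => //= j b.
by case: eqVneq => [->|//]; rewrite gK.
Qed.

Lemma foldr_rev {T : Type} (g : nat -> T -> T) a x :
  (forall i, involutive (g i)) -> foldr g (foldr g x a) (rev a) = x.
Proof.
move=> gK; elim: a x => //= i a IH x.
by rewrite rev_cons -cats1 foldr_cat /= gK IH.
Qed.

Lemma foldr_revK {T : Type} (g : nat -> T -> T) a x :
  (forall i, involutive (g i)) -> foldr g (foldr g x (rev a)) a = x.
Proof. by move=> gK; rewrite -{2}(revK a) foldr_rev. Qed.

Lemma odd_reduce a : odd (size (reduce a)) = odd (size a).
Proof.
elim: a => //= i a <-; case: (reduce a) => //= j b.
by case: eqP => //= _; rewrite negbK.
Qed.

Lemma finite_words N :
  finite_set [set a : seq nat | (size a <= N)%N /\ all (fun i => (i < N)%N) a].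
Proof.
suff H n : finite_set [set a : seq nat | (size a <= n)%N /\ all (fun i => (i < N)%N) a].
  exact: H.
elim: n => [|n IH].
  apply: (@sub_finite_set _ _ [set [::]]); last exact: finite_set1.
  by move=> [|i a] [].
pose A := [set a : seq nat | (size a <= n)%N /\ all (fun i => (i < N)%N) a].
apply: (@sub_finite_set _ _ ([set [::]] `|` (fun p : nat * seq nat => p.1 :: p.2) @` (`I_N `*` A))).
  move=> [|i a] /= [sa]; first by left.
  by move=> /andP[iN aN]; right; exists (i, a).
rewrite finite_setU; split; first exact: finite_set1.
by apply: finite_image; apply: finite_setX => //; exact: finite_II.
Qed.

End words.

(** * The tiling of the complement of the limit set and proper discontinuity *)

Section folding.
Context {R : realType} (S : ball_system R).
Local Notation C := (Cx R).
Local Notation Q := (C * C)%type.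
Implicit Types (i j n : nat) (s t z : C) (x y p q : Q) (a : seq nat).
Local Notation r := (br S).
Local Notation k := (bk S).
Local Notation t_ := (bt S).
Local Notation c := (bc S).
Local Notation rad := (rad S).
Local Notation refl := (refl S).
Local Notation d i t := (rad i (cusp t)).
Local Notation f := (limap S).
Local Notation lam := (lam S).
Local Notation fund := (fund S).

Definition wact a x : Q := foldr refl x a.

Lemma wactE a x : wact a x = foldr refl x a.
Proof. by []. Qed.

Lemma wact_lam a x : lam (wact a x) <-> lam x.
Proof. by elim: a => //= i a <-; exact: lam_reflE. Qed.

(** Ping-pong: every reflection carries the outside of its ball into the ball, and the balls are
    disjoint. *)
Lemma wact_in i a x : reduced (i :: a) -> r (last i a) <= rad (last i a) x ->
  rad i (wact (i :: a) x) <= r i.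
Proof.
elim: a i => [|j a IH] i /=; first by move=> _; exact: refl_out_le.
move=> /andP[ij ra] h; apply: refl_out_le; apply: ltW; apply: (ball_disjoint ij).
exact: IH.
Qed.

Lemma wact_contract i a x y : reduced (i :: a) ->
  r (last i a) <= rad (last i a) x -> r (last i a) <= rad (last i a) y ->
  nq (wact (i :: a) x - wact (i :: a) y) <= wt (size a) i.
Proof.
elim: a i => [|j a IH] i ra hx hy.
  by apply: (ball_diam (S := S)); exact: refl_out_le.
have /andP[ij ra'] : (i != j) && reduced (j :: a) by [].
apply: (refl_contract ij); [exact: wact_in|exact: wact_in|exact: IH].
Qed.

(** Once the letter [m] has acted, both points are in the [m]-th ball, and the remaining reflections
    do not expand. With [wact_contract], which controls the length, this leaves finitely many words
    for tiles that reach a given distance from the limit set. *)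
Lemma wact_close i a x y m : reduced (i :: a) ->
  r (last i a) <= rad (last i a) x -> r (last i a) <= rad (last i a) y ->
  m \in i :: a -> nq (wact (i :: a) x - wact (i :: a) y) <= 2^-1 ^+ m.
Proof.
elim: a i => [|j a IH] i ra hx hy.
  rewrite inE => /eqP ->; apply: le_trans (wact_contract ra hx hy) _.
  by rewrite /wt expr0 mulr1.
rewrite inE => /orP[/eqP ->|ma].
  apply: le_trans (ball_diam (wact_in ra hx) (wact_in ra hy)) _.
  by rewrite /wt expr0 mulr1.
have /andP[ij ra'] : (i != j) && reduced (j :: a) by [].
apply: le_trans (IH _ ra' hx hy ma); apply: refl_lip1.
  by apply: ltW; apply: (ball_disjoint ij); exact: wact_in.
by apply: ltW; apply: (ball_disjoint ij); exact: wact_in.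
Qed.

Definition away (e : R) x := forall t, e <= nq (x - f t).

Lemma away_lam e x y : away e x -> lam y -> e <= nq (x - y).
Proof. by move=> h [t _ <-]. Qed.

(* Points at distance at least [e] from the limit set lie in finitely many
   tiles. *)
Lemma away_word e : 0 < e -> exists N, forall a p, reduced a -> fund p ->
  away e (wact a p) -> (size a <= N)%N /\ all (fun i => (i < N)%N) a.
Proof.
move=> e0; have [N HN] := exists_half_lt e0.
exists N => -[|i a] p ra hp h; first by [].
have hl : lam (wact (i :: a) 0) by rewrite wact_lam; exact: lam0.
have he := away_lam h hl.
have lt_of m : e <= 2^-1 ^+ m -> (m < N)%N.
  rewrite ltnNge => h'; apply/negP => Nm.
  have := half_mono (R := R) Nm; rewrite leNgt => /negP; apply.
  exact: lt_le_trans HN h'.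
split.
  apply: lt_of; apply: le_trans he _; apply: le_trans (wact_contract ra _ _) _.
  - exact: hp.
  - exact: fund0.
  exact: wt_le.
apply/allP => m ma; apply: lt_of; apply: le_trans he _.
by apply: wact_close => //; exact: fund0.
Qed.

(** The point is reflected out of the ball that contains it, again and again. Either this ends in
    the fundamental domain, or after [n] further steps the centre of the ball reached, carried back,
    is a point of the limit set close to [x]. *)
Lemma unfold_or_close n i x : ~ lam x -> rad i x < r i ->
  (exists a p, [/\ fund p, reduced (i :: a) & x = wact (i :: a) p]) \/
  exists2 t, d i t < r i & nq (x - f t) <= wt n i.
Proof.
elim: n i x => [|n IH] i x hx xi.
  right; exists (t_ i); first exact: center_in.
  apply: (ball_diam (S := S) (i := i)); first exact: ltW.
  by rewrite limap_center rad_center ltW // br_gt0.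
have xc : x != c i.
  by apply/eqP => e; apply: hx; exists (t_ i) => //; rewrite limap_center.
have hy := refl_in xc xi.
have ly : ~ lam (refl i x) by rewrite lam_reflE.
have [hf|hf] := pselect (fund (refl i x)).
  by left; exists [::], (refl i x); split => //; rewrite /= reflK.
have [j yj] : exists j, rad j (refl i x) < r j.
  apply: contrapT => h; apply: hf => j; rewrite leNgt; apply/negP => hj.
  by apply: h; exists j.
have ij : i != j by apply/eqP => e; move: yj; rewrite -e ltNge ltW.
have [[a [p [hp ra E]]]|[t tj ht]] := IH j _ ly yj; [left|right].
  exists (j :: a), p; split => //; first by rewrite /= ij.
  by rewrite -[LHS](reflK S i) E.
have ti : r i < d i t by apply: (ball_disjoint ij); exact: ltW.
have ki := bk_out ti.
exists (k i t) => //.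
rewrite (limap_refl ki) bkK -[x](reflK S i).
apply: (refl_contract ij _ _ ht); apply: ltW => //; exact: limap_in.
Qed.

(** The second alternative of [unfold_or_close] contradicts the positive distance to the limit set
    once [n] is large. *)
Lemma unfold x : ~ lam x -> exists a p, [/\ fund p, reduced a & x = wact a p].
Proof.
move=> hx; have [hf|hf] := pselect (fund x); first by exists [::], x.
have [i xi] : exists i, rad i x < r i.
  apply: contrapT => h; apply: hf => j; rewrite leNgt; apply/negP => hj.
  by apply: h; exists j.
have [e e0 he] := lam_away hx.
have [N HN] := exists_half_lt e0.
have [[a [p [hp ra E]]]|[t tj ht]] := unfold_or_close N hx xi.
  by exists (i :: a), p.
have := le_lt_trans (le_trans ht (wt_le _ _)) HN.
by rewrite ltNge he.
Qed.

(** Two tiles meet only along a sphere that bounds both, since a point of the fundamental domain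
    lies on at most one of the disjoint spheres. *)
Lemma fund_word a p q : reduced a -> fund p -> fund q -> wact a p = q ->
  a = [::] \/ exists2 i, a = [:: i] & refl i p = p.
Proof.
case: a => [|i a] ra hp hq E; first by left.
right; have := wact_in ra (hp _); rewrite E => qi.
have {}qi : rad i q = r i by apply/eqP; rewrite eq_le qi hq.
case: a ra E => [|j a] ra E.
  exists i => //; have := refl_sphere qi; rewrite -E /= reflK.
  exact: esym.
have /andP[ij ra'] : (i != j) && reduced (j :: a) by [].
have E' : wact (j :: a) p = q.
  by rewrite -(refl_sphere qi) -E /= reflK.
have := wact_in ra' (hp _); rewrite E' => qj.
by have := ball_disjoint ij qj; rewrite qi ltxx.
Qed.

(* Proper discontinuity: a word moving a point away from the limit set to another
   such point is, up to cancellation, one of finitely many words [b ++ rev a]. *)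
Lemma wact_discontinuous e : 0 < e -> exists N, forall w x,
  away e x -> away e (wact w x) -> exists a b,
  [/\ (size a <= N)%N /\ all (fun i => (i < N)%N) a,
      (size b <= N)%N /\ all (fun i => (i < N)%N) b &
      forall (T : Type) (g : nat -> T -> T), (forall i, involutive (g i)) ->
        forall u, foldr g u w = foldr g u (b ++ rev a)].
Proof.
move=> e0; have [N HN] := away_word e0; exists N => w x hx hwx.
have lx : ~ lam x.
  move=> l; have := away_lam hx l; rewrite subrr nq0 => h.
  by have := lt_le_trans e0 h; rewrite ltxx.
have [a [p [hp ra xE]]] := unfold lx.
have ly : ~ lam (wact w x) by rewrite wact_lam.
have [b [q [hq rb yE]]] := unfold ly.
have sa : (size a <= N)%N /\ all (fun i => (i < N)%N) a.
  by apply: (HN a p) => //; rewrite -xE.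
have sb : (size b <= N)%N /\ all (fun i => (i < N)%N) b.
  by apply: (HN b q) => //; rewrite -yE.
have E : wact (rev b ++ w ++ a) p = q.
  by rewrite /wact !foldr_cat -!/(wact _ _) -xE yE /wact foldr_rev //; exact: reflK.
(* An equality of maps of [Q] says nothing about the lifts; an identity between words holds for
   every family of involutions. *)
suff key a' : (forall (T : Type) (g : nat -> T -> T), (forall i, involutive (g i)) ->
        forall u, foldr g u (rev b ++ w ++ a') = u) ->
    forall (T : Type) (g : nat -> T -> T), (forall i, involutive (g i)) ->
        forall u, foldr g u w = foldr g u (b ++ rev a').
  have := fund_word (reduced_reduce (rev b ++ w ++ a)) hp hq.
  rewrite {1}/wact foldr_reduce; last exact: reflK.
  case=> // [h|[i h hi]].
    exists a, b; split => //; apply: key => T g gK u.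
    by have := foldr_reduce (rev b ++ w ++ a) u gK; rewrite h => /= <-.
  (* Here [p] lies on the [i]-th sphere, and the extra letter [i], which fixes it, is absorbed into
     the word of [x]. *)
  have xE' : x = wact (reduce (rcons a i)) p.
    rewrite /wact foldr_reduce; last exact: reflK.
    by rewrite -cats1 foldr_cat /= hi.
  have sa' := HN _ _ (reduced_reduce (rcons a i)) hp (eq_ind _ (away e) hx _ xE').
  exists (reduce (rcons a i)), b; split => //; apply: key => T g gK u.
  have := foldr_reduce (rev b ++ w ++ a) (g i u) gK; rewrite h /= gK => {2}->.
  by rewrite !foldr_cat foldr_reduce // -cats1 foldr_cat.
move=> H T g gK u; rewrite -{1}(foldr_revK a' u gK) foldr_cat.
move: (foldr g u (rev a')) => v.
rewrite -[LHS](foldr_revK b _ gK); congr (foldr g _ b).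
by rewrite -!foldr_cat -?catA H.
Qed.

End folding.

(** * Density of orbits, balls near the cusp, and the fixed point of the first two inversions *)

Section orbits.
Context {R : realType} (S : ball_system R).
Local Notation C := (Cx R).
Local Notation Q := (C * C)%type.
Implicit Types (i j n : nat) (s t z : C) (x y p q : Q) (a w : seq nat).
Local Notation r := (br S).
Local Notation k := (bk S).
Local Notation t_ := (bt S).
Local Notation c := (bc S).
Local Notation rad := (rad S).
Local Notation refl := (refl S).
Local Notation d i t := (rad i (cusp t)).
Local Notation f := (limap S).
Local Notation lam := (lam S).
Local Notation fund := (fund S).
Local Notation wact := (wact S).

Fixpoint itin w s : Prop :=
  if w is i :: w' then [/\ d i s < r i, s != t_ i & itin w' (k i s)] else True.

Lemma near_sub (P : C -> Prop) t e : 0 < e -> (\forall s \near t, P s) ->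
  exists2 e' : R, 0 < e' <= e & forall s, cabs (s - t) < e' -> P s.
Proof.
move=> e0 /nbhsC[e' e'0 H]; exists (Num.min e e').
  by rewrite lt_min e0 e'0 ge_min lexx.
by move=> s; rewrite lt_min => /andP[_ /H].
Qed.

(** A disc is met near [z]; its involution [k j] is continuous there, so a parameter with an
    itinerary of length [n] near the image can be pulled back. *)
Lemma itin_dense n z (e : R) : 0 < e -> exists s w,
  [/\ size w = n, cabs (s - z) < e & itin w s].
Proof.
elim: n z e => [|n IH] z e e0; first by exists z, [::]; rewrite subrr cabs0.
have e20 : 0 < e / 2 by rewrite divr_gt0.
have [j [s0 [s0j s0z]]] := b_dense S z e20.
(* The centre is avoided because [k j] is discontinuous there. *)
have [s1 [s1j s1z s1c]] : exists s1, [/\ d j s1 < r j, cabs (s1 - z) < e & s1 != t_ j].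
  have [sc|sc] := eqVneq s0 (t_ j); last by exists s0; split => //; move: s0z e0; lra.
  have [e' /andP[e'0 e'e] H] := near_sub e20 (near_lt (@cont_disc _ S j s0) s0j).
  exists (s0 + rc (e' / 2)); split.
  - by apply: H; rewrite addrAC subrr add0r cabs_rc gtr0_norm; lra.
  - rewrite -addrA addrCA; apply: le_lt_trans (cabsD _ _) _.
    by rewrite cabs_rc gtr0_norm; lra.
  - by rewrite sc -subr_eq0 addrAC subrr add0r rc_eq0 gt_eqF // divr_gt0.
have uc : k j s1 != t_ j.
  by apply: contra_neq s1c => h; rewrite -(bkK S j s1) h bk_center.
have kc : k j @ nbhs (k j s1) --> k j (k j s1) by exact: bk_cont.
rewrite bkK in kc.
have d0 : 0 < e - cabs (s1 - z) by rewrite subr_gt0.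
have h : \forall v \near k j s1, [/\ d j (k j v) < r j, k j v != t_ j &
    cabs (k j v - s1) < e - cabs (s1 - z)].
  have h1 : \forall v \near s1, [/\ d j v < r j, v != t_ j & cabs (v - s1) < e - cabs (s1 - z)].
    have a1 := near_lt (@cont_disc _ S j s1) s1j; have a2 := near_neq s1c.
    have a3 : \forall v \near s1, cabs (v - s1) < e - cabs (s1 - z).
      by apply/nbhsC; exists (e - cabs (s1 - z)).
    by near=> v; split; near: v.
  exact: (kc _ h1).
have [e' /andP[e'0 _] H] := near_sub e0 h.
have [s' [w [sw s's its]]] := IH (k j s1) e' e'0.
have [h1 h2 h3] := H _ s's.
exists (k j s'), (j :: w); split => //=; first by rewrite sw.
  apply: le_lt_trans (cabs_tri _ _ s1) _; move: h3; lra.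
by split => //; rewrite bkK.
Unshelve. all: by end_near. Qed.

Lemma itin_word i a s : itin (i :: a) s -> reduced (i :: a) /\
  exists2 s', f s = wact (i :: a) (f s') & r (last i a) <= rad (last i a) (f s').
Proof.
elim: a i s => [|j a IH] i s [si sc its].
  split => //; exists (k i s); first by rewrite (limap_refl si).
  by apply: limap_out_le; apply: ltW; exact: bk_in'.
have [ra [s' E h]] := IH _ _ its.
have [kj _ _] := its.
have ij : i != j.
  by apply/eqP => e; move: kj; rewrite -e ltNge ltW //; exact: bk_in'.
split; first by rewrite /reduced /= ij.
by exists s' => //; rewrite (limap_refl si) E.
Qed.

(** A parameter with a long itinerary [w] close to [t] has its image in the same small set as
    [wact w 0]. *)
Lemma orbit_dense t (e : R) : 0 < e ->
  exists w, [/\ reduced w, ~~ odd (size w) & nq (wact w 0 - f t) < e].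
Proof.
move=> e0; have e20 : 0 < e / 2 by rewrite divr_gt0.
have [e' /andP[e'0 _] H] :=
  near_sub e20 (@cvgQE _ _ (nbhs t) _ _ _ _ (@cont_limap _ S t) e20).
have [N HN] := exists_half_lt e20.
(* The length is even, so that the word lifts to the group, and large enough for a contraction by
   [2^-1 ^+ N]. *)
have [s [w [sw st its]]] := itin_dense N.*2.+2 t e'0.
exists w.
case: w sw its => // i a [sa] its.
have [ra [s' E h]] := itin_word its.
split => //; first by rewrite /= sa /= odd_double.
apply: le_lt_trans (nq_tri _ _ (f s)) _.
have := H s st.
have : nq (wact (i :: a) 0 - f s) <= 2^-1 ^+ N.
  rewrite E; apply: le_trans (wact_contract ra _ h) _; first exact: fund0.
  apply: le_trans (wt_le _ _) _; apply: half_mono.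
  by rewrite sa -addnn; apply: leqW; exact: leq_addr.
by move: HN; lra.
Qed.

(** No ball contains the cusp, so a small neighbourhood of it misses the first balls; by density
    some ball meets it, and this ball has large index and small radius. *)
Lemma balls_near0 (e : R) N : 0 < e -> exists2 j, (N <= j)%N &
  forall x, rad j x <= r j -> nq x < e.
Proof.
move=> e0; have e20 : 0 < e / 2 by rewrite divr_gt0.
have [M HM] := exists_half_lt e20.
have h : \forall s \near (0 : C), forall j, (j < maxn N M)%N -> r j < d j s.
  apply: (@near_ltn _ (nbhs 0) _ (fun j s => r j < d j s)) => j.
  apply: (near_gt (@cont_disc _ S j 0)).
  rewrite cusp0 ltNge; apply/negP => h.
  by have [] := b_local h; rewrite eqxx.
have h2 : \forall s \near (0 : C), nq (cusp s - cusp 0) < e / 2.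
  exact: (@cvgQE _ _ (nbhs 0) _ _ _ _ (@cont_cusp _ 0) e20).
have [e' /andP[e'0 _] H] := near_sub e0 (filterI h h2).
have [j [s [sj s0]]] := b_dense S 0 e'0.
have [H1 H2] := H _ s0.
have Nj : (maxn N M <= j)%N.
  by rewrite leqNgt; apply/negP => /H1; rewrite ltNge ltW.
exists j; first by apply: leq_trans Nj; exact: leq_maxl.
move=> x xj.
have := ball_diam xj (ltW sj); rewrite /wt expr0 mulr1.
have := half_mono (R := R) (leq_trans (leq_maxr _ _) Nj).
have := nq_sub x (cusp s); move: H2; rewrite cusp0 subr0; move: HM; lra.
Qed.

(* The word of the [n]-th power of the product of the first two inversions. *)
Fixpoint alt n : seq nat := if n is m.+1 then [:: 0, 1 & alt m]%N else [::].

Lemma altS n : alt n.+1 = alt n ++ [:: 0; 1]%N.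
Proof. by elim: n => //= n ->. Qed.

Lemma size_alt n : size (alt n) = n.*2.
Proof. by elim: n => //= n ->. Qed.

Lemma reduced_alt n : reduced (alt n).
Proof. by elim: n => //= -[|n]. Qed.

Lemma last_alt n i : last i (alt n.+1) = 1%N.
Proof. by rewrite altS last_cat. Qed.

Lemma alt_contract n x y : r 1 <= rad 1 x -> r 1 <= rad 1 y ->
  nq (wact (alt n.+1) x - wact (alt n.+1) y) <= 2^-1 ^+ n.
Proof.
move=> hx hy.
have := @wact_contract _ S 0 (1%N :: alt n) x y (reduced_alt n.+1).
rewrite (_ : last 0 (1%N :: alt n) = 1%N); last by have := last_alt n 0.
move=> /(_ hx hy) h; apply: le_trans h _; apply: le_trans (wt_le _ _) _.
by apply: half_mono; rewrite /= size_alt -addnn; apply: leqW; exact: leq_addr.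
Qed.

(** The powers of the product of two inversions shrink the whole fundamental domain uniformly to the
    fixed point in the first ball. The orbit of [0], which lies in the limit set, converges to
    it. *)
Lemma alt_limit : exists p, [/\ lam p, rad 0 p < r 0, forall n, wact (alt n) p = p &
  forall e : R, 0 < e -> exists n, forall x, fund x -> nq (wact (alt n) x - p) < e].
Proof.
have [u uE] : exists u : nat -> Q, forall n, u n = wact (alt n.+1) 0 by eexists.
have u0 n : rad 0 (u n) <= r 0.
  by rewrite uE; apply: (@wact_in _ S 0 (1%N :: alt n)); [exact: (reduced_alt n.+1)|exact: fund0].
have dis01 x : rad 0 x <= r 0 -> r 1 < rad 1 x by exact: ball_disjoint.
have dis10 x : rad 1 x <= r 1 -> r 0 < rad 0 x by exact: ball_disjoint.
have uS n : nq (u n.+1 - u n) <= 2^-1 ^+ n.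
  rewrite !uE (altS n.+1) !wactE foldr_cat; apply: alt_contract; last exact: fund0.
  by apply: ltW; apply: dis01; have := u0 0%N; rewrite uE.
have uSE n : u n.+1 = refl 0 (refl 1 (u n)) by rewrite !uE.
have [p Hp] := Q_geom_complete uS.
have p0 : rad 0 p <= r 0.
  rewrite -subr_le0; apply: (@le_half_le0 _ _ 8) => n.
  have := nq_tri p (c 0) (u n); have := u0 n; have := Hp n.
  by rewrite !radE; lra.
have lip x y : rad 0 x <= r 0 -> rad 0 y <= r 0 ->
    nq (refl 0 (refl 1 x) - refl 0 (refl 1 y)) <= nq (x - y).
  move=> hx hy; apply: le_trans (refl_lip1 (i := 1) _ _).
  - by apply: refl_lip1; apply: ltW; apply: dis10; apply: refl_out_le; apply: ltW; exact: dis01.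
  - by apply: ltW; exact: dis01.
  - by apply: ltW; exact: dis01.
have fixp : refl 0 (refl 1 p) = p.
  apply/esym; apply: (@nq_eq_half _ p _ 16) => n.
  have h1 := Hp n.+1; have h3 := Hp n.
  have h2 : nq (u n.+1 - refl 0 (refl 1 p)) <= nq (p - u n).
    by rewrite uSE (nqB p); exact: lip _ _ (u0 n) p0.
  have key (A B D E h h' : R) : A <= 8 * h' -> B <= D -> D <= 8 * h ->
    h = 2 * h' -> 0 < h -> E <= A + B -> E <= 16 * h by lra.
  exact: (key _ _ _ _ _ _ h1 h2 h3 (half_expS n) (half_gt0 n) (nq_tri _ _ _)).
have altp n : wact (alt n) p = p.
  elim: n => [//|n IH]; rewrite -[RHS]fixp -{2}IH.
  exact: erefl.
exists p; split => //.
- apply: contrapT => /lam_away[e e0 he].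
  have : e <= 0.
    apply: (@le_half_le0 _ _ 8) => n; apply: le_trans (Hp n).
    by apply: (away_lam (S := S) he); rewrite uE wact_lam; exact: lam0.
  by rewrite leNgt e0.
- by rewrite -fixp; apply: refl_out; apply: dis10; apply: ltW; apply: refl_out; exact: dis01.
move=> e e0; have e90 : 0 < e / 9 by rewrite divr_gt0.
have [n Hn] := exists_half_lt e90.
exists n.+1 => x hx.
apply: le_lt_trans (nq_tri _ _ (u n)) _.
have h1 : nq (wact (alt n.+1) x - u n) <= 2^-1 ^+ n.
  by rewrite uE; apply: alt_contract; [exact: hx|exact: fund0].
by have := Hp n; rewrite (nqB (u n)); move: h1 Hn; lra.
Qed.

End orbits.

(** * Balls along the cuspidal curve *)

Section radial_chart.
Context {R : realType}.
Local Notation C := (Cx R).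
Local Notation Q := (C * C)%type.
Variable t0 : C.
Hypothesis t0N0 : t0 != 0.
Implicit Types (v w z : C).

(** The difference quotient of the curve at [t0]: the displacement of [cusp] from [t0] to [t0 + v]
    is [v] times [G v]. *)
Let G v : Q := (2 * t0 + v, 3 * t0 ^+ 2 + 3 * t0 * v + v ^+ 2).
Let g v : R := nq (G v).
Let a := cabs t0.
(** On the disc of this radius [g] differs from [g0] by at most a twentieth of it, by [dl_small]. *)
Let dl : R := a / 40.
Let g0 := g 0.

Lemma nqMl v (q : Q) : nq (v * q.1, v * q.2) = cabs v * nq q.
Proof.
rewrite /nq /= !cabsM !exprMn -mulrDr sqrtrM ?sqr_ge0 // sqrtr_sqr.
by rewrite ger0_norm ?cabs_ge0.
Qed.

Lemma cusp_shift v : nq (cusp (t0 + v) - cusp t0) = cabs v * g v.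
Proof.
rewrite -nqMl; congr nq; rewrite /cusp; congr pair => /=; ring.
Qed.

Lemma a_gt0 : 0 < a.
Proof. by rewrite lt_neqAle cabs_ge0 eq_sym cabs_eq0 t0N0. Qed.
Lemma dl_gt0 : 0 < dl. Proof. by rewrite divr_gt0 // a_gt0. Qed.

Lemma g0_ge1 : 2 * a <= g0.
Proof.
apply: le_trans (nq_fst (G 0)); rewrite /= addr0 cabsM.
by rewrite cabs_nat.
Qed.
Lemma g0_ge2 : 3 * a ^+ 2 <= g0.
Proof.
apply: le_trans (nq_snd (G 0)); rewrite /= mulr0 addr0 expr0n addr0 cabsM.
by rewrite cabs_nat cabsX.
Qed.
Lemma g0_gt0 : 0 < g0.
Proof. by apply: lt_le_trans g0_ge1; have := a_gt0; lra. Qed.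

Lemma g_lip v w : cabs v <= dl -> cabs w <= dl ->
  `|g v - g w| <= (1 + 4 * a) * cabs (v - w).
Proof.
move=> vd wd; rewrite ler_norml.
have h : nq (G v - G w) <= (1 + 4 * a) * cabs (v - w).
  have -> : G v - G w = ((v - w) * 1, (v - w) * (3 * t0 + v + w)).
    by rewrite /G; congr pair => /=; ring.
  rewrite (@nqMl _ (1, 3 * t0 + v + w)) mulrC ler_wpM2r ?cabs_ge0 //.
  apply: le_trans (nq_le _) _; rewrite /= cabs1 lerD2l.
  apply: le_trans (cabsD _ _) _; apply: le_trans (lerD (cabsD _ _) (lexx _)) _.
  rewrite cabsM cabs_nat -/a; move: vd wd; rewrite /dl; have := a_gt0; lra.
have := nq_sub (G v) (G w); have := nq_sub (G w) (G v); rewrite (nqB (G w)) -/(g _) -/(g _).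
by move: h; lra.
Qed.

Lemma dl_small : (1 + 4 * a) * dl <= g0 / 20.
Proof. by have := g0_ge1; have := g0_ge2; rewrite /dl; nra. Qed.

Let clamp v : C := if cabs v <= dl then v else rc (dl / cabs v) * v.

Lemma clamp_le v : cabs (clamp v) <= dl.
Proof.
rewrite /clamp; case: ifPn => //; rewrite -ltNge => h.
have v0 : 0 < cabs v by rewrite (lt_trans dl_gt0).
rewrite cabsM cabs_rc ger0_norm ?divfK ?gt_eqF //.
by rewrite divr_ge0 ?ltW // dl_gt0.
Qed.

(** The factor [cabs w] is the one that multiplies the variation of [g] in a difference of values of
    [theta]; it is harmless because the radial projection contracts far from the origin. *)
Lemma clamp_lip v w : cabs w <= cabs v ->
  cabs (clamp v - clamp w) * cabs w <= 2 * dl * cabs (v - w).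
Proof.
move=> wv; have d0 := dl_gt0.
have vw := cabs_sub v w; have n0 := cabs_ge0 (v - w); have w0 := cabs_ge0 w.
rewrite /clamp; case: ifPn => vd.
  rewrite (le_trans wv vd) mulrC.
  have := le_trans wv vd; nra.
move: vd; rewrite -ltNge => vd.
have v0 : 0 < cabs v by rewrite (lt_trans d0).
have e1 : cabs (rc (dl / cabs v) * v - v) = cabs v - dl.
  have -> : rc (dl / cabs v) * v - v = rc (dl / cabs v - 1) * v.
    by rewrite rcD rcN rc1; ring.
  rewrite cabsM cabs_rc ler0_norm; last by rewrite subr_le0 ler_pdivrMr // mul1r ltW.
  by field; rewrite gt_eqF.
case: ifPn => wd.
  have h : cabs (rc (dl / cabs v) * v - w) <= 2 * cabs (v - w).
    apply: le_trans (cabs_tri _ _ v) _; rewrite e1.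
    by move: vw wd; lra.
  nra.
move: wd; rewrite -ltNge => wd.
have w1 : 0 < cabs w by rewrite (lt_trans d0).
have -> : rc (dl / cabs v) * v - rc (dl / cabs w) * w =
  rc (dl / cabs w) * (v - w) + rc (dl / cabs v - dl / cabs w) * v.
  by rewrite rcD rcN; ring.
apply: le_trans (ler_wpM2r w0 (cabsD _ _)) _.
rewrite !cabsM !cabs_rc (ger0_norm (divr_ge0 (ltW d0) w0)).
have -> : `|dl / cabs v - dl / cabs w| = dl / cabs w - dl / cabs v.
  rewrite distrC ger0_norm // subr_ge0 ler_pM2l // lef_pV2 ?posrE //.
have -> : (dl / cabs w * cabs (v - w) + (dl / cabs w - dl / cabs v) * cabs v) * cabs w =
  dl * cabs (v - w) + dl * (cabs v - cabs w).
  by field; rewrite !gt_eqF.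
nra.
Qed.

(* A bi-Lipschitz radial change of parameter under which the trace of a small ball
   is a round disc; [clamp] extends it to the whole line. *)
Let theta v : C := rc (g (clamp v)) * v.

Lemma theta0 : theta 0 = 0. Proof. by rewrite /theta mulr0. Qed.

(** [theta] is the multiplication by [g0] up to an error whose Lipschitz constant is a fraction of
    [g0]; this makes it bi-Lipschitz and injective. *)
Lemma theta_near v w :
  cabs (theta v - theta w - rc g0 * (v - w)) <= g0 / 4 * cabs (v - w).
Proof.
wlog wv : v w / cabs w <= cabs v.
  move=> H; have [|/ltW h] := leP (cabs w) (cabs v); first exact: H.
  have := H w v h; rewrite (cabsB w v) -cabsN (_ : - _ = theta v - theta w - rc g0 * (v - w)) //.
  by ring.
have -> : theta v - theta w - rc g0 * (v - w) =
  rc (g (clamp v) - g0) * (v - w) + rc (g (clamp v) - g (clamp w)) * w.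
  by rewrite /theta !rcD !rcN; ring.
apply: le_trans (cabsD _ _) _; rewrite !cabsM !cabs_rc.
have L0 : 0 <= 1 + 4 * a by have := a_gt0; lra.
have h1 : `|g (clamp v) - g0| <= g0 / 20.
  apply: le_trans dl_small; apply: le_trans (@g_lip _ 0 (clamp_le v) _) _.
    by rewrite cabs0 ltW // dl_gt0.
  by rewrite subr0 ler_wpM2l // clamp_le.
have h2 : `|g (clamp v) - g (clamp w)| * cabs w <= g0 / 10 * cabs (v - w).
  apply: le_trans (ler_wpM2r (cabs_ge0 w) (g_lip (clamp_le v) (clamp_le w))) _.
  rewrite -[leLHS]mulrA; apply: le_trans (ler_wpM2l L0 (clamp_lip wv)) _.
  have := ler_wpM2r (cabs_ge0 (v - w)) dl_small.
  by move: (cabs (v - w)) => x; lra.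
have := ler_wpM2r (cabs_ge0 (v - w)) h1; have := mulr_ge0 (ltW g0_gt0) (cabs_ge0 (v - w)).
by move: h2; lra.
Qed.

Lemma theta_bilip v w : g0 / 2 * cabs (v - w) <= cabs (theta v - theta w) /\
  cabs (theta v - theta w) <= 2 * g0 * cabs (v - w).
Proof.
have h := theta_near v w.
have e : cabs (rc g0 * (v - w)) = g0 * cabs (v - w).
  by rewrite cabsM cabs_rc ger0_norm // ltW // g0_gt0.
have := cabs_sub (rc g0 * (v - w)) (theta v - theta w).
have := cabs_sub (theta v - theta w) (rc g0 * (v - w)).
rewrite (cabsB (rc g0 * _)) e; have := mulr_ge0 (ltW g0_gt0) (cabs_ge0 (v - w)).
by move: h; split; lra.
Qed.

(** Each ray from the origin is mapped into itself, so the intermediate value theorem in one real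
    variable suffices. *)
Lemma theta_surj z : exists v, theta v = z.
Proof.
have [->|z0] := eqVneq z 0; first by exists 0; exact: theta0.
have c0 : 0 < cabs z by rewrite lt_neqAle cabs_ge0 eq_sym cabs_eq0 z0.
have gp := g0_gt0.
have [e [e1 ez]] : exists e, cabs e = 1 /\ rc (cabs z) * e = z.
  exists (rc (cabs z)^-1 * z); split.
    by rewrite cabsM cabs_rc ger0_norm ?invr_ge0 ?cabs_ge0 // mulVf // gt_eqF.
  by rewrite mulrA -rcM divff ?mul1r // gt_eqF.
pose phi (s : R) : R := g (clamp (rc s * e)) * s.
have tphi s : theta (rc s * e) = rc (phi s) * e.
  by rewrite /theta /phi rcM; ring.
have lip s s' : `|phi s - phi s'| <= 2 * g0 * `|s - s'|.
  have [_] := theta_bilip (rc s * e) (rc s' * e).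
  rewrite !tphi -!mulrBl !cabsM e1 !mulr1.
  by rewrite -!rcN -!rcD !cabs_rc.
have cphi : continuous phi.
  move=> s; apply/cvgrPdist_lt => eps eps0.
  have d0 : 0 < eps / (2 * g0) by rewrite divr_gt0 // mulr_gt0.
  apply: (@filterS _ (nbhs s) _ _ _ _ (nbhsx_ballx s _ d0)) => u.
  rewrite /ball /= => h; apply: le_lt_trans (lip _ _) _.
  by rewrite mulrC -ltr_pdivlMr ?mulr_gt0.
pose T := 2 * cabs z / g0.
have T0 : 0 <= T by rewrite divr_ge0 ?mulr_ge0 // ltW.
have phi0 : phi 0 = 0 by rewrite /phi mulr0.
have phiT : cabs z <= phi T.
  have [+ _] := theta_bilip (rc T * e) 0.
  rewrite theta0 !subr0 tphi !cabsM e1 !mulr1 !cabs_rc ger0_norm //.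
  rewrite (_ : g0 / 2 * T = cabs z); last by rewrite /T; field; rewrite gt_eqF.
  by rewrite ger0_norm // /phi mulr_ge0 // nq_ge0.
have [|s _ hs] := @IVT _ phi 0 T (cabs z) T0 (continuous_subspaceT cphi).
  by rewrite phi0 ge_min le_max (ltW c0) phiT orbT.
by exists (rc s * e); rewrite tphi hs.
Qed.

Let m0 : R := Num.min (a / 10) (a ^+ 2 / 2).

Lemma m0_gt0 : 0 < m0.
Proof. by rewrite lt_min !divr_gt0 ?exprn_gt0 // a_gt0. Qed.

(** The components of [G] have no common zero: in terms of the first one, [u = 2 t0 + v], the second
    is [t0^2 - t0 u + u^2], which is close to [t0^2] when [u] is small. This keeps distant
    parameters out of the ball. *)
Lemma g_low v : m0 <= g v.
Proof.
rewrite /m0 ge_min; have [h|h] := leP (a / 10) (cabs (2 * t0 + v)).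
  by rewrite (le_trans h) //; exact: (nq_fst (G v)).
apply/orP; right; apply: le_trans (nq_snd (G v)) => /=.
set u := 2 * t0 + v in h *.
have -> : 3 * t0 ^+ 2 + 3 * t0 * v + v ^+ 2 = t0 ^+ 2 - (t0 * u - u ^+ 2).
  by rewrite /u; ring.
have h2 := cabsD (t0 * u) (- u ^+ 2).
rewrite cabsN cabsX (cabsM t0 u) -/a in h2.
have h3 := cabs_sub (t0 ^+ 2) (t0 * u - u ^+ 2).
rewrite cabsX -/a in h3.
have u0 := cabs_ge0 u; have a0 := a_gt0.
move: h h2 h3 u0; move: (cabs u) (cabs (t0 * u - u ^+ 2)) (cabs (t0 ^+ 2 - _)).
move=> x y w h h2 h3 u0.
have : 0 <= (a / 10 - x) * (a / 10 + x) by rewrite mulr_ge0 //; lra.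
have : 0 <= (a / 10 - x) * a by rewrite mulr_ge0 //; lra.
have : 0 < a ^+ 2 by rewrite exprn_gt0.
lra.
Qed.

Let rho0 : R := Num.min (g0 / 2 * dl) (dl * m0).

Lemma rho0_gt0 : 0 < rho0.
Proof.
by rewrite lt_min (mulr_gt0 _ dl_gt0) ?(mulr_gt0 dl_gt0 m0_gt0) // divr_gt0 // g0_gt0.
Qed.

(** For [cabs v <= dl] the clamp is the identity and the two quantities coincide; beyond, both
    exceed [rho], by the choice of [rho0]. *)
Lemma theta_ball v rho : rho < rho0 ->
  ((nq (cusp (t0 + v) - cusp t0) < rho) = (cabs (theta v) < rho)) /\
  ((nq (cusp (t0 + v) - cusp t0) <= rho) = (cabs (theta v) <= rho)).
Proof.
rewrite lt_min => /andP[r1 r2]; rewrite cusp_shift.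
have [vd|vd] := leP (cabs v) dl.
  have -> : cabs (theta v) = cabs v * g v.
    rewrite /theta /clamp vd cabsM cabs_rc ger0_norm ?nq_ge0 // mulrC.
    by [].
  by [].
have h1 : rho < cabs v * g v.
  apply: lt_le_trans r2 _; apply: ler_pM; rewrite ?g_low //; last exact: ltW.
    by rewrite ltW // dl_gt0.
  by rewrite ltW // m0_gt0.
have h2 : rho < cabs (theta v).
  apply: lt_le_trans r1 _; have [+ _] := theta_bilip v 0.
  rewrite theta0 !subr0; apply: le_trans.
  by rewrite ler_wpM2l ?ltW // divr_gt0 // g0_gt0.
by rewrite !(leNgt _ rho) h1 h2 !ltNge !(ltW h1) !(ltW h2).
Qed.

Lemma chart_at : exists (th thi : C -> C) (gg rho : R),
  [/\ [/\ 0 < gg, 0 < rho & th t0 = 0], cancel th thi, cancel thi th,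
    forall s t, gg / 2 * cabs (s - t) <= cabs (th s - th t) /\
      cabs (th s - th t) <= 2 * gg * cabs (s - t) &
    forall r t, r < rho ->
      ((nq (cusp t - cusp t0) < r) = (cabs (th t) < r)) /\
      ((nq (cusp t - cusp t0) <= r) = (cabs (th t) <= r))].
Proof.
pose thi z := t0 + projT1 (cid (theta_surj z)).
have thiK z : theta (thi z - t0) = z.
  by rewrite /thi addrAC subrr add0r; exact: (projT2 (cid (theta_surj z))).
have inj v w : theta v = theta w -> v = w.
  move=> e; have [+ _] := theta_bilip v w; rewrite e subrr cabs0 => h.
  apply/eqP; rewrite -subr_eq0 -cabs_eq0 eq_le cabs_ge0 andbT.
  by move: h; rewrite pmulr_rle0 // divr_gt0 // g0_gt0.
exists (fun t => theta (t - t0)), thi, g0, rho0; split.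
- by split; rewrite ?g0_gt0 ?rho0_gt0 // subrr theta0.
- move=> t; apply: (addIr (- t0)); exact: inj.
- by [].
- move=> s t; have := theta_bilip (s - t0) (t - t0).
  by rewrite opprB addrA subrK.
- by move=> r t h; have := theta_ball (t - t0) h; rewrite addrCA subrr addr0.
Qed.

End radial_chart.

(** * The inductive choice of the balls *)

Section ball_selection.
Context {R : realType}.
Local Notation C := (Cx R).
Local Notation Q := (C * C)%type.
Implicit Types (s t z : C) (r : R) (x y : Q) (l : seq (C * R)).

Definition is_chart (t0 : C) (ch : (C -> C) * (C -> C) * R * R) :=
  let: (th, thi, gg, rho) := ch in
  [/\ [/\ 0 < gg, 0 < rho & th t0 = 0], cancel th thi, cancel thi th,
    forall s t, gg / 2 * cabs (s - t) <= cabs (th s - th t) /\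
      cabs (th s - th t) <= 2 * gg * cabs (s - t) &
    forall r t, r < rho ->
      ((nq (cusp t - cusp t0) < r) = (cabs (th t) < r)) /\
      ((nq (cusp t - cusp t0) <= r) = (cabs (th t) <= r))].

Lemma chart_exists t0 : exists ch, t0 != 0 -> is_chart t0 ch.
Proof.
have [->|t00] := eqVneq t0 0; first by exists (id, id, 0, 0).
by have [th [thi [gg [rho H]]]] := chart_at t00; exists (th, thi, gg, rho).
Qed.

Definition chart t0 := projT1 (cid (chart_exists t0)).
Lemma chartP t0 : t0 != 0 -> is_chart t0 (chart t0).
Proof. exact: (projT2 (cid (chart_exists t0))). Qed.

Definition ch_map t0 := (chart t0).1.1.1.
Definition ch_inv t0 := (chart t0).1.1.2.
Definition ch_scale t0 := (chart t0).1.2.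
Definition ch_size t0 := (chart t0).2.

Definition in_balls l x := exists2 b, b \in l & nq (x - cusp b.1) <= b.2.

(** The conditions on the [n]-th ball, given the list [l] of the earlier ones. After those on centre
    and radius, the clauses are meant for the fields [bk_diam], [br_sep], [bk_lip2] and [b_local],
    in this order. *)
Definition good_ball (n : nat) l (b : C * R) :=
  [/\ [/\ b.1 != 0, 0 < b.2, b.2 <= 2^-1 ^+ n.+1 & b.2 < ch_size b.1],
    2 / ch_scale b.1 * b.2 <= 8^-1 ^+ n,
    forall b' x, b' \in l -> nq (x - cusp b'.1) <= b'.2 ->
      2 ^+ n.+1 * b.2 <= nq (x - cusp b.1),
    forall b' s, b' \in l -> nq (cusp s - cusp b'.1) <= b'.2 ->
      2 * 8 ^+ n.+1 * b.2 <= ch_scale b.1 / 2 * cabs (s - b.1) &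
    forall x, nq (x - cusp b.1) <= b.2 ->
      [/\ x.1 != 0, x.2 != 0 &
        cabs (x.1 - (x.2 / x.1) ^+ 2) <= cabs (x.2 / x.1) ^+ 2 / 64]].

Definition small (P : R -> Prop) := exists2 e, 0 < e & forall r, 0 < r -> r <= e -> P r.

Lemma smallI P P' : small P -> small P' -> small (fun r => P r /\ P' r).
Proof.
move=> [e e0 He] [d d0 Hd]; exists (Num.min e d); first by rewrite lt_min e0.
by move=> r r0; rewrite le_min => /andP[re rd]; split; [exact: He|exact: Hd].
Qed.

Lemma small_lin (a b : R) : 0 <= a -> 0 < b -> small (fun r => a * r <= b).
Proof.
move=> a0 b0; exists (b / (a + 1)); first by rewrite divr_gt0 // ltr_wpDl.
move=> r r0; rewrite ler_pdivlMr ?ltr_wpDl // mulrDr mulr1 mulrC => h.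
by apply: le_trans h; rewrite lerDl ltW.
Qed.

Lemma small_mem l (P : C * R -> R -> Prop) :
  (forall b, b \in l -> small (P b)) -> small (fun r => forall b, b \in l -> P b r).
Proof.
elim: l => [|b l IH] H; first by exists 1.
have [e e0 He] : small (fun r => forall b, b \in l -> P b r).
  by apply: IH => b' hb'; apply: H; rewrite inE hb' orbT.
have [d d0 Hd] := H b (mem_head _ _).
exists (Num.min e d); first by rewrite lt_min e0.
move=> r r0; rewrite le_min => /andP[re rd] b'; rewrite inE => /orP[/eqP ->|].
  exact: Hd.
exact: He.
Qed.

(** At [cusp t] the slope is [t] and [x.1 - (x.2 / x.1) ^+ 2] vanishes, so the inequality is strict
    there and persists nearby. *)
Lemma small_local t : t != 0 -> small (fun r => forall x, nq (x - cusp t) <= r ->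
  [/\ x.1 != 0, x.2 != 0 &
    cabs (x.1 - (x.2 / x.1) ^+ 2) <= cabs (x.2 / x.1) ^+ 2 / 64]).
Proof.
move=> t0.
have id_cvg : (fun x : Q => x) @ nbhs (cusp t) --> cusp t by exact: cvg_id.
have c1 : (fun x : Q => x.1) @ nbhs (cusp t) --> (cusp t).1 by apply: cvgQ_fst.
have c2 : (fun x : Q => x.2) @ nbhs (cusp t) --> (cusp t).2 by apply: cvgQ_snd.
have n1 : (cusp t).1 != 0 by rewrite expf_neq0.
have n2 : (cusp t).2 != 0 by rewrite expf_neq0.
have cq : (fun x : Q => x.2 / x.1) @ nbhs (cusp t) --> (cusp t).2 / (cusp t).1.
  have c3 : (fun x : Q => x.1^-1) @ nbhs (cusp t) --> (cusp t).1^-1.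
    by apply: (@cvgV _ _ (nbhs (cusp t)) _ (fun x : Q => x.1) _ n1 c1).
  exact: (cvgM c2 c3).
have eq0 : (cusp t).2 / (cusp t).1 = t by rewrite /cusp /=; field.
rewrite eq0 in cq.
have a0 : 0 < cabs t by rewrite lt_neqAle cabs_ge0 eq_sym cabs_eq0 t0.
have a30 : 0 < cabs t / 3 by rewrite divr_gt0.
have h0 : 0 < (cabs t / 2) ^+ 2 / 64 by rewrite divr_gt0 // exprn_gt0 // divr_gt0.
have cd : (fun x : Q => x.1 - (x.2 / x.1) ^+ 2) @ nbhs (cusp t) --> (0 : C).
  have ct : (cusp t).1 - t ^+ 2 = 0 by rewrite /cusp /= subrr.
  have cq2 : (fun x : Q => (x.2 / x.1) ^+ 2) @ nbhs (cusp t) --> t ^+ 2 by apply: cvg_exp.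
  by rewrite -ct; exact: (cvgB c1 cq2).
have e1 := near_neq n1; have e2 := near_neq n2.
have k1 : \forall x \near cusp t, x.1 != 0 by exact: (c1 _ e1).
have k2 : \forall x \near cusp t, x.2 != 0 by exact: (c2 _ e2).
have k3 := @cvgCE _ _ (nbhs (cusp t)) (nbhs_filter _) _ _ _ cq a30.
have k4 := @cvgCE _ _ (nbhs (cusp t)) (nbhs_filter _) _ _ _ cd h0.
have [e e_gt0 He] := (nbhsQ _ _).1 (filterI (filterI k1 k2) (filterI k3 k4)).
exists (e / 2); first by rewrite divr_gt0.
move=> r r0 re x xr; have [|[x1 x2] [x3 x4]] := He x; first by move: xr re; lra.
split => //; rewrite subr0 in x4.
have h5 : cabs t / 2 <= cabs (x.2 / x.1).
  by have := cabs_sub t (x.2 / x.1); rewrite cabsB; move: x3; lra.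
apply: le_trans (ltW x4) _; rewrite ler_wpM2r //.
by apply: lerXn2r => //; rewrite nnegrE ?cabs_ge0 // divr_ge0 // cabs_ge0.
Qed.

Lemma good_radius n l t : t != 0 -> ~ in_balls l (cusp t) ->
  exists r, good_ball n l (t, r).
Proof.
move=> t0 tl.
have := chartP t0; rewrite /is_chart.
case E : (chart t) => [[[th thi] gg] rho] [[gg0 rho0 tht] _ _ _ _].
have ggE : ch_scale t = gg by rewrite /ch_scale E.
have rhoE : ch_size t = rho by rewrite /ch_size E.
have gap b : b \in l -> 0 < nq (cusp t - cusp b.1) - b.2.
  move=> bl; rewrite subr_gt0 ltNge; apply/negP => h; apply: tl; by exists b.
have p1 : small (fun r => 1 * r <= 2^-1 ^+ n.+1) by apply: small_lin => //; exact: half_gt0.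
have p2 : small (fun r => 2 * r <= rho) by apply: small_lin.
have p3 : small (fun r => 2 / gg * r <= 8^-1 ^+ n).
  by apply: small_lin; rewrite ?divr_ge0 ?ltW // exprn_gt0 // invr_gt0.
have p4 : small (fun r => forall b', b' \in l ->
    2 ^+ n.+1 * r <= nq (cusp t - cusp b'.1) - b'.2).
  by apply: small_mem => b bl; apply: small_lin; [rewrite exprn_ge0|exact: gap].
have p5 : small (fun r => forall b', b' \in l -> forall s, nq (cusp s - cusp b'.1) <= b'.2 ->
    2 * 8 ^+ n.+1 * r <= gg / 2 * cabs (s - t)).
  apply: small_mem => b bl.
  have [e e0 He] := (nbhsC _ _).1 (@cvgQE _ _ (nbhs t) (nbhs_filter _) _ _ _ (@cont_cusp _ t) (gap b bl)).
  have [d d0 Hd] : small (fun r => 2 * 8 ^+ n.+1 * r <= gg / 2 * e).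
    by apply: small_lin; [rewrite mulr_ge0 ?exprn_ge0|rewrite mulr_gt0 ?divr_gt0].
  exists d => // r r0 rd s sb; apply: le_trans (Hd r r0 rd) _.
  rewrite ler_wpM2l //; first by rewrite divr_ge0 // ltW.
  rewrite leNgt; apply/negP => /He; have := nq_tri (cusp t) (cusp b.1) (cusp s).
  by rewrite (nqB (cusp t) (cusp s)); move: sb; lra.
have [e e0 He] := smallI (smallI p1 p2) (smallI (smallI p3 p4) (smallI p5 (small_local t0))).
have [[h1 h2] [[h3 h4] [h5 h6]]] := He e e0 (lexx e).
exists e; split => //=; rewrite ?ggE ?rhoE //.
- by split => //; move: h1 h2; lra.
- move=> b' x b'l hx; apply: le_trans (h4 b' b'l) _.
  have := nq_tri (cusp t) (cusp b'.1) x; rewrite (nqB (cusp t) x); move: hx; lra.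
- by move=> b' s b'l hs; apply: h5 b'l s hs.
Qed.

(** An enumeration of the complex numbers with rational coordinates; [0], the parameter of the cusp,
    cannot be a centre and is replaced by [1]. *)
Definition dense_point (n : nat) : C :=
  if choice.unpickle n is Some (p, q) then
    let z := mkc (ratr p) (ratr q) in if z == 0 then 1 else z
  else 1.

Lemma dense_point_neq0 n : dense_point n != 0.
Proof.
rewrite /dense_point; case: choice.unpickle => [[p q]|]; last exact: oner_neq0.
by case: ifPn => // _; exact: oner_neq0.
Qed.

Lemma rat_near (x e : R) : 0 < e -> exists p : rat, ratr p != x /\ `|ratr p - x| < e.
Proof.
move=> e0; have [|p] := @rat_in_itvoo R x (x + e); first by rewrite ltrDl.
rewrite in_itv /= => /andP[h1 h2]; exists p; split; first by rewrite gt_eqF.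
by rewrite ger0_norm; lra.
Qed.

Lemma dense_pointP (z : C) (e : R) : 0 < e -> exists n, cabs (dense_point n - z) < e.
Proof.
move=> e0; have e20 : 0 < e / 2 by rewrite divr_gt0.
have [p [_ hp]] := rat_near (re z) e20.
(* A nonzero imaginary part prevents the replacement of [0] by [1]. *)
have [q [q0 hq]] : exists q : rat, (ratr q : R) != 0 /\ `|ratr q - im z| < e / 2.
  have [i0|i0] := eqVneq (im z) 0.
    by have [q [q1 q2]] := rat_near (im z) e20; exists q; split; rewrite -?i0.
  have m0 : 0 < Num.min (e / 2) `|im z| by rewrite lt_min e20 normr_gt0.
  have [q [q1]] := rat_near (im z) m0; rewrite lt_min => /andP[q2 q3].
  exists q; split => //; apply/eqP => h; move: q3.
  by rewrite h sub0r normrN ltxx.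
exists (choice.pickle (p, q)); rewrite /dense_point choice.pickleK.
have -> : (mkc (ratr p) (ratr q) == 0 :> C) = false.
  by apply/negbTE/eqP => /(congr1 im) h; move: q0; rewrite (h : ratr q = 0) eqxx.
apply: le_lt_trans (cabs_le _) _; rewrite reD imD reN imN /=.
by move: hp hq; rewrite /re /im /=; lra.
Qed.

(** If the [n]-th dense point is already covered, a ball far out on the curve is taken instead, so
    that every index carries a ball. *)
Lemma next_ball n l : exists b, good_ball n l b /\
  (b.1 = dense_point n \/ in_balls l (cusp (dense_point n))).
Proof.
have [h|h] := pselect (in_balls l (cusp (dense_point n))); last first.
  have [r hr] := good_radius n (dense_point_neq0 n) h.
  by exists (dense_point n, r); split => //; left.
have [M [M1 HM]] : exists M : R, 1 <= M /\ forall b, b \in l -> nq (cusp b.1) + b.2 < M.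
  elim: (l) => [|b l' [M [M1 HM]]]; first by exists 1.
  exists (Num.max M (nq (cusp b.1) + b.2 + 1)); split; first by rewrite le_max M1.
  move=> b'; rewrite inE => /orP[/eqP ->|/HM h']; rewrite lt_max ?h' //.
  by rewrite orbC ltrDl ltr01.
have M0 : rc M != 0 by rewrite rc_eq0 gt_eqF // (lt_le_trans ltr01).
have [|r hr] := @good_radius n l (rc M) M0.
  move=> [b bl hb]; have := HM b bl.
  have : M <= nq (cusp (rc M)).
    apply: le_trans (nq_fst (cusp (rc M))); rewrite /= cabsX cabs_rc ger0_norm ?(le_trans ler01) //.
    by rewrite expr2 ler_peMr // (le_trans ler01).
  by have := nq_sub (cusp (rc M)) (cusp b.1); move: hb; lra.
by exists (rc M, r); split => //; right.
Qed.

Definition choose_ball n l := projT1 (cid (next_ball n l)).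
Fixpoint ball_list n : seq (C * R) :=
  if n is m.+1 then rcons (ball_list m) (choose_ball m (ball_list m)) else [::].
Definition ball n := choose_ball n (ball_list n).

Lemma ballP n : good_ball n (ball_list n) (ball n) /\
  ((ball n).1 = dense_point n \/ in_balls (ball_list n) (cusp (dense_point n))).
Proof. exact: (projT2 (cid (next_ball n (ball_list n)))). Qed.

Lemma ball_mem m n : (m < n)%N -> ball m \in ball_list n.
Proof.
elim: n => //= n IH; rewrite ltnS leq_eqVlt mem_rcons inE => /orP[/eqP ->|/IH ->].
  by rewrite eqxx.
by rewrite orbT.
Qed.

Lemma ball_listP n b : b \in ball_list n -> exists m, b = ball m.
Proof.
elim: n => //= n IH; rewrite mem_rcons inE => /orP[/eqP ->|/IH//].
by exists n.
Qed.

Let bt n := (ball n).1.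
Let br n := (ball n).2.
Let th n := ch_map (bt n).
Let thi n := ch_inv (bt n).
Let gg n := ch_scale (bt n).
(** In the chart the trace of the ball is a round disc, and the involution of the parameter is the
    plane inversion in its boundary. *)
Let bk n t := thi n (pinv (br n) (th n t)).

Lemma bt_neq0 n : bt n != 0. Proof. by have [[[]]] := ballP n. Qed.
Lemma br_pos n : 0 < br n. Proof. by have [[[]]] := ballP n. Qed.
Lemma br_size n : br n < ch_size (bt n). Proof. by have [[[]]] := ballP n. Qed.
Let chp n := chartP (bt_neq0 n).

Lemma chartE t : chart t = (ch_map t, ch_inv t, ch_scale t, ch_size t).
Proof. by rewrite /ch_map /ch_inv /ch_scale /ch_size; case: (chart t) => [[[]]]. Qed.

Lemma gg_pos n : 0 < gg n. Proof. by have := chp n; rewrite chartE => -[[]]. Qed.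
Lemma th0 n : th n (bt n) = 0. Proof. by have := chp n; rewrite chartE => -[[]]. Qed.
Lemma thK n : cancel (th n) (thi n). Proof. by have := chp n; rewrite chartE => -[]. Qed.
Lemma thiK n : cancel (thi n) (th n). Proof. by have := chp n; rewrite chartE => -[]. Qed.
Lemma th_low n s t : gg n / 2 * cabs (s - t) <= cabs (th n s - th n t).
Proof. by have := chp n; rewrite chartE => -[_ _ _ /(_ s t)[]]. Qed.
Lemma th_up n s t : cabs (th n s - th n t) <= 2 * gg n * cabs (s - t).
Proof. by have := chp n; rewrite chartE => -[_ _ _ /(_ s t)[]]. Qed.
Lemma th_lt n t : (nq (cusp t - cusp (bt n)) < br n) = (cabs (th n t) < br n).
Proof. by have := chp n; rewrite chartE => -[_ _ _ _ /(_ _ t (br_size n))[]]. Qed.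
Lemma th_le n t : (nq (cusp t - cusp (bt n)) <= br n) = (cabs (th n t) <= br n).
Proof. by have := chp n; rewrite chartE => -[_ _ _ _ /(_ _ t (br_size n))[]]. Qed.
Lemma th_ge n t : (br n <= nq (cusp t - cusp (bt n))) = (br n <= cabs (th n t)).
Proof. by rewrite leNgt th_lt -leNgt. Qed.
Lemma th_gt n t : (br n < nq (cusp t - cusp (bt n))) = (br n < cabs (th n t)).
Proof. by rewrite ltNge th_le -ltNge. Qed.
Lemma th_eq0 n t : (th n t == 0) = (t == bt n).
Proof. by rewrite -(th0 n) (inj_eq (can_inj (@thK n))). Qed.
Lemma thi_lip n s t : cabs (thi n s - thi n t) <= 2 / gg n * cabs (s - t).
Proof.
have := th_low n (thi n s) (thi n t); rewrite !thiK => h.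
rewrite mulrAC ler_pdivlMr ?gg_pos // mulrC.
by move: h; lra.
Qed.
Lemma th_bk n t : th n (bk n t) = pinv (br n) (th n t).
Proof. by rewrite thiK. Qed.

Lemma bk_dist n s t : s != bt n -> t != bt n ->
  cabs (bk n s - bk n t) <=
  4 * br n ^+ 2 / (cabs (th n s) * cabs (th n t)) * cabs (s - t).
Proof.
move=> sn tn; apply: le_trans (thi_lip _ _ _) _.
rewrite pinv_dist ?th_eq0 //.
have h := th_up n s t; have g0 := gg_pos n.
have p0 u : u != bt n -> 0 < cabs (th n u).
  by move=> un; rewrite lt_neqAle cabs_ge0 eq_sym cabs_eq0 th_eq0 un.
have ps := p0 s sn; have pt := p0 t tn.
have P0 : 0 <= 2 / gg n * (br n ^+ 2 / (cabs (th n s) * cabs (th n t))).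
  by rewrite mulr_ge0 ?divr_ge0 ?sqr_ge0 ?mulr_ge0 ?cabs_ge0 // (ltW g0).
have := ler_wpM2l P0 h.
rewrite (_ : 2 / gg n * _ * (2 * gg n * _) =
  4 * br n ^+ 2 / (cabs (th n s) * cabs (th n t)) * cabs (s - t)); last first.
  by field; rewrite !gt_eqF.
apply: le_trans; rewrite le_eqVlt; apply/orP; left; apply/eqP.
by field; rewrite !gt_eqF.
Qed.

Lemma ball_system_exists : inhabited (ball_system R).
Proof.
constructor; apply: (@BallSystem R bt br bk).
- exact: br_pos.
- by move=> i; have [[[]]] := ballP i.
- move=> i j x ji hx; have [[_ _ H _ _] _] := ballP i.
  exact: (H (ball j) x (ball_mem ji) hx).
- move=> i t; rewrite /bk thiK pinvK ?thK // gt_eqF // br_pos //.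
- by move=> i; rewrite /bk th0 /pinv -rc0 cj_rc rc0 invr0 mulr0 -(th0 i) thK.
- move=> i t h.
  have e : cabs (th i t) = br i by apply/eqP; rewrite eq_le -th_le -th_ge h lexx.
  by rewrite /bk pinv_circle ?thK // br_pos.
- move=> i t tc; rewrite th_gt th_lt th_bk cabs_pinv => h.
  have p0 : 0 < cabs (th i t) by rewrite lt_neqAle cabs_ge0 eq_sym cabs_eq0 th_eq0 tc.
  by rewrite ltr_pdivlMr // expr2 ltr_pM2l // br_pos.
- move=> i t; rewrite th_gt th_lt th_bk cabs_pinv => h.
  by rewrite ltr_pdivrMr ?(lt_trans (br_pos i)) // expr2 ltr_pM2l // br_pos.
- move=> i t tc.
  have lip_cont (F : C -> C) (K : R) u : 0 < K ->
      (forall v w, cabs (F v - F w) <= K * cabs (v - w)) -> {for u, continuous F}.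
    move=> K0 H; apply: (@cvgCI _ _ (nbhs u)) => e e0; apply/nbhsC.
    exists (e / K); first by rewrite divr_gt0.
    by move=> v; rewrite ltr_pdivlMr // mulrC; apply: le_lt_trans.
  have g0 := gg_pos i.
  have c1 : {for t, continuous (th i)}.
    by apply: (lip_cont _ (2 * gg i)); [rewrite mulr_gt0|exact: th_up].
  have c2 : {for th i t, continuous (pinv (br i))} by apply: cont_pinv; rewrite th_eq0.
  have c3 : {for pinv (br i) (th i t), continuous (thi i)}.
    by apply: (lip_cont _ (2 / gg i)); [rewrite divr_gt0|exact: thi_lip].
  exact: (cvg_comp _ _ (cvg_comp _ _ c1 c2) c3).
- move=> i M; have g0 := gg_pos i; have r0 := br_pos i.
  pose M' := `|M| + cabs (bt i) + 1.
  have M'0 : 0 < M' by rewrite ltr_wpDl ?addr_ge0 ?cabs_ge0.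
  exists (br i ^+ 2 / (4 * gg i ^+ 2 * M')).
    by rewrite divr_gt0 ?exprn_gt0 // !mulr_gt0 ?exprn_gt0.
  move=> t tc td.
  have p0 : 0 < cabs (th i t) by rewrite lt_neqAle cabs_ge0 eq_sym cabs_eq0 th_eq0 tc.
  have h1 := th_up i t (bt i); rewrite th0 subr0 in h1.
  have h2 := th_up i (bk i t) (bt i); rewrite th0 subr0 th_bk cabs_pinv in h2.
  have h3 : M' <= cabs (bk i t - bt i).
    have q0 : 0 < 2 * gg i by rewrite mulr_gt0.
    rewrite -(ler_pM2l q0); apply: le_trans h2.
    rewrite ler_pdivlMr //; apply: (@le_trans _ _ (2 * gg i * M' * (2 * gg i * (br i ^+ 2 / (4 * gg i ^+ 2 * M'))))).
      apply: ler_wpM2l; first by rewrite ltW // !mulr_gt0.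
      by apply: le_trans h1 _; rewrite ler_pM2l // ltW.
    rewrite le_eqVlt; apply/orP; left; apply/eqP; field.
    by rewrite !gt_eqF.
  have := cabsD (bk i t) (- bt i); rewrite cabsN.
  have := ler_norm M; move: h3; rewrite /M'; lra.
- move=> i s t; rewrite !th_ge => hs ht; have r0 := br_pos i.
  have nc u : br i <= cabs (th i u) -> u != bt i.
    by move=> h; rewrite -th_eq0 -cabs_eq0 gt_eqF // (lt_le_trans r0).
  apply: le_trans (bk_dist (nc _ hs) (nc _ ht)) _.
  rewrite ler_wpM2r ?cabs_ge0 // ler_pdivrMr; last by rewrite mulr_gt0 // (lt_le_trans r0).
  by rewrite ler_wpM2l // expr2 ler_pM // ltW.
- move=> i j s t ji sj tj; have r0 := br_pos i.
  have [[_ _ _ H _] _] := ballP i.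
  have low u : nq (cusp u - cusp (bt j)) <= br j -> 2 * 8 ^+ i.+1 * br i <= cabs (th i u).
    move=> hu; apply: le_trans (H (ball j) u (ball_mem ji) hu) _.
    by have := th_low i u (bt i); rewrite th0 subr0.
  have hs := low s sj; have ht := low t tj.
  have k0 : 0 < 2 * 8 ^+ i.+1 * br i by rewrite !mulr_gt0 // exprn_gt0.
  have nc u : 2 * 8 ^+ i.+1 * br i <= cabs (th i u) -> u != bt i.
    by move=> h; rewrite -th_eq0 -cabs_eq0 gt_eqF // (lt_le_trans k0).
  apply: le_trans (bk_dist (nc _ hs) (nc _ ht)) _.
  rewrite ler_wpM2r ?cabs_ge0 // ler_pdivrMr; last by rewrite mulr_gt0 // (lt_le_trans k0).
  have e8 : 1 <= (8 : R) ^+ i.+1 by rewrite exprn_ege1 // ler1n.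
  have e80 : 0 < (8 : R) ^+ i.+1 by rewrite exprn_gt0.
  apply: (@le_trans _ _ (8^-1 ^+ i.+1 * ((2 * 8 ^+ i.+1 * br i) * (2 * 8 ^+ i.+1 * br i)))); last first.
    rewrite ler_wpM2l ?exprn_ge0 ?invr_ge0 //; apply: ler_pM => //; exact: ltW.
  rewrite exprVn (_ : _^-1 * _ = 4 * 8 ^+ i.+1 * br i ^+ 2); last by field; rewrite gt_eqF.
  by rewrite ler_wpM2r ?sqr_ge0 // ler_peMr.
- move=> i t; rewrite th_le => h; have [[_ H _ _ _] _] := ballP i.
  apply: le_trans H; have := thi_lip i (th i t) (th i (bt i)); rewrite !thK th0 subr0.
  by move=> h'; apply: le_trans h' _; rewrite ler_wpM2l // divr_ge0 // ltW // gg_pos.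
- by move=> i x; have [[_ _ _ _ H] _] := ballP i; exact: H.
- move=> z e e0; have e20 : 0 < e / 2 by rewrite divr_gt0.
  have [n hn] := dense_pointP z e20.
  have [_ [h|[b /ball_listP[m ->] hb]]] := ballP n.
    exists n, (dense_point n); rewrite -h subrr nq0 br_pos; split => //.
    by rewrite -/(bt n) in h *; rewrite h; move: hn; lra.
  exists m; rewrite -/(bt m) -/(br m) th_le in hb.
  set t := dense_point n in hn hb; have g0 := gg_pos m; have r0 := br_pos m.
  (* The dense point is only known to lie in a closed ball; shrinking its chart coordinate by the
     factor [1 - mu] puts it into the open ball and moves it by at most [e / 4]. *)
  pose mu := Num.min (1 / 2) (gg m * e / (8 * br m)).
  have mu0 : 0 < mu by rewrite lt_min !divr_gt0 ?mulr_gt0.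
  have mu1 : mu <= 1 / 2 by rewrite ge_min lexx.
  have mu2 : mu * br m <= gg m * e / 8.
    have : mu <= gg m * e / (8 * br m) by rewrite ge_min lexx orbT.
    rewrite ler_pdivlMr ?mulr_gt0 // => h; move: h; lra.
  exists (thi m (rc (1 - mu) * th m t)); split.
    rewrite th_lt thiK cabsM cabs_rc ger0_norm; last by lra.
    have := cabs_ge0 (th m t); move: hb r0 mu0 mu1; nra.
  apply: le_lt_trans (cabs_tri _ _ t) _.
  have := thi_lip m (rc (1 - mu) * th m t) (th m t); rewrite thK.
  have -> : rc (1 - mu) * th m t - th m t = rc (- mu) * th m t.
    by rewrite rcD !rcN rc1; ring.
  rewrite cabsM cabs_rc normrN ger0_norm; last exact: ltW.
  move=> h; have h2 : 2 / gg m * (mu * cabs (th m t)) <= e / 4.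
    apply: (@le_trans _ _ (2 / gg m * (gg m * e / 8))); last first.
      by rewrite le_eqVlt; apply/orP; left; apply/eqP; field; rewrite gt_eqF.
    rewrite ler_wpM2l ?divr_ge0 ?(ltW g0) //; apply: le_trans mu2.
    by rewrite ler_wpM2l // ltW.
  by move: h h2 hn; lra.
Qed.

End ball_selection.

(** * Projective space *)

Section proj3_topology.
Context {K : numFieldType}.
Local Notation V := ('rV[K]_4).
Local Notation P := (proj3 K).
Implicit Types (u v : V) (p q : P) (c : K).

(** The quotient map as a total function on vectors; the zero vector receives an arbitrary class. *)
Definition mk v : P :=
  match pselect (v \in [set v : V | v != 0]) with
  | left h => \pi_(proj3 K)%qT (SigSub h : nonzero_vector K)
  | right _ => \pi_(proj3 K)%qT (SigSub (affine_vector_neq0 ord0 0) : nonzero_vector K)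
  end.

Lemma homog_neq0 p : homog p != 0.
Proof. exact: (set_mem (valP (repr p))). Qed.

Lemma mk_pi v (h : v \in [set v : V | v != 0]) :
  mk v = \pi_(proj3 K)%qT (SigSub h : nonzero_vector K).
Proof.
by rewrite /mk; case: pselect => // h'; congr (\pi_(proj3 K)%qT _); exact: val_inj.
Qed.

Lemma mk_homog p : mk (homog p) = p.
Proof.
have h : homog p \in [set v : V | v != 0] by apply/mem_set; exact: homog_neq0.
rewrite (mk_pi h) -[RHS]reprK; congr (\pi_(proj3 K)%qT _); exact: val_inj.
Qed.

Lemma mk_eq u v : u != 0 -> v != 0 ->
  mk u = mk v <-> exists2 c, c != 0 & v = c *: u.
Proof.
move=> u0 v0.
have hu : u \in [set v : V | v != 0] by apply/mem_set.
have hv : v \in [set v : V | v != 0] by apply/mem_set.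
rewrite (mk_pi hu) (mk_pi hv); split.
  by move=> /eqquotP/asboolP.
by move=> H; apply/eqquotP/asboolP.
Qed.

Lemma mk_scale c v : c != 0 -> v != 0 -> mk (c *: v) = mk v.
Proof.
by move=> c0 v0; apply/esym/mk_eq => //; [rewrite scaler_eq0 negb_or c0|exists c].
Qed.

Lemma homog_mk v : v != 0 -> exists2 c, c != 0 & homog (mk v) = c *: v.
Proof. by move=> v0; apply/mk_eq => //; rewrite ?homog_neq0 // mk_homog. Qed.

Lemma rV_cvg {T : Type} (F : set_system T) {FF : Filter F} n (f : T -> 'rV[K]_n) (l : 'rV[K]_n) :
  (forall i, (fun x => f x 0 i) @ F --> l 0 i) -> f @ F --> l.
Proof.
move=> H A [B hB BA].
have h : \forall x \near F, forall i, B 0 i (f x 0 i).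
  by apply: filter_forall => i; exact: (H i _ (hB 0 i)).
by apply: filterS h => x hx; apply: BA => i j; rewrite (ord1 i).
Qed.

Lemma nbhs_neq0 v : v != 0 -> \forall u \near v, u != 0.
Proof.
move=> v0.
have [i vi] : exists i, v 0 i != 0.
  apply: contrapT => h; case/negP: v0; apply/eqP/rowP => i; rewrite mxE.
  by apply/eqP; apply: contrapT => /negP hi; apply: h; exists i.
have h : (fun u : V => u 0 i) @ nbhs v --> v 0 i by exact: coord_continuous.
have hn : nbhs (v 0 i) [set x : K | x != 0].
  apply/nbhs_ballP; exists `|v 0 i|; rewrite /= ?normr_gt0 // => x.
  rewrite -ball_normE /ball_/= => hx; apply/eqP => e; move: hx.
  by rewrite e subr0 ltxx.
apply: (@filterS _ (nbhs v) _ _ _ _ (h _ hn)) => u /=; apply: contraNN => /eqP ->.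
by rewrite mxE.
Qed.

Lemma mk_continuous v : v != 0 -> {for v, continuous mk}.
Proof.
move=> v0 A hA.
have hv : v \in [set v : V | v != 0] by apply/mem_set.
rewrite (mk_pi hv) in hA.
have := @pi_continuous _ _ (SigSub hv : nonzero_vector K) A hA.
rewrite /= => -[B [[D oD DB] Bv] BA].
have Dv : D v by have : (set_val @^-1` D) (SigSub hv) by rewrite DB.
have nD : nbhs v D by apply: open_nbhs_nbhs.
apply: (@filterS _ (nbhs v) _ _ _ _ (filterI nD (nbhs_neq0 v0))) => u [Du u0].
have hu : u \in [set v : V | v != 0] by apply/mem_set.
rewrite /= (mk_pi hu); apply: BA; rewrite -DB; exact: Du.
Qed.

(** The quotient map is open because the saturation of an open set is a union of its images under
    invertible scalars. *)
Lemma mk_nbhs v (A : set V) : v != 0 -> nbhs v A ->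
  nbhs (mk v) [set mk u | u in A `&` [set u | u != 0]].
Proof.
move=> v0 vA.
pose B := (A `&` [set u | u != 0])°.
have oB : open B by exact: open_interior.
have Bv : B v by exact: (filterI vA (nbhs_neq0 v0)).
have BA : B `<=` A `&` [set u | u != 0] by exact: interior_subset.
suff h : nbhs (mk v) [set mk u | u in B].
  by apply: (@filterS _ (nbhs (mk v)) _ _ _ _ h) => _ [u /BA ? <-]; exists u.
apply: open_nbhs_nbhs; split; last by exists v.
rewrite /open /= /quotient_open.
pose D : set V := \bigcup_(c in [set c : K | c != 0]) ((fun u => c *: u) @^-1` B).
have oD : open D.
  apply: bigcup_open => c _; move/continuousP: (@scaler_continuous K V c); exact.
exists D => //; apply/seteqP; split => -[u hu] /=.
  move=> [c c0 Bcu]; exists (c *: u) => //.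
  have u0 : u != 0 by exact: set_mem hu.
  by rewrite mk_scale // (mk_pi hu).
move=> [w Bw].
have u0 : u != 0 by exact: set_mem hu.
have [_ w0] := BA _ Bw.
rewrite -(mk_pi hu) => /esym/mk_eq => /(_ u0 w0)[c c0 E].
by exists c => //=; rewrite -E.
Qed.

Lemma cont_proj3 {T : topologicalType} (f : P -> T) v : v != 0 ->
  {for v, continuous (f \o mk)} -> {for mk v, continuous f}.
Proof.
move=> v0 h A fA.
have := h A fA; move=> /(mk_nbhs v0).
by apply: (@filterS _ (nbhs (mk v))) => _ [u [Au _] <-].
Qed.

Lemma act_neq0 (M : 'M[K]_4) v : M \in unitmx -> v != 0 -> v *m M != 0.
Proof.
move=> hM; apply: contra_neq => h.
by rewrite -(mulmxK hM v) h mul0mx.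
Qed.

Definition mact (M : 'M[K]_4) p : P := mk (homog p *m M).

Lemma mact_mk M v : M \in unitmx -> v != 0 -> mact M (mk v) = mk (v *m M).
Proof.
move=> hM v0; rewrite /mact; have [c c0 ->] := homog_mk v0.
by rewrite -scalemxAl mk_scale // act_neq0.
Qed.

Lemma mactM M N p : M \in unitmx -> N \in unitmx ->
  mact N (mact M p) = mact (M *m N) p.
Proof.
move=> hM hN; rewrite -[p]mk_homog.
by rewrite !mact_mk ?mulmxA ?act_neq0 ?homog_neq0 // unitmx_mul hM.
Qed.

Lemma mact1 p : mact 1%:M p = p.
Proof. by rewrite /mact mulmx1 mk_homog. Qed.

Lemma mactZ c M p : c != 0 -> M \in unitmx -> mact (c *: M) p = mact M p.
Proof.
by move=> c0 hM; rewrite /mact -scalemxAr mk_scale // act_neq0 // homog_neq0.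
Qed.

Lemma cvg_bigsum {T I : Type} (F : set_system T) {FF : Filter F} (r : seq I)
    (f : I -> T -> K) (l : I -> K) :
  (forall i, f i @ F --> l i) ->
  (fun x => \sum_(i <- r) f i x) @ F --> \sum_(i <- r) l i.
Proof.
move=> H; elim: r => [|i r IH].
  rewrite big_nil (_ : (fun _ => _) = cst 0); first exact: cvg_cst.
  by apply/funext => x; rewrite big_nil.
rewrite big_cons (_ : (fun _ => _) = (fun x => f i x + \sum_(j <- r) f j x)).
  exact: (cvgD (H i) IH).
by apply/funext => x; rewrite big_cons.
Qed.

Lemma mulmxr_coord_cvg (M : 'M[K]_4) v : {for v, continuous (fun u : V => u *m M)}.
Proof.
apply: (@rV_cvg _ (nbhs v)) => i.
have -> : (fun u : V => (u *m M) 0 i) = (fun u : V => \sum_j u 0 j * M j i).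
  by apply/funext => u; rewrite mxE.
rewrite mxE; apply: (@cvg_bigsum _ _ (nbhs v)) => j.
apply: (@cvgM _ _ (nbhs v)); last exact: cvg_cst.
exact: coord_continuous.
Qed.

Lemma mact_continuous M : M \in unitmx -> continuous (mact M).
Proof.
move=> hM p; rewrite -[p]mk_homog; have p0 := homog_neq0 p.
apply: (cont_proj3 p0).
have h : {for homog p, continuous (mk \o (fun u : V => u *m M))}.
  apply: (cvg_comp _ _ (@mulmxr_coord_cvg M (homog p))).
  by apply: mk_continuous; exact: act_neq0.
move=> A hA; rewrite /= mact_mk // in hA.
have hA' : nbhs (homog p) ((mk \o (fun u : V => u *m M)) @^-1` A) by exact: (h A hA).
apply: (@filterS _ (nbhs (homog p)) _ _ _ _ (filterI hA' (nbhs_neq0 p0))) => u [Au u0].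
by rewrite /= mact_mk.
Qed.

Lemma differentiable_rV n m (f : 'rV[K]_n -> 'rV[K]_m) (w : 'rV[K]_n) :
  (forall i, differentiable (fun x => f x 0 i) w) -> differentiable f w.
Proof.
move=> H.
have -> : f = \sum_(i < m) (fun x => f x 0 i *: (delta_mx 0 i : 'rV[K]_m)).
  apply/funext => x; rewrite fct_sumE [LHS]row_sum_delta; apply: eq_bigr => i _.
  by [].
by apply: differentiable_sum => i; apply: differentiableZl; exact: H.
Qed.

Lemma affine_coord_mk j v k : v != 0 ->
  affine_coord j (mk v) 0 k = v 0 (lift j k) / v 0 j.
Proof.
move=> v0; rewrite mxE; have [c c0 ->] := homog_mk v0; rewrite !mxE.
by rewrite -mulf_div divff // mul1r.
Qed.

Lemma affine_domain_mk j v : v != 0 -> affine_domain j (mk v) = (v 0 j != 0).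
Proof.
move=> v0; rewrite /affine_domain /=; have [c c0 ->] := homog_mk v0.
by rewrite mxE mulf_eq0 negb_or c0.
Qed.

Lemma affine_param_mk j w : affine_param j w = mk (affine_vector j w).
Proof. by rewrite (mk_pi (affine_vector_neq0 j w)). Qed.

Lemma affine_vector_nz j w : affine_vector (K := K) j w != 0.
Proof. exact: set_mem (affine_vector_neq0 j w). Qed.

Lemma mact_holomorphic M : M \in unitmx -> holomorphic (mact M).
Proof.
move=> hM; split; first exact: mact_continuous.
move=> i j w; rewrite affine_param_mk mact_mk ?affine_vector_nz //.
have nz w' : affine_vector i w' *m M != 0 by apply: act_neq0; rewrite ?affine_vector_nz.
rewrite affine_domain_mk // => nj.
have dl l : differentiable (fun w' => (affine_vector i w' *m M) 0 l) w.
  have -> : (fun w' => (affine_vector i w' *m M) 0 l) =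
    \sum_(m < 4) (fun w' => affine_vector i w' 0 m * M m l).
    by apply/funext => w'; rewrite fct_sumE mxE.
  apply: differentiable_sum => m.
  apply: (@differentiableM K _ (fun w' => affine_vector i w' 0 m) (fun _ => M m l)).
    case E : (unlift i m) => [k|].
      rewrite (_ : (fun _ => _) = (fun w' : 'rV[K]_3 => w' 0 k)); last first.
        by apply/funext => w'; rewrite mxE E.
      exact: differentiable_coord.
    rewrite (_ : (fun _ => _) = cst 1); last by apply/funext => w'; rewrite mxE E.
    exact: differentiable_cst.
  exact: differentiable_cst.
apply: differentiable_rV => k.
have -> : (fun x => (affine_coord j \o mact M \o affine_param i) x 0 k) =
  (fun x => (affine_vector i x *m M) 0 (lift j k)) *
  (fun x => ((affine_vector i x *m M) 0 j)^-1).
  apply/funext => x; rewrite /= affine_param_mk mact_mk ?affine_vector_nz //.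
  by rewrite affine_coord_mk.
apply: differentiableM; first exact: dl.
by apply: differentiableV => //; exact: dl.
Qed.

Lemma mact_aut M : M \in unitmx -> Aut_hol K (mact M).
Proof.
move=> hM; split; first exact: mact_holomorphic.
have hM' : invmx M \in unitmx by rewrite unitmx_inv.
exists (mact (invmx M)); split; first exact: mact_holomorphic.
  by move=> p; rewrite mactM // mulmxV // mact1.
by move=> p; rewrite mactM // mulVmx // mact1.
Qed.

End proj3_topology.

(** * The twistor fibration *)

Section twistor.
Context {R : realType}.
Local Notation C := (Cx R).
Local Notation Q := (C * C)%type.
Local Notation V := 'rV[C]_4.
Local Notation P := (proj3 C).
Implicit Types (c q p u v : Q) (r a : R) (z : C).

(** The pair [(a, b)] stands for the quaternion [a + j b]. Complex scalars then act by
    multiplication on the right, and left multiplication by a quaternion is complex linear. *)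
Definition qmul p q : Q := (p.1 * q.1 - cj p.2 * q.2, p.2 * q.1 + cj p.1 * q.2).
Definition qbar q : Q := (cj q.1, - q.2).

Lemma qeq p q : p.1 = q.1 -> p.2 = q.2 -> p = q.
Proof. by case: p q => ? ? [? ?] /= -> ->. Qed.

Lemma qmulA p q u : qmul p (qmul q u) = qmul (qmul p q) u.
Proof. by apply: qeq; rewrite /= !(cjD, cjM, cjN, cjK); ring. Qed.
Lemma qmulDl p q u : qmul (p + q) u = qmul p u + qmul q u.
Proof. by apply: qeq; rewrite /= !cjD; ring. Qed.
Lemma qmulNl p u : qmul (- p) u = - qmul p u.
Proof. by apply: qeq; rewrite /= !cjN; ring. Qed.
Lemma qmulBl p q u : qmul (p - q) u = qmul p u - qmul q u.
Proof. by rewrite qmulDl qmulNl. Qed.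
Lemma qmulZl a p u : qmul (rc a *: p) u = rc a *: qmul p u.
Proof. by apply: qeq; rewrite /= !cjM !cj_rc /GRing.scale /=; ring. Qed.
Lemma qmulZr z p u : qmul p (z *: u) = z *: qmul p u.
Proof. by apply: qeq; rewrite /= /GRing.scale /=; ring. Qed.
Lemma qbarK q : qbar (qbar q) = q.
Proof. by apply: qeq; rewrite /= ?cjK ?opprK. Qed.
Lemma qbarD p q : qbar (p + q) = qbar p + qbar q.
Proof. by apply: qeq; rewrite /= ?cjD ?opprD. Qed.
Lemma qbarN q : qbar (- q) = - qbar q.
Proof. by apply: qeq; rewrite /= ?cjN. Qed.
Lemma qbarZ a q : qbar (rc a *: q) = rc a *: qbar q.
Proof. by apply: qeq; rewrite /= ?cjM ?cj_rc ?mulrN /GRing.scale //= mulrN. Qed.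
Lemma nq_qbar q : nq (qbar q) = nq q.
Proof. by rewrite /nq /= cabs_cj cabsN. Qed.
Lemma qmul_bar q u : qmul (qbar q) (qmul q u) = rc (nq q ^+ 2) *: u.
Proof.
have -> : rc (nq q ^+ 2) = q.1 * cj q.1 + q.2 * cj q.2.
  by rewrite sqr_nq rcD -!mul_cj.
by apply: qeq; rewrite /= !(cjK, cjN) /GRing.scale /=; ring.
Qed.
Lemma qmul_barr q u : qmul q (qmul (qbar q) u) = rc (nq q ^+ 2) *: u.
Proof. by rewrite -{1}(qbarK q) qmul_bar nq_qbar. Qed.
Lemma nq_qmul p q : nq (qmul p q) = nq p * nq q.
Proof.
apply/eqP; rewrite -(@eqrXn2 _ 2) ?mulr_ge0 ?nq_ge0 // exprMn; apply/eqP.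
by rewrite !sqr_nq !sqr_cabs /= !cxE; ring.
Qed.
Lemma qmul0 p : qmul p 0 = 0.
Proof. by apply/eqP; rewrite -nq_eq0 nq_qmul nq0 mulr0. Qed.
Lemma qmul0l p : qmul 0 p = 0.
Proof. by apply/eqP; rewrite -nq_eq0 nq_qmul nq0 mul0r. Qed.
Lemma cj0 : cj 0 = 0 :> C. Proof. by rewrite -rc0 cj_rc. Qed.
Lemma cj1 : cj 1 = 1 :> C. Proof. by rewrite -rc1 cj_rc. Qed.
Lemma qmul1l u : qmul (1, 0) u = u.
Proof.
have h0 : cj ((1, 0) : Q).2 = 0 by exact: cj0.
have h1 : cj ((1, 0) : Q).1 = 1 by exact: cj1.
by apply: qeq; rewrite /qmul h0 h1 /=; ring.
Qed.
Lemma qmul1r u : qmul u (1, 0) = u.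
Proof. by apply: qeq; rewrite /=; ring. Qed.
Lemma scale1q q : rc 1 *: q = q. Proof. by rewrite rc1 scale1r. Qed.
Lemma qmul_eq0 p u : (qmul p u == 0) = (p == 0) || (u == 0).
Proof. by rewrite -!nq_eq0 nq_qmul mulf_eq0. Qed.

Definition qinv q : Q := rc (nq q ^- 2) *: qbar q.
Lemma qmulV q u : q != 0 -> qmul q (qmul (qinv q) u) = u.
Proof.
move=> q0; rewrite qmulZl qmulZr qmul_barr rcZA mulVf ?scale1q //.
by rewrite sqrf_eq0 nq_eq0.
Qed.
Lemma qmulVK q u : q != 0 -> qmul (qinv q) (qmul q u) = u.
Proof.
move=> q0; rewrite qmulZl qmul_bar rcZA mulVf ?scale1q //.
by rewrite sqrf_eq0 nq_eq0.
Qed.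

Lemma qmulI u p q : u != 0 -> qmul p u = qmul q u -> p = q.
Proof.
move=> u0 e; apply/eqP; rewrite -subr_eq0.
have : qmul (p - q) u == 0 by rewrite qmulBl e subrr.
by rewrite qmul_eq0 (negbTE u0) orbF.
Qed.

Local Notation o0 := (@Ordinal 4 0 isT).
Local Notation o1 := (@Ordinal 4 1 isT).
Local Notation o2 := (@Ordinal 4 2 isT).
Local Notation o3 := (@Ordinal 4 3 isT).

Definition row4 u v : V := \row_i nth 0 [:: u.1; u.2; v.1; v.2] i.
Definition hd (w : V) : Q := (w 0 o0, w 0 o1).
Definition tl (w : V) : Q := (w 0 o2, w 0 o3).

Lemma hd_row4 u v : hd (row4 u v) = u.
Proof. by case: u => a b; rewrite /hd !mxE. Qed.
Lemma tl_row4 u v : tl (row4 u v) = v.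
Proof. by case: v => a b; rewrite /tl !mxE. Qed.
Lemma row4_hdtl (w : V) : row4 (hd w) (tl w) = w.
Proof.
apply/rowP => -[[|[|[|[|//]]]] h]; rewrite mxE /=; congr (w 0 _); exact: val_inj.
Qed.
Lemma hdZ z (w : V) : hd (z *: w) = z *: hd w.
Proof. by rewrite /hd !mxE. Qed.
Lemma tlZ z (w : V) : tl (z *: w) = z *: tl w.
Proof. by rewrite /tl !mxE. Qed.
Lemma row4Z z u v : row4 (z *: u) (z *: v) = z *: row4 u v.
Proof. by rewrite -[RHS]row4_hdtl hdZ tlZ hd_row4 tl_row4. Qed.
Lemma row4_eq0 u v : (row4 u v == 0) = (u == 0) && (v == 0).
Proof.
apply/eqP/andP => [e|[/eqP -> /eqP ->]].
  rewrite -(hd_row4 u v) -{2}(tl_row4 u v) e /hd /tl !mxE.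
  by split; apply/eqP.
by apply/rowP => -[[|[|[|[|//]]]] h]; rewrite !mxE.
Qed.

(** The twistor fibration in the affine coordinate of the quaternionic line: the right line through
    [(u, v)] has slope [v u^-1]. On the fibre over infinity, where [finpt] fails, the value is [0]
    by the convention on inverses. *)
Definition tw (p : P) : Q := qmul (tl (homog p)) (qinv (hd (homog p))).
Definition finpt (p : P) : bool := hd (homog p) != 0.
Definition pt q u : P := mk (row4 u (qmul q u)).

Lemma qmul_unit u v : u != 0 -> qmul (qmul v (qinv u)) u = v.
Proof.
move=> u0; apply: (@qmulI (qinv u)).
  rewrite /qinv -nq_eq0 nqZ nq_qbar mulf_neq0 ?normr_eq0 ?nq_eq0 //.
  by rewrite invr_eq0 sqrf_eq0 nq_eq0.
by rewrite -!qmulA qmulVK.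
Qed.

Lemma row4_neq0 u v : u != 0 -> row4 u v != 0.
Proof. by rewrite row4_eq0 negb_and => ->. Qed.

Lemma scalez_eq0 z u : z != 0 -> (z *: u == 0) = (u == 0).
Proof.
move=> z0; apply/eqP/eqP => [|->]; last by rewrite scaler0.
by move=> e; rewrite -[u]scale1r -(mulVf z0) -scalerA e scaler0.
Qed.

Lemma finpt_mk u v : row4 u v != 0 -> finpt (mk (row4 u v)) = (u != 0).
Proof.
move=> w0; rewrite /finpt; have [c c0 ->] := homog_mk w0.
by rewrite hdZ hd_row4 scalez_eq0.
Qed.

Lemma tw_mk u v q : u != 0 -> v = qmul q u -> tw (mk (row4 u v)) = q.
Proof.
move=> u0 e; rewrite /tw.
have [c c0 ->] := homog_mk (row4_neq0 v u0).
rewrite hdZ tlZ hd_row4 tl_row4.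
have cu : c *: u != 0 by rewrite scalez_eq0.
by apply: (qmulI cu); rewrite qmul_unit // e qmulZr.
Qed.

Lemma tw_pt q u : u != 0 -> tw (pt q u) = q.
Proof. by move=> u0; apply: tw_mk. Qed.
Lemma finpt_pt q u : u != 0 -> finpt (pt q u).
Proof. by move=> u0; rewrite finpt_mk // row4_neq0. Qed.

Lemma pt_tw (p : P) : finpt p -> p = pt (tw p) (hd (homog p)).
Proof.
move=> pf; rewrite /pt /tw qmul_unit // row4_hdtl mk_homog.
by [].
Qed.

Lemma ptZ z q u : z != 0 -> u != 0 -> pt q (z *: u) = pt q u.
Proof.
by move=> z0 u0; rewrite /pt qmulZr row4Z mk_scale // row4_neq0.
Qed.

Definition Aseq c a : seq (seq C) :=
  [:: [:: - cj c.1; c.2; rc a; 0];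
      [:: - cj c.2; - c.1; 0; rc a];
      [:: 1; 0; c.1; c.2];
      [:: 0; 1; - cj c.2; cj c.1] ].

(* The lift of [q |-> c + r^2 (q - qbar c)^-1] *)
Definition Amx c r : 'M[C]_4 :=
  \matrix_(i, j) nth 0 (nth [::] (Aseq c (r ^+ 2 - nq c ^+ 2)) i) j.

Lemma row4_A c r u v : row4 u v *m Amx c r =
  row4 (v - qmul (qbar c) u) (qmul c (v - qmul (qbar c) u) + rc (r ^+ 2) *: u).
Proof.
have -> : qmul c (v - qmul (qbar c) u) + rc (r ^+ 2) *: u =
    qmul c v + rc (r ^+ 2 - nq c ^+ 2) *: u.
  have -> : qmul c (v - qmul (qbar c) u) = qmul c v - qmul c (qmul (qbar c) u).
    by apply: qeq; rewrite /=; ring.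
  by rewrite qmul_barr rcD rcN scalerDl scaleNr -addrA [- _ + _]addrC.
apply/rowP => j; rewrite mxE !big_ord_recl big_ord0 !mxE /=.
case: j => [[|[|[|[|//]]]] h] /=; rewrite ?(cjK, cjN) /GRing.scale /=; ring.
Qed.

Lemma A_bar c r : Amx c r *m Amx (qbar c) r = (rc (r ^+ 2))%:M.
Proof.
suff H u v : row4 u v *m (Amx c r *m Amx (qbar c) r) = rc (r ^+ 2) *: row4 u v.
  apply/row_matrixP => i.
  rewrite -[Amx c r *m _]mul1mx row_mul -(row4_hdtl (row i 1%:M)) H row4_hdtl.
  by rewrite -[(rc _)%:M]scalemx1 linearZ.
rewrite mulmxA !row4_A qbarK; set w := v - qmul (qbar c) u.
have e1 : qmul c w + rc (r ^+ 2) *: u - qmul c w = rc (r ^+ 2) *: u.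
  by rewrite addrAC subrr add0r.
rewrite e1 qmulZr -row4Z; congr row4; rewrite /w scalerBr addrCA subrr addr0.
by [].
Qed.

Lemma A_unit c r : r != 0 -> Amx c r \in unitmx.
Proof.
move=> r0; have : Amx c r *m Amx (qbar c) r \in unitmx.
  rewrite A_bar -scalemx1 unitmxZ ?unitmx1 // unitfE rc_eq0.
  by rewrite expf_neq0.
by rewrite unitmx_mul => /andP[].
Qed.

(** The inverse of a quaternion is its conjugate divided by the squared norm, so the fractional
    linear map of [Amx] is the inversion preceded by conjugation. *)
Lemma mact_A c r (p : P) : r != 0 -> finpt p -> tw p != qbar c ->
  finpt (mact (Amx c r) p) /\
  tw (mact (Amx c r) p) = inversion c r (qbar (tw p)).
Proof.
move=> r0 pf pc; rewrite (pt_tw pf); set u := hd _; set q := tw p in pc *.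
have u0 : u != 0 by [].
rewrite tw_pt // /pt mact_mk ?A_unit ?row4_neq0 // row4_A -qmulBl.
have qc0 : q - qbar c != 0 by rewrite subr_eq0.
have u'0 : qmul (q - qbar c) u != 0 by rewrite qmul_eq0 negb_or qc0.
split; first by rewrite finpt_mk // row4_neq0.
apply: tw_mk => //; rewrite /inversion (qmulDl c).
have -> : qbar q - c = qbar (q - qbar c) by rewrite qbarD qbarN qbarK.
rewrite nq_qbar qmulZl qmul_bar rcZA divfK //.
by rewrite sqrf_eq0 nq_eq0.
Qed.

Lemma inversion_qbar c r q : qbar (inversion c r q) = inversion (qbar c) r (qbar q).
Proof.
rewrite /inversion qbarD qbarZ; have -> : qbar q - qbar c = qbar (q - c).
  by rewrite qbarD qbarN.
by rewrite nq_qbar.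
Qed.

Lemma hd_cont (w : V) : {for w, continuous hd}.
Proof.
apply: (@cvgQ_pair _ _ (nbhs w) _ (fun x : V => x 0 o0) (fun x : V => x 0 o1));
 exact: coord_continuous.
Qed.
Lemma tl_cont (w : V) : {for w, continuous tl}.
Proof.
apply: (@cvgQ_pair _ _ (nbhs w) _ (fun x : V => x 0 o2) (fun x : V => x 0 o3));
 exact: coord_continuous.
Qed.

Lemma cvgQ_mul {T : Type} (F : set_system T) {FF : Filter F} (f g : T -> Q) p q :
  f @ F --> p -> g @ F --> q -> (fun x => qmul (f x) (g x)) @ F --> qmul p q.
Proof.
move=> fp gq.
have f1 : (fun x => (f x).1) @ F --> p.1 by apply: cvgQ_fst.
have f2 : (fun x => (f x).2) @ F --> p.2 by apply: cvgQ_snd.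
have g1 : (fun x => (g x).1) @ F --> q.1 by apply: cvgQ_fst.
have g2 : (fun x => (g x).2) @ F --> q.2 by apply: cvgQ_snd.
have f1' : (fun x => cj (f x).1) @ F --> cj p.1.
  exact: (cvg_comp _ _ f1 (@continuous_cj R p.1)).
have f2' : (fun x => cj (f x).2) @ F --> cj p.2.
  exact: (cvg_comp _ _ f2 (@continuous_cj R p.2)).
apply: cvgQ_pair.
  exact: (cvgB (cvgM f1 g1) (cvgM f2' g2)).
exact: (cvgD (cvgM f2 g1) (cvgM f1' g2)).
Qed.

Lemma cvgQ_bar {T : Type} (F : set_system T) {FF : Filter F} (f : T -> Q) p :
  f @ F --> p -> (fun x => qbar (f x)) @ F --> qbar p.
Proof.
move=> fp.
have f1 : (fun x => (f x).1) @ F --> p.1 by apply: cvgQ_fst.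
have f2 : (fun x => (f x).2) @ F --> p.2 by apply: cvgQ_snd.
have f1' : (fun x => cj (f x).1) @ F --> cj p.1.
  exact: (cvg_comp _ _ f1 (@continuous_cj R p.1)).
by apply: cvgQ_pair; [exact: f1'|exact: (cvgN f2)].
Qed.

Lemma cvgQ_inv {T : Type} (F : set_system T) {FF : Filter F} (f : T -> Q) p :
  p != 0 -> f @ F --> p -> (fun x => qinv (f x)) @ F --> qinv p.
Proof.
move=> p0 fp.
have n : (fun x => nq (f x)) @ F --> nq p.
  exact: (cvg_comp _ _ fp (@cont_nq R p)).
have n2 : (fun x => nq (f x) ^- 2) @ F --> nq p ^- 2.
  apply: cvgV; first by rewrite sqrf_eq0 nq_eq0.
  exact: (cvg_comp _ _ n (@exprn_continuous R 2 (nq p))).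
have b : (fun x => qbar (f x)) @ F --> qbar p by exact: cvgQ_bar.
exact: cvg_scaleQ n2 b.
Qed.

Lemma cvg_row4 {T : Type} (F : set_system T) {FF : Filter F} (f g : T -> Q) u v :
  f @ F --> u -> g @ F --> v -> (fun x => row4 (f x) (g x)) @ F --> row4 u v.
Proof.
move=> fu gv; apply: rV_cvg => -[[|[|[|[|//]]]] h]; rewrite mxE /=.
- rewrite (_ : (fun _ => _) = (fun x => (f x).1)); first by apply: cvgQ_fst.
  by apply/funext => x; rewrite mxE.
- rewrite (_ : (fun _ => _) = (fun x => (f x).2)); first by apply: cvgQ_snd.
  by apply/funext => x; rewrite mxE.
- rewrite (_ : (fun _ => _) = (fun x => (g x).1)); first by apply: cvgQ_fst.
  by apply/funext => x; rewrite mxE.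
rewrite (_ : (fun _ => _) = (fun x => (g x).2)); first by apply: cvgQ_snd.
by apply/funext => x; rewrite mxE.
Qed.

Lemma near_finpt (p : P) : finpt p -> \forall x \near p, finpt x.
Proof.
move=> pf; rewrite -[p]mk_homog; have p0 := homog_neq0 p.
have c : hd @ nbhs (homog p) --> hd (homog p) by exact: hd_cont.
have h : nbhs (hd (homog p)) [set x | x != 0].
  have n0 : 0 < nq (hd (homog p)) by rewrite nq_gt0.
  apply/nbhsQ; exists (nq (hd (homog p))) => // x; rewrite nqB => hx.
  by apply/eqP => e; move: hx; rewrite e subr0 ltxx.
have := mk_nbhs p0 (c _ h).
move=> nb; move: nb; apply: (@filterS _ (nbhs (mk (homog p)))) => _ [w [/= hw w0] <-].
have : row4 (hd w) (tl w) != 0 by rewrite row4_hdtl.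
by move=> /finpt_mk; rewrite row4_hdtl => ->.
Qed.

Lemma tw_cont (p : P) : finpt p -> {for p, continuous tw}.
Proof.
move=> pf; rewrite -[p]mk_homog; have p0 := homog_neq0 p.
apply: (cont_proj3 p0).
have h1 : hd @ nbhs (homog p) --> hd (homog p) by exact: hd_cont.
have h2 : tl @ nbhs (homog p) --> tl (homog p) by exact: tl_cont.
have h3 : (fun w => qinv (hd w)) @ nbhs (homog p) --> qinv (hd (homog p)).
  exact: (@cvgQ_inv _ (nbhs (homog p)) _ _ _ pf h1).
have h4 : (fun w => qmul (tl w) (qinv (hd w))) @ nbhs (homog p) --> tw p.
  exact: (@cvgQ_mul _ (nbhs (homog p)) _ _ _ _ _ h2 h3).
move=> A; rewrite /= mk_homog => hA.
have h5 : nbhs (hd (homog p)) [set x | x != 0].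
  have n0 : 0 < nq (hd (homog p)) by rewrite nq_gt0.
  apply/nbhsQ; exists (nq (hd (homog p))) => // x; rewrite nqB => hx.
  by apply/eqP => e; move: hx; rewrite e subr0 ltxx.
have h6 : nbhs (homog p) [set w | hd w != 0] by exact: (h1 _ h5).
have h7 : nbhs (homog p) [set w | A (qmul (tl w) (qinv (hd w)))] by exact: (h4 _ hA).
apply: (@filterS _ (nbhs (homog p)) _ _ _ _ (filterI h7 h6)) => w [/= Aw w0].
have -> : tw (mk w) = qmul (tl w) (qinv (hd w)); last exact: Aw.
have e := @tw_mk (hd w) (tl w) _ w0 (esym (qmul_unit (tl w) w0)).
by rewrite row4_hdtl in e.
Qed.

Lemma cvg_pt {T : Type} (F : set_system T) {FF : Filter F} (f g : T -> Q) q u :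
  u != 0 -> f @ F --> q -> g @ F --> u -> (fun x => pt (f x) (g x)) @ F --> pt q u.
Proof.
move=> u0 fq gu.
have h : (fun x => row4 (g x) (qmul (f x) (g x))) @ F --> row4 u (qmul q u).
  have fg : (fun x => qmul (f x) (g x)) @ F --> qmul q u by exact: cvgQ_mul.
  exact: cvg_row4 gu fg.
exact: (cvg_comp _ _ h (mk_continuous (row4_neq0 _ u0))).
Qed.

End twistor.

(** * The lifted group *)

Section group_facts.
Context {X : topologicalType} (Gam : set (X -> X)).
Hypothesis gG : transformation_group Gam.
Hypothesis cG : forall g, Gam g -> continuous g.

Lemma group_region h x : Gam h -> region_of_discontinuity Gam x ->
  region_of_discontinuity Gam (h x).
Proof.
have [G1 GM GV] := gG.
move=> hh [U xU fU].
have [h' [hh' hK h'K]] := GV h hh.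
exists (h' @^-1` U).
  have c := cG hh' (x := h x).
  by apply: c; rewrite hK.
pose phi (g : X -> X) := h' \o g \o h.
apply: (@sub_finite_set _ _ ((fun g => h \o g \o h') @`
    [set g | Gam g /\ U `&` (g @` U) !=set0])); last exact: finite_image.
move=> g [gg [y [Uy [z Uz gzy]]]].
exists (phi g); last by apply/funext => v; rewrite /phi /= !h'K.
split; first by apply: (GM) => //; apply: (GM).
by exists (h' y); split => //; exists (h' z) => //; rewrite /phi /= h'K gzy.
Qed.

Lemma open_region : open (region_of_discontinuity Gam).
Proof.
rewrite openE => x [U xU fU].
have := nbhs_interior xU.
apply: (@filterS _ (nbhs x)) => y Uy; exists U => //.
Qed.

End group_facts.

Section twistor_group.
Context {R : realType} (S : ball_system R).
Local Notation C := (Cx R).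
Local Notation Q := (C * C)%type.
Local Notation P := (proj3 C).
Local Notation r := (br S).
Local Notation c := (bc S).
Local Notation rad := (rad S).
Local Notation refl := (refl S).
Local Notation f := (limap S).
Local Notation lam := (lam S).
Local Notation fund := (fund S).
Local Notation wact := (wact S).
Implicit Types (i j : nat) (p : P) (x q u : Q) (X : P * bool) (w a b : seq nat).

(* The inversions reverse the orientation and do not lift to [P^3]; the lift
   of a word is followed through the conjugate copy of the quaternions, the
   boolean recording in which copy the point lies. *)
Definition flift i X : P * bool :=
  (mact (Amx (if X.2 then c i else qbar (c i)) (r i)) X.1, ~~ X.2).
Definition ftw X : Q := if X.2 then qbar (tw X.1) else tw X.1.

Lemma r_neq0 i : r i != 0. Proof. by rewrite gt_eqF // br_gt0. Qed.

Lemma fliftK i : involutive (flift i).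
Proof.
move=> [p b]; rewrite /flift /= negbK mactM ?A_unit ?r_neq0 //; congr pair.
have E d : mact (Amx d (r i) *m Amx (qbar d) (r i)) p = p.
  rewrite A_bar -scalemx1 mactZ ?mact1 ?unitmx1 //.
  by rewrite rc_eq0 expf_neq0 // r_neq0.
case: b => /=; first exact: E.
by have := E (qbar (c i)); rewrite qbarK.
Qed.

Lemma flift_tw i X : finpt X.1 -> ftw X != c i ->
  finpt (flift i X).1 /\ ftw (flift i X) = refl i (ftw X).
Proof.
case: X => p [] /= pf pc.
  have hc : tw p != qbar (c i).
    by apply: contra_neq pc => e; rewrite /ftw /= e qbarK.
  have [h1 h2] := mact_A (r_neq0 i) pf hc.
  by split; rewrite // /ftw /= h2.
have hc : tw p != qbar (qbar (c i)) by rewrite qbarK.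
have [h1 h2] := mact_A (r_neq0 i) pf hc.
by split; rewrite // /ftw /= h2 inversion_qbar !qbarK.
Qed.

Definition wlift w p : P := (foldr flift (p, false) w).1.

Lemma foldr_flag w X : (foldr flift X w).2 = X.2 (+) odd (size w).
Proof. by elim: w => [|i w /= ->] /=; rewrite ?addbF // addbN. Qed.

Lemma wlift_pair w p : ~~ odd (size w) -> foldr flift (p, false) w = (wlift w p, false).
Proof.
move=> ew; rewrite [LHS]surjective_pairing foldr_flag /=.
by rewrite (negbTE ew).
Qed.

Lemma wlift_cat a b p : ~~ odd (size b) -> wlift (a ++ b) p = wlift a (wlift b p).
Proof. by move=> eb; rewrite /wlift foldr_cat wlift_pair. Qed.

Lemma wlift_rev a p : ~~ odd (size a) -> wlift (rev a) (wlift a p) = p.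
Proof.
move=> ea; rewrite -wlift_cat // /wlift foldr_cat foldr_rev //.
exact: fliftK.
Qed.

Lemma wlift_revr a p : ~~ odd (size a) -> wlift a (wlift (rev a) p) = p.
Proof.
by move=> ea; rewrite -{1}(revK a) wlift_rev // size_rev.
Qed.

Lemma wlift_mx w (b : bool) : exists2 M : 'M[C]_4, M \in unitmx &
  forall p, (foldr flift (p, b) w).1 = mact M p.
Proof.
elim: w => [|i w [M hM H]] /=; first by exists 1%:M; rewrite ?unitmx1 // => p; rewrite mact1.
pose A := Amx (if b (+) odd (size w) then c i else qbar (c i)) (r i).
have hA : A \in unitmx by rewrite A_unit // r_neq0.
exists (M *m A); first by rewrite unitmx_mul hM.
by move=> p; rewrite foldr_flag H mactM.
Qed.

Lemma wlift_aut w : Aut_hol C (wlift w).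
Proof.
have [M hM H] := wlift_mx w false.
by rewrite (_ : wlift w = mact M); [exact: mact_aut|apply/funext].
Qed.

Lemma wlift_continuous w : continuous (wlift w).
Proof. by have [[]] := wlift_aut w. Qed.

Lemma ftw_word w X : finpt X.1 -> ~ lam (ftw X) ->
  finpt (foldr flift X w).1 /\ ftw (foldr flift X w) = wact w (ftw X).
Proof.
move=> Xf Xl; elim: w => [//|i w [h1 h2]] /=.
have nc : ftw (foldr flift X w) != c i.
  apply/eqP => e; apply: Xl; apply/(wact_lam S w); rewrite -h2 e.
  by exists (bt S i) => //; rewrite limap_center.
by have [h3 h4] := flift_tw h1 nc; split => //; rewrite h4 h2.
Qed.

Definition free_pt p : Prop := finpt p /\ ~ lam (tw p).
(** Besides the fibres over [lam] it contains the fibre over infinity, the point that closes up the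
    sphere. *)
Definition lam_lift : set P := [set p | ~ free_pt p].

Lemma wlift_tw w p : ~~ odd (size w) -> free_pt p ->
  finpt (wlift w p) /\ tw (wlift w p) = wact w (tw p).
Proof.
move=> ew [pf pl]; have [] := @ftw_word w (p, false) pf pl.
by rewrite wlift_pair.
Qed.

Lemma wlift_free w p : ~~ odd (size w) -> free_pt p -> free_pt (wlift w p).
Proof.
move=> ew hp; have [h1 h2] := wlift_tw ew hp.
by split => //; rewrite h2 wact_lam; case: hp.
Qed.

Definition Gam : set (P -> P) := [set g | exists2 w, ~~ odd (size w) & g = wlift w].

Lemma Gam_group : transformation_group Gam.
Proof.
split.
- by exists [::].
- move=> _ _ [a ea ->] [b eb ->]; exists (a ++ b); first by rewrite size_cat oddD (negbTE ea).
  by apply/funext => p; rewrite wlift_cat.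
move=> _ [a ea ->]; exists (wlift (rev a)); split; first by exists (rev a); rewrite ?size_rev.
  by move=> p; rewrite wlift_rev.
by move=> p; rewrite wlift_revr.
Qed.

Lemma Gam_continuous g : Gam g -> continuous g.
Proof. by move=> [w _ ->]; exact: wlift_continuous. Qed.

(** The word identities of [wact_discontinuous], read for the involutions [flift], bound the number
    of lifted maps and not just of their traces on [Q]. *)
Lemma Gam_finite (e : R) : 0 < e ->
  finite_set [set g | Gam g /\ exists p, [/\ free_pt p, away S e (tw p) & away S e (tw (g p))]].
Proof.
move=> e0; have [N HN] := wact_discontinuous S e0.
pose W := [set a : seq nat | (size a <= N)%N /\ all (fun i => (i < N)%N) a].
apply: (@sub_finite_set _ _ ((fun ab => wlift (ab.2 ++ rev ab.1)) @` (W `*` W))); last first.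
  by apply: finite_image; apply: finite_setX; exact: finite_words.
move=> _ [[w ew ->] [p [pf h1 h2]]].
have [_ htw] := wlift_tw ew pf; rewrite htw in h2.
have [a [b [ha hb E]]] := HN _ _ h1 h2.
exists (a, b) => //=; apply/funext => q.
by rewrite /wlift (E _ flift fliftK).
Qed.

Lemma away_half (e : R) x y : away S e x -> nq (y - x) <= e / 2 -> away S (e / 2) y.
Proof.
move=> h hy t; have := h t; have := nq_tri x (f t) y; rewrite (nqB x y).
by move: hy; lra.
Qed.

Lemma free_near p : free_pt p -> exists2 e : R, 0 < e &
  \forall p' \near p, free_pt p' /\ away S e (tw p').
Proof.
move=> [pf pl]; have [e e0 he] := lam_away pl.
have e20 : 0 < e / 2 by rewrite divr_gt0.
exists (e / 2) => //.
have h1 := near_finpt pf.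
have ct : tw @ nbhs p --> tw p by exact: tw_cont.
have h2 : \forall p' \near p, nq (tw p' - tw p) < e / 2 by exact: cvgQE ct e20.
apply: (@filterS _ (nbhs p) _ _ _ _ (filterI h1 h2)) => p' [p'f hp'].
have h3 : away S (e / 2) (tw p') by apply: (away_half he); exact: ltW.
split => //; split => // l.
by have := away_lam h3 l; rewrite subrr nq0 leNgt e20.
Qed.

Lemma free_region p : free_pt p -> region_of_discontinuity Gam p.
Proof.
move=> hp; have [e e0 he] := free_near hp.
exists [set p' | free_pt p' /\ away S e (tw p')] => //.
apply: sub_finite_set (Gam_finite e0) => g [hg [q [[_ h1] [q' [h2 h3] E]]]].
by split => //; exists q'; rewrite E.
Qed.

Lemma lam_neq_center i a : reduced (i :: a) -> wact a 0 != c i.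
Proof.
move=> ra; rewrite -(rad_gt0 S).
case: a ra => [_|j a ra]; first by apply: lt_le_trans (br_gt0 S i) _; exact: fund0.
have /andP[ij ra'] : (i != j) && reduced (j :: a) by [].
apply: lt_trans (br_gt0 S i) _; apply: (ball_disjoint ij).
by apply: wact_in => //; exact: fund0.
Qed.

Lemma ftw_orbit w X : reduced w -> finpt X.1 -> ftw X = wact w 0 ->
  finpt (foldr flift X (rev w)).1 /\ ftw (foldr flift X (rev w)) = 0.
Proof.
elim: w X => [//|i w IH] X rw Xf EX.
have nc : ftw X != c i.
  rewrite EX /=; apply: contra_neq (lam_neq_center rw) => e.
  by rewrite -[LHS](reflK S i) e refl_center.
have [h1 h2] := flift_tw Xf nc.
rewrite rev_cons -cats1 foldr_cat /=; apply: IH => //; first exact: reduced_tail rw.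
by rewrite h2 EX /= reflK.
Qed.

(** The lift also moves points along the fibres: the direction [u] becomes [(qbar (c i - c j) (q - c
    i) + r i ^+ 2) u]. The assumption makes the coefficient real and positive, so that the direction
    is kept. *)
Lemma two_balls i j q u : i != j -> u != 0 -> r i < rad i q ->
  (exists a : R, qmul (qbar (c i) - qbar (c j)) (q - c i) = rc a *: (1, 0) /\ 0 <= a) ->
  wlift [:: j; i] (pt q u) = pt (refl j (refl i q)) u.
Proof.
move=> ij u0 qi [a [Ea a0]].
have qc : q != c i by rewrite -(rad_gt0 S) (lt_trans (br_gt0 S i)).
have ic : refl i q != c j.
  rewrite -(rad_gt0 S) (lt_trans (br_gt0 S j)) // (ball_disjoint (i := j) (j := i)) 1?eq_sym //.
  by apply: refl_out_le; exact: ltW.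
have X0 : finpt (pt q u) by exact: finpt_pt.
have [h1 h2] := @flift_tw i (pt q u, false) X0 (eq_ind_r (fun x => x != c i) qc (tw_pt q u0)).
have h2' : ftw (flift i (pt q u, false)) = refl i q by rewrite h2 /ftw /= tw_pt.
have [h3 h4] := @flift_tw j _ h1 (eq_ind_r (fun x => x != c j) ic h2').
have h5 : tw (wlift [:: j; i] (pt q u)) = refl j (refl i q).
  by have := h4; rewrite h2'.
have w0 := row4_neq0 (qmul q u) u0.
have E : wlift [:: j; i] (pt q u) = mk (row4 u (qmul q u) *m Amx (qbar (c i)) (r i) *m Amx (c j) (r j)).
  by rewrite /wlift /flift /= /pt !mact_mk ?A_unit ?r_neq0 // act_neq0 ?A_unit ?r_neq0.
pose k := a + r i ^+ 2.
have k0 : 0 < k by rewrite ltr_wpDl // exprn_gt0 // br_gt0.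
have Eu : exists v, row4 u (qmul q u) *m Amx (qbar (c i)) (r i) *m Amx (c j) (r j) = row4 (rc k *: u) v.
  rewrite row4_A qbarK -qmulBl row4_A; eexists; congr row4.
  by rewrite addrAC -qmulBl qmulA Ea qmulZl /k rcD scalerDl qmul1l.
have [v Ev] := Eu.
have ku0 : rc k *: u != 0 by rewrite scalez_eq0 // rc_eq0 gt_eqF.
have h6 : finpt (mk (row4 (rc k *: u) v)) by rewrite finpt_mk // row4_neq0.
rewrite E Ev in h5 *.
have v_eq : v = qmul (refl j (refl i q)) (rc k *: u).
  rewrite -h5 /tw; have [z z0 Ez] := homog_mk (row4_neq0 v ku0).
  rewrite Ez hdZ tlZ hd_row4 tl_row4.
  have zk0 : z *: (rc k *: u) != 0 by rewrite scalez_eq0.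
  have := qmul_unit (z *: v) zk0; rewrite qmulZr => e.
  rewrite -[LHS]scale1r -[RHS]scale1r -(mulVf z0) -!scalerA e.
  by [].
by rewrite v_eq -/(pt _ (rc k *: u)) ptZ // rc_eq0 gt_eqF.
Qed.

Lemma finite_nat_bound (A : set nat) : finite_set A -> exists N, forall n, A n -> (n < N)%N.
Proof.
move=> /finite_seqP[s ->]; exists (\max_(n <- s) n).+1 => n /= ns.
by rewrite ltnS (big_rem n ns) leq_maxl.
Qed.

(** Each point of the fibre must be a limit point, not just some of them. One ball [k] near the cusp
    is fixed, and infinitely many balls [j] near it give products of two inversions that carry a
    point near [pt 0 u] to another one, with the same direction by [two_balls]. *)
Lemma zero_fiber_limit u : u != 0 -> limit_set Gam (pt 0 u).
Proof.
move=> u0 [U xU fU].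
have idc : (fun q : Q => q) @ nbhs (0 : Q) --> (0 : Q) by exact: cvg_id.
have uc : (fun _ : Q => u) @ nbhs (0 : Q) --> u by apply: cvgQ_cst.
have cp : (fun q : Q => pt q u) @ nbhs (0 : Q) --> pt 0 u.
  exact: (@cvg_pt _ _ (nbhs (0 : Q)) _ _ _ _ _ u0 idc uc).
have /nbhsQ[e e0 he] : nbhs (0 : Q) [set q | U (pt q u)] by exact: (cp _ xU).
have {}he q : nq q < e -> U (pt q u) by move=> h; apply: he; rewrite subr0.
have e90 : 0 < e / 9 by rewrite divr_gt0.
have [k _ hk] := balls_near0 S 0 e90.
have ck : nq (c k) < e / 9 by apply: hk; rewrite rad_center ltW // br_gt0.
(* The centre and a boundary point of the ball both have norm below [e / 9]. *)
have rk : r k <= 2 * e / 9.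
  have hx : rad k (c k + (rc (r k), 0)) = r k.
    rewrite !radE addrAC subrr add0r /nq /= cabs0 expr0n addr0 sqrtr_sqr.
    by rewrite !ger0_norm ?cabs_ge0 // cabs_rc ger0_norm // ltW // br_gt0.
  have h : nq (c k + (rc (r k), 0)) < e / 9 by apply: hk; rewrite hx.
  have : rad k (c k + (rc (r k), 0)) <= nq (c k + (rc (r k), 0)) + nq (c k).
    by rewrite -[nq (c k)]nqN; exact: nqD.
  by rewrite hx; move: h ck; lra.
pose J := [set j : nat | k != j /\ forall x, rad j x <= r j -> nq x < e / 9].
pose x0 : Q := (0, 1).
have x0f : fund x0 by exact: fund0w.
have x0l : ~ lam x0.
  move=> /(lam_fund x0f)[t E _].
  have t0 : t = 0.
    by apply/eqP; rewrite -sqrf_eq0; apply/eqP; exact: (esym (congr1 fst E)).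
  have := congr1 snd E; rewrite t0 cusp0 => /= /eqP.
  by rewrite oner_eq0.
have u10 : ((1, 0) : Q) != 0.
  by apply/eqP => e1; have := oner_neq0 C; rewrite -[1]/((1, 0) : Q).1 e1 eqxx.
have free0 : free_pt (pt x0 (1, 0)) by split; rewrite ?finpt_pt // tw_pt.
have JG j : J j -> [set g | Gam g /\ U `&` (g @` U) !=set0] (wlift [:: j; k]).
  move=> [kj hj]; split; first by exists [:: j; k].
  have cj : nq (c j) < e / 9 by apply: hj; rewrite rad_center ltW // br_gt0.
  have d0 : 0 < nq (c k - c j).
    have h : r j < rad j (c k) by apply: (ball_disjoint (j := k)); rewrite 1?eq_sym // rad_center ltW // br_gt0.
    by apply: lt_trans h; exact: br_gt0.
  pose s := 2 * r k / nq (c k - c j).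
  have s0 : 0 <= s by rewrite divr_ge0 ?nq_ge0 // mulr_ge0 // ltW // br_gt0.
  (* On the ray from [c j] through [c k], at distance [2 * r k] beyond [c k]: outside the [k]-th
     ball, close to the cusp, and in the direction that [two_balls] requires. *)
  pose q := c k + rc s *: (c k - c j).
  have qk : rad k q = 2 * r k.
    by rewrite !radE /q addrAC subrr add0r nqZ ger0_norm // divfK // gt_eqF.
  have qe : nq q < e.
    have := nq_sub q (c k); rewrite -/(rad k q) qk; move: ck rk; lra.
  have rk0 := br_gt0 S k.
  have kq : r k < rad k q by rewrite qk; lra.
  exists (pt (refl j (refl k q)) u); split.
    apply: he; have : nq (refl j (refl k q)) < e / 9.
      apply: hj; apply: refl_out_le; apply: ltW; apply: (ball_disjoint (j := k)); rewrite 1?eq_sym //.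
      by apply: refl_out_le; exact: ltW.
    by move: e0; lra.
  exists (pt q u); first exact: he.
  apply: two_balls => //; exists (s * nq (c k - c j) ^+ 2); split; last by rewrite mulr_ge0 // sqr_ge0.
  rewrite -qbarN -qbarD /q addrAC subrr add0r.
  by rewrite qmulZr -{2}(qmul1r (c k - c j)) qmul_bar rcZA.
have fJ : finite_set J.
  (* Different [j] give different maps: [j] is recovered as the ball into which the base point is
     sent. *)
  pose phi (g : P -> P) := xget 0%N [set j | rad j (tw (g (pt x0 (1, 0)))) <= r j].
  apply: (@sub_finite_set _ _ (phi @` [set g | Gam g /\ U `&` (g @` U) !=set0]));
    last exact: finite_image.
  move=> j hj; exists (wlift [:: j; k]); first exact: JG.
  have [kj _] := hj.
  have e1 : rad j (tw (wlift [:: j; k] (pt x0 (1, 0)))) <= r j.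
    have [_ ->] := @wlift_tw [:: j; k] _ isT free0.
    by rewrite tw_pt //; apply: wact_in; [rewrite /reduced /= eq_sym kj|exact: x0f].
  have e2 : [set l | rad l (tw (wlift [:: j; k] (pt x0 (1, 0)))) <= r l] (phi (wlift [:: j; k])).
    by apply: xgetPex; exists j.
  exact: (ball_uniq e2 e1).
have [N HN] := finite_nat_bound fJ.
have [j Nj hj] := balls_near0 S (maxn N k.+1) e90.
have : (j < N)%N.
  apply: HN; split => //; apply/eqP => e1; move: Nj; rewrite -e1 leqNgt.
  by rewrite leq_max ltnSn orbT.
by rewrite ltnNge (leq_trans (leq_maxl _ _) Nj).
Qed.

Lemma Gam_limit_act g p : Gam g -> limit_set Gam p -> limit_set Gam (g p).
Proof.
move=> hg hp hgp; apply: hp.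
have [_ _ GV] := Gam_group.
have [g' [hg' gK _]] := GV g hg.
by rewrite -(gK p); exact: (group_region Gam_group Gam_continuous hg' hgp).
Qed.

Lemma closed_limit : closed (limit_set Gam).
Proof. by apply: open_closedC; exact: open_region. Qed.

Lemma orbit_limit w u : reduced w -> ~~ odd (size w) -> u != 0 ->
  limit_set Gam (pt (wact w 0) u).
Proof.
move=> rw ew u0; set p := pt _ _.
have erw : ~~ odd (size (rev w)) by rewrite size_rev.
have [h1 h2] := @ftw_orbit w (p, false) rw (finpt_pt _ u0) (tw_pt _ u0).
rewrite wlift_pair //= in h1 h2.
rewrite -(wlift_revr p ew); apply: Gam_limit_act; first by exists w.
by rewrite (pt_tw h1) [tw _]h2; exact: zero_fiber_limit.
Qed.

(** The limit set is closed and invariant, and the orbit of [0], whose whole fibre it contains, is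
    dense in [lam]. *)
Lemma lam_limit x u : lam x -> u != 0 -> limit_set Gam (pt x u).
Proof.
move=> [t _ <-] u0; apply: contrapT => h.
have nU : nbhs (pt (f t) u) (region_of_discontinuity Gam).
  by apply: open_nbhs_nbhs; split; [exact: open_region|exact: contrapT].
have cp : (fun q : Q => pt q u) @ nbhs (f t) --> pt (f t) u.
  have idc : (fun q : Q => q) @ nbhs (f t) --> f t by exact: cvg_id.
  have uc : (fun _ : Q => u) @ nbhs (f t) --> u by apply: cvgQ_cst.
  exact: (@cvg_pt _ _ (nbhs (f t)) _ _ _ _ _ u0 idc uc).
have /nbhsQ[e e0 he] : nbhs (f t) [set q | region_of_discontinuity Gam (pt q u)].
  exact: (cp _ nU).
have [w [rw ew hw]] := orbit_dense S t e0.
exact: (orbit_limit rw ew u0 (he _ hw)).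
Qed.

(** The sphere is unbounded in [Q]: the points [row4 u v] with [u = f(t)^-1 v] lie over the sphere
    and tend to [row4 0 v] as [f(t)] goes to infinity. *)
Lemma infinity_limit v : v != 0 -> limit_set Gam (mk (row4 0 v)).
Proof.
move=> v0; apply: contrapT => h.
have w0 : row4 0 v != 0 by rewrite row4_eq0 negb_and v0 orbT.
have nU : nbhs (mk (row4 0 v)) (region_of_discontinuity Gam).
  by apply: open_nbhs_nbhs; split; [exact: open_region|exact: contrapT].
have cp : (fun q : Q => mk (row4 q v)) @ nbhs (0 : Q) --> mk (row4 0 v).
  have idc : (fun q : Q => q) @ nbhs (0 : Q) --> (0 : Q) by exact: cvg_id.
  have vc : (fun _ : Q => v) @ nbhs (0 : Q) --> v by apply: cvgQ_cst.
  have rc4 : (fun q : Q => row4 q v) @ nbhs (0 : Q) --> row4 0 v.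
    exact: (@cvg_row4 _ _ (nbhs (0 : Q)) _ _ _ _ _ idc vc).
  exact: (cvg_comp _ _ rc4 (mk_continuous w0)).
have /nbhsQ[e e0 he] : nbhs (0 : Q) [set q | region_of_discontinuity Gam (mk (row4 q v))].
  exact: (cp _ nU).
pose M := 1 + nq v / e.
have M0 : 0 < M by rewrite ltr_wpDr // divr_ge0 ?nq_ge0 // ltW.
have ft : M <= nq (f (rc (M + 2))).
  have := limap_proper S (rc (M + 2)); rewrite cabs_rc ger0_norm; first by lra.
  by rewrite addr_ge0 // ltW.
have f0 : 0 < nq (f (rc (M + 2))) by exact: lt_le_trans ft.
have fn0 : f (rc (M + 2)) != 0 by rewrite -nq_gt0.
pose u := qmul (qinv (f (rc (M + 2)))) v.
have hu : nq u < e.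
  rewrite /u nq_qmul /qinv nqZ nq_qbar ger0_norm ?invr_ge0 ?sqr_ge0 //.
  rewrite (_ : nq _ ^- 2 * nq _ = (nq (f (rc (M + 2))))^-1); last first.
    by field; rewrite gt_eqF.
  rewrite mulrC ltr_pdivrMr // mulrC -ltr_pdivrMr //.
  by apply: lt_le_trans ft; rewrite /M; lra.
have u0 : u != 0.
  rewrite /u qmul_eq0 negb_or v0 andbT /qinv -nq_eq0 nqZ nq_qbar.
  by rewrite mulf_neq0 ?normr_eq0 ?invr_eq0 ?expf_neq0 // gt_eqF.
have := he u; rewrite subr0 => /(_ hu) /=.
have -> : mk (row4 u v) = pt (f (rc (M + 2))) u by rewrite /pt /u qmulV.
by apply: lam_limit => //; exists (rc (M + 2)).
Qed.

Lemma limit_setE : limit_set Gam = lam_lift.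
Proof.
apply/seteqP; split => p hp; first by move=> /free_region; exact: hp.
have [pf|pf] := boolP (finpt p).
  rewrite (pt_tw pf); apply: lam_limit => //.
  by apply: contrapT => l; exact: hp.
have h0 : hd (homog p) = 0 by apply/eqP; rewrite -[_ == _]negbK.
rewrite -[p]mk_homog -(row4_hdtl (homog p)) h0; apply: infinity_limit.
apply/eqP => t0; have := homog_neq0 p; rewrite -(row4_hdtl (homog p)) h0 t0.
by rewrite row4_eq0 !eqxx.
Qed.

Lemma regionE : region_of_discontinuity Gam = free_pt.
Proof.
apply/seteqP; split => p; last exact: free_region.
move=> hp; apply: contrapT => h.
have : lam_lift p by [].
by rewrite -limit_setE; apply.
Qed.

Definition base_pt : P := pt (0, 1) (1, 0).

Lemma base_lam : ~ lam ((0, 1) : Q).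
Proof.
move=> /(lam_fund (fund0w S 1))[t E _].
have t0 : t = 0.
  by apply/eqP; rewrite -sqrf_eq0; apply/eqP; exact: (esym (congr1 fst E)).
have := congr1 snd E; rewrite t0 cusp0 => /= /eqP.
by rewrite oner_eq0.
Qed.

Lemma base_u : ((1, 0) : Q) != 0.
Proof.
by apply/eqP => e1; have := oner_neq0 C; rewrite -[1]/((1, 0) : Q).1 e1 eqxx.
Qed.

Lemma base_free : free_pt base_pt.
Proof. by split; rewrite ?finpt_pt ?tw_pt ?base_u //; exact: base_lam. Qed.

Lemma fund_nbhs0w (w : C) : w != 0 -> ~ lam (0, w) -> \forall x \near ((0, w) : Q), fund x.
Proof.
move=> w0 hl.
apply: (@filterS _ (nbhs ((0, w) : Q)) _ _ _ _ (fund_near (fund0w S w) hl)) => x hx i.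
rewrite leNgt; apply/negP => /hx e.
have : rad i (0, w) <= r i by rewrite e.
by move=> /b_local[]; rewrite eqxx.
Qed.

Lemma wlift_id w : ~~ odd (size w) -> reduce w = [::] -> wlift w = id.
Proof.
move=> ew h; apply/funext => p.
by rewrite /wlift -foldr_reduce ?h //; exact: fliftK.
Qed.

(** The base point lies over the interior of the fundamental domain, so an element that sends it
    into the same tile as [wlift a] does differs from [wlift a] by a word that reduces to at most
    one letter, hence by parity to none. *)
Lemma Gam_discrete : discrete Gam.
Proof.
move=> _ [a ea ->].
pose U := [set p | finpt p /\ fund (tw p)].
have [bf bl] := base_free.
have twb : tw base_pt = (0, 1) by rewrite tw_pt ?base_u.
have nU : nbhs base_pt U.
  have ct : tw @ nbhs base_pt --> tw base_pt by exact: tw_cont.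
  have n1 : nbhs (tw base_pt) fund.
    by rewrite twb; apply: fund_nbhs0w; [exact: oner_neq0|exact: base_lam].
  have h2 : nbhs base_pt [set p | fund (tw p)] by exact: (ct _ n1).
  exact: filterI (near_finpt bf) h2.
pose O := wlift (rev a) @^-1` U°.
have oO : open O.
  by move/continuousP: (@wlift_continuous (rev a)); apply; exact: open_interior.
exists [set g | g @` [set base_pt] `<=` O].
  by apply: compact_open_open => //; exact: compact_set1.
apply/seteqP; split => [g [gO [b eb gb]]|_ -> /=]; last first.
  split; last by exists a.
  by move=> _ [_ -> <-]; rewrite /O /= wlift_rev.
have era : ~~ odd (size (rev a)) by rewrite size_rev.
have gb0 : O (g base_pt) by apply: gO; exists base_pt.
have {gb0} : U (wlift (rev a) (g base_pt)) by exact: interior_subset gb0.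
rewrite gb -wlift_cat // => -[_].
have erb : ~~ odd (size (rev a ++ b)) by rewrite size_cat oddD (negbTE era).
have [_ ->] := wlift_tw erb base_free.
rewrite twb => hq.
have fq := fund0w S 1.
have E : wact (reduce (rev a ++ b)) (0, 1) = wact (rev a ++ b) (0, 1).
  by apply: foldr_reduce; exact: reflK.
have [h|[i h _]] := fund_word (reduced_reduce _) fq hq E.
  rewrite /= -gb; apply/funext => p.
  have := wlift_id erb h => /(congr1 (fun F => F p)); rewrite wlift_cat // => h'.
  by rewrite gb -[LHS](wlift_revr (wlift b p) ea) h'.
by have := odd_reduce (rev a ++ b); rewrite h (negbTE erb).
Qed.

Lemma Gam_kleinian : complex_kleinian Gam.
Proof.
split.
- by move=> _ [w _ ->]; exact: wlift_aut.
- exact: Gam_group.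
- exact: Gam_discrete.
- by rewrite regionE; exists base_pt; exact: base_free.
split; first exact: open_region.
- move=> _ [w ew ->]; rewrite regionE; apply/seteqP; split => [_ [p hp <-]|p hp].
    exact: wlift_free.
  exists (wlift (rev w) p); last by rewrite wlift_revr.
  by apply: wlift_free; rewrite ?size_rev.
move=> A cA; rewrite regionE => Af.
have /compact_near_coveringP/(_ nat \oo (fun n p => away S (2^-1 ^+ n) (tw p))) := cA.
case.
  move=> p /Af hp; have [e e0 he] := free_near hp.
  have [N HN] := exists_half_lt e0.
  exists ([set p' | free_pt p' /\ away S e (tw p')], [set n | (N <= n)%N]).
    by split => //; exists N.
  move=> [p' n] [/= [_ h1] h2] t; apply: le_trans (h1 t).
  by apply: ltW; apply: le_lt_trans HN; exact: half_mono.
move=> N _ HN; apply: sub_finite_set (Gam_finite (half_gt0 (R := R) N)) => g [hg [q [Aq [p Ap E]]]].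
split => //; exists p; split; first exact: Af.
  exact: (HN N (leqnn N)).
by rewrite E; exact: (HN N (leqnn N)).
Qed.

End twistor_group.

(** * Tame sets are locally conical *)

Section continuity_on.
Context {T U V : topologicalType}.

Definition conton {T U : topologicalType} (A : set T) (f : T -> U) : Prop :=
  forall x, A x -> forall W, nbhs (f x) W -> \forall y \near x, A y -> W (f y).

Lemma contonP (A : set T) (f : T -> U) : {within A, continuous f} <-> conton A f.
Proof. exact: (subspace_continuousP A f). Qed.

Lemma conton_comp (A : set T) (B : set U) (f : T -> U) (g : U -> V) :
  conton A f -> conton B g -> (forall x, A x -> B (f x)) -> conton A (g \o f).
Proof.
move=> hf hg AB x Ax W hW.
have := hf x Ax _ (hg _ (AB x Ax) W hW).
by apply: (@filterS _ (nbhs x)) => y h Ay; apply: h => //; exact: AB.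
Qed.

Lemma conton_at (A : set T) (f : T -> U) :
  (forall x, A x -> {for x, continuous f}) -> conton A f.
Proof.
move=> H x Ax W hW; have := H x Ax W hW.
by apply: (@filterS _ (nbhs x)) => y.
Qed.

Lemma contonT (f : T -> U) : continuous f <-> conton setT f.
Proof.
split=> [H|H x W hW]; first by apply: conton_at => x _; exact: H.
by have := H x I W hW; apply: (@filterS _ (nbhs x)) => y; exact.
Qed.

End continuity_on.

(** * Local cone structure of polyhedra *)

Section simplices.
Context {R : realType} {N : nat}.
Local Notation V := 'rV[R]_N.
Implicit Types (s : {fset V}) (T L : {fset {fset V}}) (x y v : V).

Lemma sum_nth {M : nmodType} (s : seq V) (G : V -> M) :
  \sum_(v <- s) G v = \sum_(i < size s) G (nth 0 s i).
Proof. by rewrite (big_nth 0) big_mkord. Qed.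

Lemma simplex_compact s : compact (simplex s).
Proof.
have [vs vsE] : exists vs : seq V, vs = enum_fset s by eexists.
have vsU : uniq vs by rewrite vsE; exact: fset_uniq.
pose m := size vs.
pose F (w : 'rV[R]_m) : V := \sum_(i < m) w 0 i *: nth 0 vs i.
pose D : set 'rV[R]_m := [set w | (forall i, `[0, 1]%classic (w 0 i)) /\ \sum_i w 0 i = 1].
have cc i : continuous (fun w : 'rV[R]_m => w 0 i) by move=> w; exact: coord_continuous.
have csum n (G : 'I_n -> 'rV[R]_m -> R) : (forall i, continuous (G i)) ->
    continuous (fun w => \sum_(i < n) G i w).
  move=> hG w; elim: n G hG => [|n IH] G hG.
    rewrite (_ : (fun _ => _) = cst 0); first exact: (@cvg_cst _ _ _ (nbhs w)).
    by apply/funext => u; rewrite big_ord0.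
  rewrite (_ : (fun _ => _) = (fun u => G ord0 u + \sum_(i < n) G (lift ord0 i) u)).
    apply: (@cvgD _ _ _ (nbhs w)); first exact: (hG ord0 w).
    by apply: (IH (fun i => G (lift ord0 i))) => i; exact: hG.
  by apply/funext => u; rewrite big_ord_recl.
have csumV n (G : 'I_n -> 'rV[R]_m -> V) : (forall i, continuous (G i)) ->
    continuous (fun w => \sum_(i < n) G i w).
  move=> hG w; elim: n G hG => [|n IH] G hG.
    rewrite (_ : (fun _ => _) = cst 0); first exact: (@cvg_cst _ _ _ (nbhs w)).
    by apply/funext => u; rewrite big_ord0.
  rewrite (_ : (fun _ => _) = (fun u => G ord0 u + \sum_(i < n) G (lift ord0 i) u)).
    apply: (@cvgD _ _ _ (nbhs w)); first exact: (hG ord0 w).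
    by apply: (IH (fun i => G (lift ord0 i))) => i; exact: hG.
  by apply/funext => u; rewrite big_ord_recl.
have cD : compact D.
  have K := @rV_compact R m (fun _ => `[0, 1]%classic) (fun _ => @segment_compact R 0 1).
  apply: (subclosed_compact _ K); last by move=> w [].
  rewrite (_ : D = [set w : 'rV[R]_m | (forall i, `[0, 1]%classic (w 0 i))] `&`
     ((fun w : 'rV[R]_m => \sum_i w 0 i) @^-1` [set 1])) //.
  apply: closedI; first by apply: compact_closed K; exact: norm_hausdorff.
  apply: closed_comp; last exact: closed_eq.
  by move=> w _; exact: (csum m (fun i u => u 0 i) cc).
have cF : continuous F.
  apply: (csumV m (fun i u => u 0 i *: nth 0 vs i)) => i w.
  by apply: (@cvgZr_tmp _ _ _ (nbhs w)); exact: cc.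
have -> : simplex s = F @` D.
  rewrite /simplex; have vsm v : (v \in s) = (v \in vs) by rewrite vsE.
  rewrite -vsE; apply/seteqP; split => [x [w [w0 w1 <-]]|x [w [w01 w1] <-]].
    exists (\row_i w (nth 0 vs i)); last first.
      by rewrite sum_nth /F; apply: eq_bigr => i _; rewrite mxE.
    have s1 : \sum_i (\row_(i < m) w (nth 0 vs i)) 0 i = (1 : R).
      by rewrite -[RHS]w1 sum_nth; apply: eq_bigr => i _; rewrite mxE.
    split => // i; rewrite /= in_itv /= mxE w0 ?vsm ?mem_nth //=.
    rewrite -w1 sum_nth (bigD1 i) //= lerDl sumr_ge0 // => j _.
    by rewrite w0 ?vsm ?mem_nth.
  pose W v := if [pick i : 'I_m | nth 0 vs i == v] is Some i then w 0 i else 0.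
  have WE (i : 'I_m) : W (nth 0 vs i) = w 0 i.
    rewrite /W; case: pickP => [j /eqP e|/(_ i)]; last by rewrite eqxx.
    congr (w 0 _); apply: val_inj; apply/eqP.
    by rewrite -(nth_uniq 0 (s := vs)) ?e ?eqxx ?ltn_ord.
  exists W; split.
  - move=> v _; rewrite /W; case: pickP => // i _.
    by have := w01 i; rewrite /= in_itv /= => /andP[].
  - by rewrite -w1 sum_nth; apply: eq_bigr => i _; exact: WE.
  - by rewrite sum_nth; apply: eq_bigr => i _; rewrite WE.
by apply: continuous_compact => //; exact: continuous_subspaceT.
Qed.

Lemma simplex_away s x : ~ simplex s x -> exists2 e : R, 0 < e &
  forall y, simplex s y -> e <= `|y - x|.
Proof.
move=> nx; have /compact_closed := @simplex_compact s.
move=> /(_ (@norm_hausdorff R V)) cl.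
have : nbhs x (~` simplex s).
  by apply: open_nbhs_nbhs; split => //; exact: closed_openC.
move=> /nbhs_ballP[e /= e0 he]; exists e => // y sy.
rewrite leNgt; apply/negP => h; apply: (he y) => //.
by rewrite -ball_normE /ball_/= distrC.
Qed.

Lemma simplices_away T x : exists2 e : R, 0 < e &
  forall s y, s \in T -> simplex s y -> `|y - x| < e -> simplex s x.
Proof.
suff [e e0 H] : exists2 e : R, 0 < e &
  forall s y, s \in enum_fset T -> simplex s y -> `|y - x| < e -> simplex s x by exists e.
elim: (enum_fset T) => [|s l [e e0 he]]; first by exists 1.
have [sx|sx] := pselect (simplex s x).
  by exists e => // s' y; rewrite inE => /orP[/eqP ->//|h]; exact: he.
have [d d0 hd] := simplex_away sx.
exists (Num.min e d) => [|s' y]; first by rewrite lt_min e0.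
rewrite inE lt_min => /orP[/eqP -> /hd h1 /andP[_]|h1 h2 /andP[h3 _]].
  by rewrite ltNge h1.
exact: he h1 h2 h3.
Qed.

Lemma simplex_convex s x y (a : R) : 0 <= a <= 1 -> simplex s x -> simplex s y ->
  simplex s (x + a *: (y - x)).
Proof.
move=> /andP[a0 a1] [w [w0 w1 <-]] [u [u0 u1 <-]].
exists (fun v => (1 - a) * w v + a * u v); split.
- by move=> v vs; rewrite addr_ge0 // mulr_ge0 ?w0 ?u0 ?subr_ge0.
- by rewrite big_split /= -!mulr_sumr w1 u1; ring.
- rewrite scalerBr !scaler_sumr -sumrB -big_split; apply: eq_bigr => v _ /=.
  by rewrite !scalerA scalerDl mulrBl mul1r scalerBl addrAC addrA.
Qed.

Lemma sum_fsetI {M : nmodType} s s' (F : V -> M) :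
  \sum_(v <- (s `&` s')%fset) F v = \sum_(v <- s | v \in s') F v.
Proof.
rewrite -[RHS]big_filter; apply: perm_big; apply: uniq_perm.
- exact: fset_uniq.
- by rewrite filter_uniq ?fset_uniq.
by move=> v; rewrite mem_filter in_fsetI andbC.
Qed.

(* A face containing the points [x0] and [x0 + a (x - x0)] contains [x]. *)
Lemma simplex_cone s s' x0 x (a : R) : affinely_independent s -> 0 < a ->
  simplex s x -> simplex (s `&` s')%fset x0 ->
  simplex (s `&` s')%fset (x0 + a *: (x - x0)) -> simplex (s `&` s')%fset x.
Proof.
move=> ind a0 [w [w0 w1 wx]] [u [u0 u1 ux]] [b [b0 b1 bx]].
pose ext (g : V -> R) v : R := if v \in s' then g v else 0.
have sum_ext g : \sum_(v <- s) ext g v = \sum_(v <- (s `&` s')%fset) g v.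
  rewrite sum_fsetI [RHS]big_mkcond; apply: eq_bigr => v _; rewrite /ext.
  by case: ifP.
have sumV_ext g : \sum_(v <- s) ext g v *: v = \sum_(v <- (s `&` s')%fset) g v *: v.
  rewrite sum_fsetI [RHS]big_mkcond; apply: eq_bigr => v _; rewrite /ext.
  by case: ifP => //; rewrite scale0r.
(* The difference of two barycentric expressions of [x0 + a *: (x - x0)] over the vertices of [s];
   it vanishes by affine independence, which forces [w] to vanish off [s']. *)
pose z v := (1 - a) * ext u v + a * w v - ext b v.
have z0 : forall v, v \in s -> z v = 0.
  apply: ind.
    rewrite /z sumrB big_split /= -!mulr_sumr !sum_ext u1 w1 b1; ring.
  have -> : \sum_(v <- s) z v *: v = (1 - a) *: (\sum_(v <- s) ext u v *: v) +
      a *: (\sum_(v <- s) w v *: v) - \sum_(v <- s) ext b v *: v.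
    rewrite !scaler_sumr -big_split -sumrB; apply: eq_bigr => v _ /=.
    by rewrite /z !scalerA scalerBl scalerDl.
  rewrite !sumV_ext ux wx bx; apply/eqP; rewrite subr_eq0; apply/eqP.
  by rewrite scalerBl scale1r scalerBr addrAC addrA.
have w_out v : v \in s -> v \notin s' -> w v = 0.
  move=> vs vs'; have := z0 v vs; rewrite /z /ext (negbTE vs') mulr0 add0r subr0 => /eqP.
  by rewrite mulf_eq0 gt_eqF //= => /eqP.
have wE : \sum_(v <- (s `&` s')%fset) w v = \sum_(v <- s) w v.
  rewrite -sum_ext; apply: eq_big_seq => v vs; rewrite /ext.
  by case: ifPn => // /(w_out v vs).
have wVE : \sum_(v <- (s `&` s')%fset) w v *: v = \sum_(v <- s) w v *: v.
  rewrite -sumV_ext; apply: eq_big_seq => v vs; rewrite /ext.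
  by case: ifPn => // /(w_out v vs) ->.
exists w; rewrite wE wVE; split => // v; rewrite in_fsetI => /andP[vs _]; exact: w0.
Qed.

(** Near [x0] only simplices containing [x0] occur. Homotheties towards [x0] preserve each of them,
    and cannot bring a point into a face that does not contain it already. *)
Lemma cone_polyhedron T x0 : simplicial_complex T -> exists2 e : R, 0 < e &
  forall x (a : R), polyhedron T x -> `|x - x0| < e -> 0 < a <= 1 ->
    polyhedron T (x0 + a *: (x - x0)) /\
    forall L, (L `<=` T)%fset -> polyhedron L (x0 + a *: (x - x0)) -> polyhedron L x.
Proof.
move=> [T1 T2 T3]; have [e e0 he] := simplices_away T x0.
exists e => // x a [s sT sx] xe /andP[a0 a1].
have sx0 := he s x sT sx xe.
have sy : simplex s (x0 + a *: (x - x0)).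
  by apply: simplex_convex => //; rewrite (ltW a0).
split; first by exists s.
move=> L /fsubsetP LT [s' s'L s'y]; have s'T := LT _ s'L.
have ye : `|x0 + a *: (x - x0) - x0| < e.
  rewrite addrAC subrr add0r normrZ gtr0_norm //.
  by apply: le_lt_trans xe; rewrite ler_piMl.
have s'x0 := he s' _ s'T s'y ye.
have E := T3 s s' sT s'T.
exists s' => //.
suff : (simplex s `&` simplex s') x by case.
rewrite E; have [_ ind] := T1 s sT.
by apply: (simplex_cone (x0 := x0) (a := a)) => //; rewrite -E.
Qed.

End simplices.

(** The homothety towards the image of [p], transported by the triangulation and the ambient
    homeomorphism. The neighbourhood [U] is fixed before the target [W]; only the final stage [s0]
    depends on [W]. *)
Lemma tame_cone {R : realType} (S : set (proj3 R[i])) (p : proj3 R[i]) : tame S ->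
  exists2 U : set (proj3 R[i]), nbhs p U & forall W, nbhs p W ->
  exists (s0 : R) (H : R -> proj3 R[i] -> proj3 R[i]),
  [/\ 0 < s0 <= 1, forall x, U x -> H 1 x = x,
      forall s x, U x -> ~ S x -> s0 <= s <= 1 -> ~ S (H s x),
      forall x, U x -> W (H s0 x) &
      conton (`[s0, 1]%classic `*` U) (fun z => H z.1 z.2)].
Proof.
move=> [N [T [t [h [P [[_ [ct bt [g [cg tK]]] _] [ch bh [gh [cgh hK]]] sub hS]]]]]].
have [T' [L [[cT' TT' _] LT' _ LP]]] := sub.
have [_ tinj tsurj] := bt; have [_ hinj hsurj] := bh.
have gT q : polyhedron T (g q).
  by have [x Tx <-] := tsurj q I; rewrite tK //; exact: mem_set.
have gK q : t (g q) = q.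
  by have [x Tx <-] := tsurj q I; rewrite tK //; exact: mem_set.
have ghK q : h (gh q) = q.
  by have [x _ <-] := hsurj q I; rewrite hK //; exact: mem_set.
have hK' q : gh (h q) = q by apply: hK; exact: mem_set.
move/contonP : ct => ct.
have {}cg := (contonT g).2 ((contonP setT g).1 cg).
have {}ch := (contonT h).2 ((contonP setT h).1 ch).
have {}cgh := (contonT gh).2 ((contonP setT gh).1 cgh).
pose c (x : proj3 R[i]) : 'rV[R]_N := g (h x).
have cc : continuous c by move=> x; exact: (cvg_comp _ _ (ch x) (cg (h x))).
have cT x : polyhedron T (c x) by exact: gT.
have [x0 x0E] : exists x0, x0 = c p by eexists.
have [e e0 he] := cone_polyhedron x0 cT'.
rewrite TT' in he.
pose U : set (proj3 R[i]) := [set x | `|c x - x0| < e].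
have UE x : U x -> `|c x - x0| < e by [].
exists U.
  have /cvgrPdist_lt/(_ e e0) := cc p; rewrite -x0E.
  by apply: (@filterS _ (nbhs p)) => x; rewrite /U /= distrC.
move=> W hW.
have hW' : nbhs (t x0) (gh @^-1` W).
  by apply: cgh; rewrite x0E gK hK'.
have [d /= d0 hd] := (nbhs_ballP _ _).1 (ct x0 (eq_ind_r _ (cT p) x0E) _ hW').
have [s0 s0E] : exists s0, s0 = Num.min 1 (d / e / 2) by eexists.
have s0p : 0 < s0 by rewrite s0E lt_min ltr01 !divr_gt0.
have s01 : s0 <= 1 by rewrite s0E ge_min lexx.
have s0d : s0 * e < d.
  apply: (@le_lt_trans _ _ (d / e / 2 * e)).
    by rewrite ler_pM2r // s0E ge_min lexx orbT.
  have -> : d / e / 2 * e = d / 2 by field; rewrite gt_eqF.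
  by rewrite gtr_pMr // invf_lt1 ?ltr1n.
pose k (s : R) x : 'rV[R]_N := x0 + s *: (c x - x0).
have kT s x : U x -> 0 < s <= 1 -> polyhedron T (k s x).
  by move=> Ux s01'; exact: (he _ _ (cT x) (UE _ Ux) s01').1.
exists s0, (fun s x => gh (t (k s x))); split.
- by rewrite s0p.
- by move=> x Ux; rewrite /k scale1r addrC subrK gK hK'.
- move=> s x Ux nS /andP[s1 s2] SH; apply: nS.
  have s_01 : 0 < s <= 1 by rewrite (lt_le_trans s0p s1).
  have : (t @` P) (t (k s x)) by rewrite -hS; exists (gh (t (k s x))).
  move=> [z Pz tz].
  have Tz : polyhedron T z.
    move: Pz; rewrite -LP -TT' => -[l lL lz]; exists l => //.
    exact: (fsubsetP LT').
  have zE : z = k s x by apply: tinj => //; apply/mem_set => //; exact: kT.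
  have Lx : polyhedron L (c x).
    apply: (he _ s (cT x) (UE _ Ux) s_01).2 => //.
    by move: Pz; rewrite zE LP.
  have : (h @` S) (h x) by rewrite hS; exists (c x); rewrite -?LP ?gK.
  by move=> [x' Sx' /(can_inj hK')<-].
- move=> x Ux; apply: (hd (k s0 x)); last by apply: kT => //; rewrite s0p.
  rewrite -ball_normE /ball_/= /k opprD addNKr normrN normrZ gtr0_norm //.
  apply: le_lt_trans s0d; rewrite ler_pM2l //; exact/ltW/UE.
have ck : continuous (fun z : R * proj3 R[i] => k z.1 z.2).
  move=> z; apply: (@cvgD _ _ _ (nbhs z)); first exact: (@cvg_cst _ _ _ (nbhs z)).
  apply: (@cvgZ _ _ _ (nbhs z)).
    exact: cvg_fst.
  apply: (@cvgB _ _ _ (nbhs z)); last exact: (@cvg_cst _ _ _ (nbhs z)).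
  have h2 : {for z, continuous (fun z : R * proj3 R[i] => z.2)} by exact: cvg_snd.
  exact: (@continuous_comp _ _ _ _ c z h2 (cc z.2)).
have c1 : conton (`[s0, 1]%classic `*` U) (t \o (fun z : R * proj3 R[i] => k z.1 z.2)).
  apply: (conton_comp (B := polyhedron T)) => //.
    by apply: conton_at => z _; exact: ck.
  move=> z [/= h1 h2]; apply: kT => //.
  by move: h1; rewrite in_itv /= => /andP[h1 ->]; rewrite (lt_le_trans s0p).
apply: (conton_comp c1 (B := setT) (g := gh)) => //.
exact: (contonT gh).1.
Qed.

(** * Continuous roots of a cubic *)

Section cubic.
Context {R : realType}.
Local Notation C := (Cx R).
Implicit Types (x y z w : C).

(* The discriminant of this cubic in [z] is [108 (x^3 - y^2)]. *)
Definition cub x y z : C := z ^+ 3 - 3 * x * z + 2 * y.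

Lemma cub_factor x y : exists a b c : C, forall z,
  cub x y z = (z - a) * (z - b) * (z - c).
Proof.
have [a aE] : exists a : C, cub x y a = 0.
  have [a] := @solve_monicpoly R[i] 3 (nth 0 [:: - (2 * y); 3 * x]) isT.
  rewrite !big_ord_recr big_ord0 /= add0r expr0 expr1 mulr1 mul0r addr0 => E.
  by exists a; rewrite /cub; move: E => ->; ring.
(* A root of the quadratic quotient; the third root is [- a - b] because the cubic has no quadratic
   term. *)
have [b bE] : exists b : C, b ^+ 2 = 3 * x - a ^+ 2 - a * b.
  have [b] := @solve_monicpoly R[i] 2 (nth 0 [:: 3 * x - a ^+ 2; - a]) isT.
  rewrite !big_ord_recr big_ord0 /= add0r expr0 expr1 mulr1 => E.
  by exists b; move: E => ->; ring.
exists a, b, (- a - b) => z.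
have -> : cub x y z = cub x y z - cub x y a by rewrite aE subr0.
have -> : cub x y z - cub x y a = (z - a) * (z ^+ 2 + a * z + a ^+ 2 - 3 * x).
  by rewrite /cub; ring.
have -> : 3 * x = b ^+ 2 + a ^+ 2 + a * b by rewrite bE; ring.
by ring.
Qed.

Lemma cub_near x y z (e : R) : 0 <= e -> cabs (cub x y z) <= e ^+ 3 ->
  exists2 r, cub x y r = 0 & cabs (r - z) <= e.
Proof.
move=> e0; have [a [b [c H]]] := cub_factor x y; rewrite H !cabsM => le.
have ra : cub x y a = 0 by rewrite H subrr !mul0r.
have rb : cub x y b = 0 by rewrite H subrr mulr0 mul0r.
have rd : cub x y c = 0 by rewrite H subrr mulr0.
have [la|la] := leP (cabs (a - z)) e; first by exists a.
have [lb|lb] := leP (cabs (b - z)) e; first by exists b.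
have [lc|lc] := leP (cabs (c - z)) e; first by exists c.
exfalso; move: le; apply/negP; rewrite -ltNge.
rewrite !(cabsB z) exprS expr2 mulrA.
by rewrite !ltr_pM ?mulr_ge0.
Qed.

Lemma cub_two_roots x y z w : cub x y z = 0 -> cub x y w = 0 -> z <> w ->
  z ^+ 2 + z * w + w ^+ 2 = 3 * x.
Proof.
move=> hz hw zw; have zw0 : z - w != 0 by rewrite subr_eq0; apply/eqP.
apply: (mulfI zw0); apply/eqP; rewrite -subr_eq0; apply/eqP.
have -> : (z - w) * (z ^+ 2 + z * w + w ^+ 2) - (z - w) * (3 * x) =
  cub x y z - cub x y w by rewrite /cub; ring.
by rewrite hz hw subrr.
Qed.

Lemma cub_disc x y z : cub x y z = 0 ->
  4 * (x ^+ 3 - y ^+ 2) = (x - z ^+ 2) ^+ 2 * (4 * x - z ^+ 2).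
Proof.
rewrite /cub => h; have yE : 2 * y = 3 * x * z - z ^+ 3.
  by apply/eqP; rewrite -subr_eq0 -h; apply/eqP; ring.
have -> : 4 * (x ^+ 3 - y ^+ 2) = 4 * x ^+ 3 - (2 * y) ^+ 2 by ring.
by rewrite yE; ring.
Qed.

Lemma cub_bound x y z (M : R) : 1 <= M -> cabs x <= M -> cabs y <= M ->
  cub x y z = 0 -> cabs z <= 3 * M.
Proof.
move=> M1 hx hy; rewrite /cub => h; have zE : z ^+ 3 = 3 * x * z - 2 * y.
  by apply/eqP; rewrite -subr_eq0 -h; apply/eqP; ring.
have := cabsD (3 * x * z) (- (2 * y)); rewrite -zE cabsN cabsX !cabsM !cabs_nat.
move: (cabs_ge0 z) (cabs_ge0 x) (cabs_ge0 y) => z0 x0 y0 le.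
rewrite leNgt; apply/negP => lt.
have h1 : cabs z ^+ 3 <= 3 * M * cabs z + 2 * M.
  apply: (le_trans le); apply: lerD; last by rewrite ler_pM2l.
  by rewrite ler_wpM2r // ler_pM2l.
have key (m t : R) : 1 <= m -> 3 * m < t -> t ^+ 3 <= 3 * m * t + 2 * m -> False.
  move=> m1 tm hh.
  have t3 : 3 < t by lra.
  have : (3 * m) * t < t * t by rewrite ltr_pM2r //; lra.
  have : 3 * (t * t) < t * (t * t) by rewrite ltr_pM2r // mulr_gt0 //; lra.
  have : 3 * t < t * t by rewrite ltr_pM2r //; lra.
  rewrite !exprS expr0 mulr1 in hh; lra.
exact: key M1 lt h1.
Qed.

(** Two close roots make the derivative small, hence also the discriminant. The constant is
    [9 * 13], from the bounds [3 * M * cabs (z - w)] and [13 * M ^+ 2] for the factors in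
    [cub_disc]. *)
Lemma cub_separated x y z w (M m : R) : 1 <= M -> cabs x <= M -> cabs y <= M ->
  cub x y z = 0 -> cub x y w = 0 -> z <> w -> m <= cabs (x ^+ 3 - y ^+ 2) ->
  4 * m <= 117 * M ^+ 4 * cabs (z - w) ^+ 2.
Proof.
move=> M1 hx hy hz hw zw hm.
have zM := cub_bound M1 hx hy hz; have wM := cub_bound M1 hx hy hw.
have E := cub_two_roots hz hw zw.
have hd : cabs (x - z ^+ 2) <= 3 * M * cabs (z - w).
  have : 3 * (x - z ^+ 2) = (z - w) * (- (w + 2 * z)).
    by rewrite mulrBr -E; ring.
  move/(congr1 (@cabs R)); rewrite !cabsM cabsN cabs_nat => h3.
  have : cabs (w + 2 * z) <= 9 * M.
    apply: (le_trans (cabsD _ _)); rewrite cabsM cabs_nat.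
    by move: zM wM; lra.
  move: (cabs_ge0 (z - w)); move: (cabs (z - w)) (cabs (w + 2 * z)) h3 => a b h3 a0 hb.
  have : a * b <= a * (9 * M) by rewrite ler_wpM2l.
  lra.
have h4 : cabs (4 * x - z ^+ 2) <= 13 * M ^+ 2.
  apply: (le_trans (cabsD _ _)); rewrite cabsN cabsX cabsM cabs_nat.
  have : cabs z ^+ 2 <= (3 * M) ^+ 2 by rewrite ler_pXn2r ?nnegrE ?cabs_ge0 //; lra.
  have : M <= M ^+ 2 by rewrite expr2 ler_pMl; lra.
  rewrite exprMn; lra.
have := congr1 (@cabs R) (cub_disc hz); rewrite cabsM [X in _ = X]cabsM cabsX !cabs_nat => D.
apply: (@le_trans _ _ (4 * cabs (x ^+ 3 - y ^+ 2))); first by rewrite ler_pM2l.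
rewrite D.
have -> : 117 * M ^+ 4 * cabs (z - w) ^+ 2 = (3 * M * cabs (z - w)) ^+ 2 * (13 * M ^+ 2).
  by ring.
apply: ler_pM h4; rewrite ?exprn_ge0 ?cabs_ge0 //.
rewrite ler_pXn2r ?nnegrE ?cabs_ge0 //.
by rewrite mulr_ge0 ?cabs_ge0 //; lra.
Qed.

Lemma cub_lip x y x' y' z : cub x y z = 0 ->
  cabs (cub x' y' z) <= 3 * cabs (x' - x) * cabs z + 2 * cabs (y' - y).
Proof.
move=> h; have -> : cub x' y' z = - (3 * (x' - x) * z) + 2 * (y' - y).
  by rewrite -[LHS]subr0 -h /cub; ring.
by apply: (le_trans (cabsD _ _)); rewrite cabsN !cabsM !cabs_nat.
Qed.

Lemma cub_perturb x y x' y' z (M e : R) : 0 <= e -> cub x y z = 0 -> cabs z <= M ->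
  cabs (x' - x) * (6 * (M + 1)) <= e ^+ 3 -> cabs (y' - y) * 4 <= e ^+ 3 ->
  exists2 r, cub x' y' r = 0 & cabs (r - z) <= e.
Proof.
move=> e0 h zM hx hy; apply: cub_near => //; apply: (le_trans (cub_lip _ _ h)).
have key (a b m : R) : 0 <= a -> b <= m -> a * b <= a * (m + 1).
  by move=> a0 bm; rewrite ler_wpM2l //; lra.
have := key _ _ _ (cabs_ge0 (x' - x)) zM; lra.
Qed.

End cubic.

(** * Continuous roots of families of cubics and their homotopy invariance *)

Section root_sections.
Context {R : realType}.
Local Notation C := (Cx R).

Definition root_section {T : topologicalType} (A : set T) (X Y z : T -> C) : Prop :=
  conton A z /\ forall x : T, A x -> cub (X x) (Y x) (z x) = 0.

Lemma contonC {T : topologicalType} (A : set T) (f : T -> C) (x : T) (e : R) :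
  conton A f -> A x -> 0 < e -> \forall y \near x, A y -> cabs (f y - f x) < e.
Proof.
move=> cf Ax e0; apply: (cf x Ax [set u | cabs (u - f x) < e]).
by apply/nbhsC; exists e.
Qed.

Lemma contonR {T : topologicalType} (A : set T) (f : T -> R) (x : T) (e : R) :
  conton A f -> A x -> 0 < e -> \forall y \near x, A y -> `|f y - f x| < e.
Proof.
move=> cf Ax e0; apply: (cf x Ax [set u | `|u - f x| < e]).
apply/nbhs_ballP; exists e => //= u; rewrite -ball_normE /ball_ /=.
by rewrite distrC.
Qed.

Lemma cvg_cabs {T : Type} (F : set_system T) {FF : Filter F} (f : T -> C) (z : C) :
  f @ F --> z -> (fun x => cabs (f x)) @ F --> cabs z.
Proof.
move=> fz; apply/cvgrPdist_lt => e e0.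
apply: filterS (cvgCE fz e0) => x h.
have := cabs_sub (f x) z; have := cabs_sub z (f x).
by rewrite (cabsB z) ltr_norml; lra.
Qed.

(* The root near the approximate root [a] is continuous because no other root
   comes near [a]. *)
Lemma select_root {T : topologicalType} (A : set T) (X Y a : T -> C) (d e : T -> R) :
  conton A X -> conton A Y -> conton A a -> conton A e ->
  (forall x, A x -> d x < e x) ->
  (forall x, A x -> exists2 r, cub (X x) (Y x) r = 0 & cabs (r - a x) <= d x) ->
  (forall x r s, A x -> cub (X x) (Y x) r = 0 -> cub (X x) (Y x) s = 0 ->
     cabs (r - a x) <= e x -> cabs (s - a x) <= e x -> r = s) ->
  exists2 z, root_section A X Y z & forall x, A x -> cabs (z x - a x) <= d x.
Proof.
move=> cX cY ca ce lt ex uni.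
have [z zP] : exists z : T -> C, forall x, A x ->
    cub (X x) (Y x) (z x) = 0 /\ cabs (z x - a x) <= d x.
  have /choice[z zP] : forall x, exists r, A x ->
      cub (X x) (Y x) r = 0 /\ cabs (r - a x) <= d x.
    move=> x; have [Ax|nA] := pselect (A x); last by exists 0.
    by have [r h1 h2] := ex x Ax; exists r.
  by exists z.
exists z; last by move=> x /zP[].
split; last by move=> x /zP[].
move=> x Ax W /nbhsC[e1 e10 he].
have lx := lt x Ax.
have [t [t0 t1 t2]] : exists t : R, [/\ 0 < t, t < e1 & 8 * t <= e x - d x].
  exists (Num.min (e1 / 2) ((e x - d x) / 8)).
  have h : 0 < e x - d x by rewrite subr_gt0.
  split; first by rewrite lt_min !divr_gt0.
    by apply: (@le_lt_trans _ _ (e1 / 2)); [rewrite ge_min lexx | lra].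
  have : Num.min (e1 / 2) ((e x - d x) / 8) <= (e x - d x) / 8 by rewrite ge_min lexx orbT.
  by move: (Num.min _ _) => u; lra.
have [z0E z0a] := zP x Ax.
have t3 : 0 < t ^+ 3 by rewrite exprn_gt0.
have m0 : 0 < 6 * (cabs (z x) + 1) by rewrite mulr_gt0 // ltr_wpDl ?cabs_ge0.
have nX := contonC cX Ax (divr_gt0 t3 m0).
have nY := contonC cY Ax (divr_gt0 t3 (ltr0n R 4)).
have na := contonC ca Ax t0.
have ne := contonR ce Ax t0.
have n1 := @filterI _ _ (nbhs_filter x) _ _ nX nY.
have n2 := @filterI _ _ (nbhs_filter x) _ _ na ne.
apply: (@filterS2 _ (nbhs x) _ _ _ _ _ n1 n2) => y [hX hY] [ha hen] Ay.
apply: he; have {}hX := hX Ay; have {}hY := hY Ay; have {}ha := ha Ay; have {}hen := hen Ay.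
rewrite ltr_pdivlMr // in hX; rewrite ltr_pdivlMr // in hY.
have [r rE rz] := cub_perturb (ltW t0) z0E (lexx _) (ltW hX) (ltW hY).
have [zy1 zy2] := zP y Ay.
suff -> : z y = r by exact: le_lt_trans rz t1.
have ly := lt y Ay.
apply: (uni y) => //; first exact: le_trans zy2 (ltW ly).
have h1 := cabs_tri r (a y) (z x).
have h2 := cabs_tri (z x) (a y) (a x).
move: hen; rewrite ltr_norml (cabsB (a y)) in ha * => /andP[hen _].
move: (cabs (r - a y)) (cabs (r - z x)) (cabs (z x - a y)) (cabs (z x - a x)) (cabs (a x - a y)) h1 h2 rz z0a ha => *.
lra.
Qed.

Lemma conton_pair {T U V : topologicalType} (A : set T) (f : T -> U) (g : T -> V) :
  conton A f -> conton A g -> conton A (fun x => (f x, g x)).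
Proof.
move=> cf cg x Ax W [[W1 W2] /= [h1 h2] h].
apply: (@filterS2 _ (nbhs x) _ _ _ _ _ (cf x Ax _ h1) (cg x Ax _ h2)) => y k1 k2 Ay.
by apply: h; split; [exact: k1 | exact: k2].
Qed.

Lemma compact_bounded_above {T : topologicalType} (A : set T) (f : T -> R) :
  compact A -> conton A f -> exists2 M : R, 1 <= M & forall x, A x -> f x <= M.
Proof.
move=> /compact_near_coveringP cA cf.
have : \forall n \near \oo, A `<=` (fun x => A x -> f x <= n%:R).
  apply: (cA _ _ (fun n x => A x -> f x <= n%:R)) => x Ax.
  have h := contonR cf Ax ltr01.
  exists ((fun y => A y -> `|f y - f x| < 1), [set n | f x + 1 <= n%:R]).
    split=> //=; exact: nbhs_infty_ger.
  move=> [y n] /= [h1 h2] Ay; apply: le_trans h2.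
  by move: (h1 Ay); rewrite ltr_norml => /andP[_]; lra.
move=> [n _ /(_ n.+1 (leqnSn n)) h]; exists n.+1%:R => [|x Ax]; last exact: h.
by rewrite ler1n.
Qed.

(** The old root serves as approximate root: a new root lies within [d] of it, and two of them
    within [2 * d] would be closer together than [cub_separated] allows. *)
Lemma root_step {T : topologicalType} (A : set T) (X Y X' Y' z : T -> C) (M d m : R) :
  0 < d -> 1 <= M -> 117 * M ^+ 4 * (4 * d) ^+ 2 < 4 * m ->
  conton A X' -> conton A Y' ->
  (forall x, A x -> [/\ cabs (X x) <= M, cabs (Y x) <= M, cabs (X' x) <= M,
    cabs (Y' x) <= M & m <= cabs (X' x ^+ 3 - Y' x ^+ 2)]) ->
  (forall x, A x -> cabs (X' x - X x) * (6 * (3 * M + 1)) <= d ^+ 3 /\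
    cabs (Y' x - Y x) * 4 <= d ^+ 3) ->
  root_section A X Y z -> exists z', root_section A X' Y' z'.
Proof.
move=> d0 M1 dm cX cY bd near [cz zE].
have cd : conton A (fun _ : T => 2 * d) by apply: conton_at => x _; exact: cst_continuous.
have [||x r s Ax hr hs ra sa|z' h _] := select_root (d := fun=> d) cX cY cz cd.
- by move=> x _; lra.
- move=> x Ax; have [hX hY _ _ _] := bd x Ax; have [nX nY] := near x Ax.
  exact: cub_perturb (ltW d0) (zE x Ax) (cub_bound M1 hX hY (zE x Ax)) nX nY.
- have [_ _ hX hY hm] := bd x Ax.
  apply: contrapT => rs; have := cub_separated M1 hX hY hr hs rs hm.
  apply/negP; rewrite -ltNge; apply: le_lt_trans dm.
  have M4 : 0 <= 117 * M ^+ 4 by rewrite mulr_ge0 // exprn_ge0 //; lra.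
  apply: (ler_wpM2l M4); rewrite ler_pXn2r ?nnegrE ?cabs_ge0 //; last by lra.
  by have := cabs_tri r s (z x); rewrite (cabsB (z x)); lra.
- by exists z'.
Qed.

(** By compactness the discriminant is bounded away from zero, so one [d] suits every application of
    [root_step]; the existence of a continuous root is then locally constant in the stage. *)
Lemma root_homotopy (s0 : R) (X Y : R * C -> C) : s0 <= 1 ->
  conton (`[s0, 1]%classic `*` circle) X -> conton (`[s0, 1]%classic `*` circle) Y ->
  (forall q, (`[s0, 1]%classic `*` circle) q -> X q ^+ 3 != Y q ^+ 2) ->
  (exists z, root_section circle (fun w => X (s0, w)) (fun w => Y (s0, w)) z) ->
  exists z, root_section circle (fun w => X (1, w)) (fun w => Y (1, w)) z.
Proof.
move=> s01 cX cY XY; set K := (_ `*` _) in cX cY XY.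
have cK : compact K by apply: compact_setX; [exact: segment_compact | exact: compact_circle].
have cabsK (f : R * C -> C) : conton K f -> conton K (fun q => cabs (f q)).
  move=> cf; apply: (conton_comp (B := setT) (g := @cabs R) cf) => //.
  by apply: conton_at => z _; exact: cont_cabs.
have [M1 M11 hM1] := compact_bounded_above cK (cabsK _ cX).
have [M2 M21 hM2] := compact_bounded_above cK (cabsK _ cY).
have cD : conton K (fun q => (cabs (X q ^+ 3 - Y q ^+ 2))^-1).
  apply: (conton_comp (B := [set q : C * C | q.1 ^+ 3 != q.2 ^+ 2])
    (g := fun q : C * C => (cabs (q.1 ^+ 3 - q.2 ^+ 2))^-1) (conton_pair cX cY)) => //.
  apply: conton_at => q qD.
  apply: (@cvgV _ _ (nbhs q)); first by rewrite cabs_eq0 subr_eq0.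
  apply: (@cvg_cabs _ (nbhs q)).
  apply: (@cvgB _ _ _ (nbhs q)); apply: (@cvg_exp _ _ (nbhs q)).
    exact: (@cvgQ_fst _ _ (nbhs q) _ _ _ (@cvg_id _ (nbhs q))).
  exact: (@cvgQ_snd _ _ (nbhs q) _ _ _ (@cvg_id _ (nbhs q))).
have [M3 M31 hM3] := compact_bounded_above cK cD.
have [M [M_1 M_X M_Y]] : exists M, [/\ 1 <= M, forall q, K q -> cabs (X q) <= M &
    forall q, K q -> cabs (Y q) <= M].
  exists (M1 + M2); split; first by lra.
  - by move=> q /hM1; lra.
  - by move=> q /hM2; lra.
have [m m0 mD] : exists2 m, 0 < m & forall q, K q -> m <= cabs (X q ^+ 3 - Y q ^+ 2).
  exists M3^-1 => [|q Kq]; first by rewrite invr_gt0; lra.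
  have c0 : 0 < cabs (X q ^+ 3 - Y q ^+ 2).
    by rewrite lt_neqAle cabs_ge0 andbT eq_sym cabs_eq0 subr_eq0 XY.
  by rewrite -[leRHS]invrK lef_pV2 ?posrE ?invr_gt0 ?hM3 //; lra.
have M4 : 0 < 117 * M ^+ 4 by rewrite mulr_gt0 // exprn_gt0 //; lra.
have [d d0 dm] : exists2 d : R, 0 < d & 117 * M ^+ 4 * (4 * d) ^+ 2 < 4 * m.
  move: (117 * M ^+ 4) M4 => k k0.
  exists (Num.min 1 (m / (8 * k))); first by rewrite lt_min ltr01 divr_gt0 ?mulr_gt0.
  have u1 : Num.min 1 (m / (8 * k)) <= 1 by rewrite ge_min lexx.
  have u2 : Num.min 1 (m / (8 * k)) <= m / (8 * k) by rewrite ge_min lexx orbT.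
  have u0 : 0 < Num.min 1 (m / (8 * k)) by rewrite lt_min ltr01 divr_gt0 ?mulr_gt0.
  move: (Num.min _ _) u0 u1 u2 => u u0 u1; rewrite ler_pdivlMr ?mulr_gt0 // => u2.
  have : u * u <= u by rewrite ler_piMl // ltW.
  move=> uu; have : k * (u * u) <= k * u by rewrite ler_wpM2l // ltW.
  rewrite exprMn; lra.
have d3 : 0 < d ^+ 3 by rewrite exprn_gt0.
have near_slice (F : R * C -> C) (k s : R) : conton K F -> 0 < k -> s0 <= s <= 1 ->
    \forall t \near s, s0 <= t <= 1 -> forall w, circle w ->
      cabs (F (t, w) - F (s, w)) * k <= d ^+ 3.
  move=> cF k0 hs; have /compact_near_coveringP cC := @compact_circle R.
  have : \forall t \near s, circle `<=` (fun w => circle w -> s0 <= t <= 1 ->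
      cabs (F (t, w) - F (s, w)) * k <= d ^+ 3).
    apply: (cC R (nbhs s) (fun t w => circle w -> s0 <= t <= 1 ->
      cabs (F (t, w) - F (s, w)) * k <= d ^+ 3)) => w cw.
    have Ksw : K (s, w) by split => //=; rewrite in_itv.
    have e0 : 0 < d ^+ 3 / k / 2 by rewrite !divr_gt0.
    have [[A B] /= [hA hB] h] := contonC cF Ksw e0.
    exists (B, A `&` [set t | True]) => /=; first by split=> //; exact: filterI hA filterT.
    move=> [w' t] /= [Bw [At _]] cw' ht.
    have Kt : K (t, w') by split => //=; rewrite in_itv.
    have Ks : K (s, w') by split => //=; rewrite in_itv.
    have h1 : cabs (F (t, w') - F (s, w)) < d ^+ 3 / k / 2 by apply: (h (t, w')).
    have h2 : cabs (F (s, w') - F (s, w)) < d ^+ 3 / k / 2.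
      apply: (h (s, w')) => //; split => //=; exact: nbhs_singleton hA.
    rewrite -ler_pdivlMr //; have := cabs_tri (F (t, w')) (F (s, w')) (F (s, w)).
    by rewrite (cabsB (F (s, w))); lra.
  by apply: (@filterS _ (nbhs s)) => t h ht w cw; exact: h.
pose good s := exists z, root_section circle (fun w => X (s, w)) (fun w => Y (s, w)) z.
have slice (F : R * C -> C) s : conton K F -> s0 <= s <= 1 -> conton circle (fun w => F (s, w)).
  move=> cF hs; apply: (conton_comp (B := K) (f := fun w : C => (s, w)) (g := F)) => //.
    by apply: conton_pair; apply: conton_at => w _ //; exact: cst_continuous.
have move_good s t : s0 <= s <= 1 -> s0 <= t <= 1 ->
    (forall w, circle w -> cabs (X (t, w) - X (s, w)) * (6 * (3 * M + 1)) <= d ^+ 3) ->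
    (forall w, circle w -> cabs (Y (t, w) - Y (s, w)) * 4 <= d ^+ 3) -> good s -> good t.
  move=> hs ht hX hY [z zs].
  have Kc u w : s0 <= u <= 1 -> circle w -> K (u, w) by move=> hu cw; split => //=; rewrite in_itv.
  apply: (root_step d0 M_1 dm (slice X t cX ht) (slice Y t cY ht) _ _ zs) => w cw.
    by split; [apply: M_X|apply: M_Y|apply: M_X|apply: M_Y|apply: mD]; exact: Kc.
  by split; [exact: hX | exact: hY].
have M0 : 0 < 6 * (3 * M + 1) by lra.
have local s : s0 <= s <= 1 -> \forall t \near s, s0 <= t <= 1 -> (good t <-> good s).
  move=> hs; have nX := near_slice X _ s cX M0 hs; have nY := near_slice Y _ s cY (ltr0n R 4) hs.
  apply: (@filterS2 _ (nbhs s) _ _ _ _ _ nX nY) => t hX hY ht.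
  split; apply: move_good => //; try by [exact: hX | exact: hY].
    by move=> w cw; rewrite cabsB; exact: hX.
  by move=> w cw; rewrite cabsB; exact: hY.
move=> g0; apply: contrapT => g1.
(* The indicator of the good stages is continuous on the interval, so it cannot pass from 1 to 0. *)
pose phi (s : R) : R := if `[< good s >] then 1 else 0.
have phi0 : phi s0 = 1 by rewrite /phi asboolT.
have phi1 : phi 1 = 0 by rewrite /phi asboolF.
have cphi : {within `[s0, 1], continuous phi}.
  apply/contonP => s; rewrite /= in_itv /= => hs W hW.
  apply: (@filterS _ (nbhs s) _ _ _ _ (local s hs)) => t h ht.
  have -> : phi t = phi s by rewrite /phi; congr (if _ then _ else _); apply: asbool_equiv_eq; exact: h.
  exact: nbhs_singleton hW.
have [] := @IVT R phi s0 1 2^-1 s01 cphi.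
  by rewrite phi0 phi1 ge_min le_max invr_ge0 ler0n orbT /= invf_le1 // ler1n.
move=> c _; rewrite /phi; case: ifP => _ /eqP; first by rewrite eq_sym invr_eq1 pnatr_eq1.
by rewrite eq_sym invr_eq0 pnatr_eq0.
Qed.

(** The cube roots of a nonzero number are isolated from each other, and the image of [A] is
    connected. *)
Lemma cube_constant {T : topologicalType} (A : set T) (u : T -> C) (c : C) :
  connected A -> conton A u -> c != 0 -> (forall x, A x -> u x ^+ 3 = c) ->
  forall x y, A x -> A y -> u x = u y.
Proof.
move=> cA /contonP cu c0 uE x y Ax Ay.
have cI := connected_continuous_connected cA cu.
have ux0 : 0 < cabs (u x).
  rewrite lt_neqAle cabs_ge0 andbT eq_sym cabs_eq0; apply/eqP => h.
  by move/eqP: c0; apply; rewrite -(uE x Ax) h expr0n.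
have sep v : v ^+ 3 = c -> cabs (v - u x) < cabs (u x) -> v = u x.
  move=> vE lt; apply: contrapT => /eqP; rewrite -subr_eq0 => vu.
  have E : v ^+ 2 + v * u x + u x ^+ 2 = 0.
    apply: (mulfI vu); rewrite mulr0; apply/eqP; rewrite -(subr_eq0 _ 0) subr0; apply/eqP.
    have -> : (v - u x) * (v ^+ 2 + v * u x + u x ^+ 2) = v ^+ 3 - u x ^+ 3 by ring.
    by rewrite vE uE // subrr.
  have vn : cabs v = cabs (u x).
    apply/eqP; rewrite -(@eqrXn2 _ 3) ?cabs_ge0 // -!cabsX vE uE //.
  have : (v - u x) ^+ 2 = - (3 * v * u x).
    have -> : (v - u x) ^+ 2 = v ^+ 2 + v * u x + u x ^+ 2 - 3 * v * u x by ring.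
    by rewrite E add0r.
  move/(congr1 (@cabs R)); rewrite cabsN cabsX !cabsM cabs_nat vn.
  move: (cabs_ge0 (v - u x)) lt ux0; move: (cabs (v - u x)) (cabs (u x)) => a b a0 ab b0.
  have : a * a <= b * a by rewrite ler_wpM2r // ltW.
  have : b * a < b * b by rewrite ltr_pM2l.
  have : 0 < b * b by rewrite mulr_gt0.
  rewrite expr2; lra.
have B1 : exists2 D, open D & [set u x] = u @` A `&` D.
  exists [set v : C | cabs (v - u x) < cabs (u x)].
    rewrite openE => v /= hv; apply/nbhsC; exists (cabs (u x) - cabs (v - u x)).
      by rewrite subr_gt0.
    by move=> w; rewrite ltrBrDr /= => hw; exact: le_lt_trans (cabs_tri w (u x) v) hw.
  apply/seteqP; split => [v /= -> | v [[t At <-] /= h]].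
    by split; [exists x | rewrite subrr cabs0].
  by apply: sep => //; exact: uE.
have B2 : exists2 D, closed D & [set u x] = u @` A `&` D.
  exists [set u x].
    rewrite -[X in closed X]setCK; apply: open_closedC.
    rewrite openE => v /= hv; apply/nbhsC; exists (cabs (v - u x)).
      by rewrite lt_neqAle cabs_ge0 andbT eq_sym cabs_eq0 subr_eq0; apply/eqP.
    by move=> w hw /= wE; move: hw; rewrite wE cabsB ltxx.
  by apply/seteqP; split => [v /= -> | v []//]; split => //; exists x.
have := cI [set u x] (ex_intro _ (u x) erefl) B1 B2.
by move/seteqP => [_ /(_ (u y))]; move=> /(_ (ex_intro2 _ _ y Ay erefl)) /= ->.
Qed.

(** The root would satisfy [z(w)^3 = - 2 w]. For a primitive cube root of unity [g], the quotient
    [z(g w) / z(w)] has cube [g], hence is constant; its product over [w], [g w], [g^2 w] is 1, so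
    [g = 1]. *)
Lemma no_circle_root :
  ~ exists z : C -> C, root_section circle (fun=> 0) id z.
Proof.
move=> [z [cz zE]].
have {zE} zE (w : C) : circle w -> z w ^+ 3 = - (2 * w).
  by move/zE; rewrite /cub mulr0 mul0r subr0 => /eqP; rewrite addr_eq0 => /eqP.
have c0 (w : C) : circle w -> w != 0.
  by rewrite /circle /= => h; rewrite -cabs_eq0 h oner_eq0.
have z0 (w : C) : circle w -> z w != 0.
  move=> cw; apply/eqP => h; have := zE w cw; rewrite h expr0n /= => /esym/eqP.
  by rewrite oppr_eq0 mulf_eq0 pnatr_eq0 (negbTE (c0 w cw)).
have [g gE] : exists g : C, g ^+ 2 = - 1 - g.
  have [g] := @solve_monicpoly R[i] 2 (nth 0 [:: - 1; - 1]) isT.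
  rewrite !big_ord_recr big_ord0 /= add0r expr0 expr1 mulr1 => E.
  by exists g; rewrite E mulN1r.
have g3 : g ^+ 3 = 1 by rewrite exprS gE mulrBr -expr2 gE; ring.
have g1 : g != 1.
  apply/eqP => h; move/eqP: gE; rewrite h expr1n -subr_eq0.
  have -> : 1 - (- 1 - 1) = 3 :> C by ring.
  by rewrite pnatr_eq0.
have cg : cabs g = 1.
  by apply/eqP; rewrite -(@eqrXn2 _ 3) ?cabs_ge0 // -cabsX g3 cabs1 expr1n.
have cM (w : C) : circle w -> circle (g * w) by rewrite /circle /= cabsM cg mul1r.
have cu : conton circle (fun w => z (g * w) / z w).
  have c1 : conton circle (fun w => z (g * w)).
    have cg' : conton circle (fun w : C => g * w).
      apply: conton_at => w _; apply: (@contC_lip R (fun w => g * w)) => v v'.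
      by rewrite -mulrBr cabsM cg mul1r.
    exact: (conton_comp cg' cz cM).
  have c2 := conton_pair c1 cz.
  have c3 : conton [set q : C * C | q.2 != 0] (fun q : C * C => q.1 / q.2).
    apply: conton_at => q q0.
    have h1 : (fun q : C * C => q.1) @ nbhs q --> q.1.
      exact: (@cvgQ_fst R _ (nbhs q) _ _ _ (@cvg_id _ (nbhs q))).
    have h2 : (fun q : C * C => q.2) @ nbhs q --> q.2.
      exact: (@cvgQ_snd R _ (nbhs q) _ _ _ (@cvg_id _ (nbhs q))).
    have h3 : (fun q : C * C => q.2^-1) @ nbhs q --> q.2^-1 by apply: cvgV.
    exact: (cvgM h1 h3).
  exact: (conton_comp c2 c3 z0).
have g0 : g != 0 by rewrite -cabs_eq0 cg oner_eq0.
have uE (w : C) : circle w -> (z (g * w) / z w) ^+ 3 = g.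
  move=> cw; rewrite exprMn exprVn (zE w cw) (zE _ (cM w cw)).
  by have := c0 w cw; move=> w0; field.
have k := cube_constant (@connected_circle R) cu g0 uE.
have C1 : circle (1 : C) by rewrite /circle /= cabs1.
have e1 := k _ _ (cM _ C1) C1; have e2 := k _ _ (cM _ (cM _ C1)) C1.
move: e1 e2; have -> : g * (g * (g * 1)) = 1 by rewrite -[RHS]g3; ring.
have := uE _ C1.
rewrite mulr1; have := z0 _ C1; have := z0 _ (cM _ C1); have := z0 _ (cM _ (cM _ C1)); rewrite mulr1.
 move: (z 1) (z g) (z (g * g)) => a b c c_0 b_0 a_0 h e1 e2.
move/eqP: g1; apply; rewrite -h.
have -> : (b / a) ^+ 3 = (b / a) * (b / a) * (b / a) by ring.
by rewrite -{1}e2 -{1}e1; field; rewrite a_0 b_0 c_0.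
Qed.

End root_sections.

(** * Wildness *)

Section fold_map.
Context {R : realType} (S : ball_system R).
Local Notation C := (Cx R).
Local Notation Q := (C * C)%type.
Implicit Types (i j n : nat) (x y p q : Q) (a b : seq nat).
Local Notation r := (br S).
Local Notation c := (bc S).
Local Notation rad := (rad S).
Local Notation refl := (refl S).
Local Notation lam := (lam S).
Local Notation fund := (fund S).
Local Notation wact := (wact S).

Lemma center_lam i : lam (c i).
Proof. by exists (bt S i); rewrite ?limap_center. Qed.

Lemma cont_refl i x : ~ lam x -> {for x, continuous (refl i)}.
Proof.
by move=> hx; apply: cont_inversion; apply/eqP => e; apply: hx; rewrite e; exact: center_lam.
Qed.

Lemma cont_wact a x : ~ lam x -> {for x, continuous (wact a)}.
Proof.
move=> hx; elim: a => [|i a IH]; first by [].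
have h : ~ lam (wact a x) by rewrite wact_lam.
move=> W hW; exact: (IH _ (@cont_refl i _ h W hW)).
Qed.

Lemma tile_unique a p q : fund p -> fund q -> wact a p = q -> p = q.
Proof.
rewrite /wact -foldr_reduce; last by move=> i; exact: reflK.
move=> hp hq E; have [a0|[i ai ip]] := fund_word (reduced_reduce a) hp hq E.
  by move: E; rewrite a0.
by rewrite -E ai /= ip.
Qed.

(** The point of the fundamental domain in the orbit of [x] is unique by [tile_unique], so the
    choice does not matter. *)
Definition fold x : Q :=
  if pselect (exists p, fund p /\ exists a, x = wact a p) is left h then projT1 (cid h)
  else x.

Lemma foldP x : ~ lam x -> fund (fold x) /\ exists a, x = wact a (fold x).
Proof.
move=> /unfold[a [p [hp _ E]]]; rewrite /fold; case: pselect => [h|[]].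
  exact: (projT2 (cid h)).
by exists p; split => //; exists a.
Qed.

Lemma fold_wact a x p : ~ lam x -> fund p -> x = wact a p -> fold x = p.
Proof.
move=> /foldP[h1 [b E]] hp E'.
apply: (@tile_unique (rev a ++ b)) => //.
rewrite /wact foldr_cat -/(wact b _) -E E' foldr_rev // => i; exact: reflK.
Qed.

Lemma fold_fund x : ~ lam x -> fund x -> fold x = x.
Proof. by move=> hx fx; exact: (@fold_wact [::]). Qed.

Lemma fold_act a x : ~ lam x -> fold (wact a x) = fold x.
Proof.
move=> hx; have [h [b E]] := foldP hx.
apply: (@fold_wact (a ++ b)) => //; first by rewrite wact_lam.
by rewrite /wact foldr_cat -/(wact b _) -E.
Qed.

Lemma fold_lam x : ~ lam x -> ~ lam (fold x).
Proof. by move=> hx; have [_ [a E]] := foldP hx; rewrite -(wact_lam S a) -E. Qed.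

Lemma near_lam x : ~ lam x -> \forall y \near x, ~ lam y.
Proof.
move=> hx; have [e e0 he] := lam_away hx; apply/nbhsQ; exists e => // y yx [t _ ft].
by move: (he t); rewrite ft nqB leNgt yx.
Qed.

(** Near [p] there are only its own tile and, if [p] lies on a sphere, the tile across it; on the
    latter [fold] is the inversion in that sphere, which fixes [p]. *)
Lemma cont_fold_fund p : fund p -> ~ lam p -> fold @ p --> p.
Proof.
move=> hp hl W hW.
have nl := near_lam hl; have nf := fund_near hp hl.
have [[i pi]|hi] := pselect (exists i, rad i p = r i); last first.
  have n1 := @filterI _ _ (nbhs_filter p) _ _ nl nf.
  apply: (@filterS2 _ (nbhs p) _ _ _ _ _ n1 hW) => y [yl yf] Wy.
  rewrite /= fold_fund // => j; rewrite leNgt; apply/negP => /yf h.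
  by apply: hi; exists j.
have rp : refl i p = p by exact: refl_sphere.
have cr (A : set Q) : nbhs p A -> \forall y \near p, A (refl i y).
  by move=> hA; apply: (@cont_refl i _ hl A); rewrite rp.
have nf' : \forall y \near p, forall j, rad j (refl i y) < r j -> rad j p = r j.
  exact: (cr [set y | forall j, rad j y < r j -> rad j p = r j] nf).
have nW' : \forall y \near p, W (refl i y) by exact: cr.
have n1 := @filterI _ _ (nbhs_filter p) _ _ nl nf.
have n2 := @filterI _ _ (nbhs_filter p) _ _ nf' nW'.
have n3 := @filterI _ _ (nbhs_filter p) _ _ n1 n2.
apply: (@filterS2 _ (nbhs p) _ _ _ _ _ n3 hW) => y [[yl yf] [yf' Wy']] Wy /=.
have uni j : rad j p = r j -> j = i.
  by move=> jp; apply: (@ball_uniq _ S j i p); [rewrite jp | rewrite pi].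
have [fy|fy] := pselect (fund y); first by rewrite fold_fund.
have [j yj] : exists j, rad j y < r j.
  by apply: contrapT => h; apply: fy => j; rewrite leNgt; apply/negP => hj; apply: h; exists j.
have {}yj : rad i y < r i by rewrite -(uni j (yf j yj)).
have yc : y != c i by apply/eqP => e; apply: yl; rewrite e; exact: center_lam.
have fz : fund (refl i y).
  move=> m; rewrite leNgt; apply/negP => hm; have em := uni m (yf' m hm).
  by move: hm; rewrite em ltNge; apply/negP; rewrite negbK; exact: ltW (refl_in yc yj).
by rewrite (@fold_wact [:: i] y (refl i y)) //= reflK.
Qed.

Lemma cont_fold x : ~ lam x -> {for x, continuous fold}.
Proof.
move=> hx; have [hf [a E]] := foldP hx.
have hl := fold_lam hx.
have Ea : wact (rev a) x = fold x by rewrite {1}E !wactE foldr_rev // => i; exact: reflK.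
move=> W hW; have h := cont_fold_fund hf hl hW.
have h2 : \forall y \near x, W (fold (wact (rev a) y)).
  by apply: (@cont_wact (rev a) x hx (fold @^-1` W)); rewrite Ea; exact: h.
apply: (@filterS2 _ (nbhs x) _ _ _ _ _ (near_lam hx) h2) => y yl.
by rewrite fold_act.
Qed.

End fold_map.

(** * Collapsing the first ball into a neighbourhood of a smooth arc *)

Section collapse.
Context {R : realType} (S : ball_system R).
Local Notation C := (Cx R).
Local Notation Q := (C * C)%type.
Implicit Types (i j n : nat) (x y p q : Q) (a b : seq nat).
Local Notation r := (br S).
Local Notation rad := (rad S).
Local Notation lam := (lam S).
Local Notation fund := (fund S).
Local Notation fold := (fold S).

Definition disc q : C := q.1 ^+ 3 - q.2 ^+ 2.

(** The zeros of [disc] form the cuspidal curve, whose part in the fundamental domain belongs to the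
    limit set. *)
Lemma disc_neq0 p : fund p -> ~ lam p -> disc p != 0.
Proof.
move=> hp hl; apply/negP; rewrite subr_eq0 => /eqP E; apply: hl.
have [t pE] : exists t, p = cusp t.
  have [p1|p1] := eqVneq p.1 0.
    exists 0; move: E; rewrite p1 expr0n /= => /esym/eqP; rewrite sqrf_eq0 => /eqP p2.
    by rewrite [LHS]surjective_pairing p1 p2 /cusp !expr0n.
  exists (p.2 / p.1); rewrite [LHS]surjective_pairing; congr pair.
    by rewrite expr_div_n -E exprS mulfK // expf_neq0.
  have -> : (p.2 / p.1) ^+ 3 = p.2 * p.2 ^+ 2 / p.1 ^+ 3 by rewrite expr_div_n exprS.
  by rewrite -E mulfK // expf_neq0.
by rewrite pE; apply: cusp_fund_lam; rewrite -pE.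
Qed.

Definition slope q : C := q.2 / q.1.
(** On the sphere, where [fold] is the identity, this equals [q.1 - slope q ^+ 2]. Inside the ball
    it provides a continuous extension without zeros off the limit set. *)
Definition dratio q : C := disc (fold q) / q.1 ^+ 2.
Definition bnd q : R := cabs (slope q) ^+ 2 / 64.
(** [dratio] shortened to length at most [bnd], with its argument kept; on the sphere [b_local] says
    that nothing has to be cut. *)
Definition trim q : C := dratio q * rc (Num.min 1 (bnd q / cabs (dratio q))).
Definition coll q : Q :=
  (slope q ^+ 2 + trim q, slope q * (slope q ^+ 2 + trim q)).
(* For [x = s^2, y = s^3] the cubic [z^3 - 3 x z + 2 y] has the double root [s] and
   the simple root [- 2 s], which persists for the small perturbation [trim]; the
   latter never vanishes and makes [coll] the identity on the sphere. *)
Definition unwind q : Q := if rad 0 q <= r 0 then coll q else fold q.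

Lemma bnd_ge0 q : 0 <= bnd q.
Proof. by rewrite divr_ge0 ?exprn_ge0 ?cabs_ge0. Qed.

Lemma trim_le q : cabs (trim q) <= bnd q.
Proof.
rewrite /trim cabsM cabs_rc.
have [e0|e0] := eqVneq (dratio q) 0; first by rewrite e0 cabs0 mul0r bnd_ge0.
have c0 : 0 < cabs (dratio q) by rewrite lt_neqAle cabs_ge0 andbT eq_sym cabs_eq0.
rewrite ger0_norm; last by rewrite le_min ler01 divr_ge0 ?bnd_ge0 ?cabs_ge0.
by rewrite -ler_pdivlMl // [leRHS]mulrC ge_min lexx orbT.
Qed.

Lemma slope_gt0 q : rad 0 q <= r 0 -> 0 < cabs (slope q).
Proof.
move=> /b_local[h1 h2 _]; rewrite lt_neqAle cabs_ge0 andbT eq_sym cabs_eq0.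
by rewrite mulf_neq0 ?invr_eq0.
Qed.

Lemma dratio_neq0 q : ~ lam q -> rad 0 q <= r 0 -> dratio q != 0.
Proof.
move=> hl /b_local[h1 _ _]; rewrite mulf_neq0 ?invr_eq0 ?expf_neq0 //.
by apply: disc_neq0; [case: (foldP hl) | exact: fold_lam].
Qed.

Lemma trim_neq0 q : ~ lam q -> rad 0 q <= r 0 -> trim q != 0.
Proof.
move=> hl hq; have e0 := dratio_neq0 hl hq; rewrite mulf_neq0 // rc_eq0 gt_eqF //.
have c0 : 0 < cabs (dratio q) by rewrite lt_neqAle cabs_ge0 andbT eq_sym cabs_eq0.
by rewrite lt_min ltr01 !divr_gt0 // exprn_gt0 // slope_gt0.
Qed.

Lemma coll_disc q : ~ lam q -> rad 0 q <= r 0 -> disc (coll q) != 0.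
Proof.
move=> hl hq; have -> : disc (coll q) = (slope q ^+ 2 + trim q) ^+ 2 * trim q.
  by rewrite /disc /=; ring.
rewrite mulf_neq0 ?trim_neq0 // expf_neq0 // addr_eq0; apply/eqP => /(congr1 (@cabs R)).
rewrite cabsX cabsN => E; have := trim_le q; rewrite -E /bnd.
have : 0 < cabs (slope q) ^+ 2 by rewrite exprn_gt0 // slope_gt0.
by move: (_ ^+ 2) => u; lra.
Qed.

Lemma sphere_fund q : rad 0 q = r 0 -> fund q.
Proof.
move=> hq j; have [->|j0] := eqVneq j 0%N; first by rewrite hq.
by apply: ltW; apply: (ball_disjoint j0); rewrite hq.
Qed.

Lemma coll_sphere q : ~ lam q -> rad 0 q = r 0 -> coll q = q.
Proof.
move=> hl hq; have hq' : rad 0 q <= r 0 by rewrite hq.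
have [h1 h2 h3] := b_local hq'.
have E : dratio q = q.1 - slope q ^+ 2.
  rewrite /dratio (fold_fund hl (sphere_fund hq)) /disc /slope expr_div_n mulrBl; congr (_ - _).
  by rewrite exprS mulfK // expf_neq0.
have d0 : 0 < cabs (dratio q).
  by rewrite lt_neqAle cabs_ge0 andbT eq_sym cabs_eq0 dratio_neq0 // hq.
have -> : coll q = (q.1, slope q * q.1); last by rewrite /slope divfK // -surjective_pairing.
have tE : trim q = q.1 - slope q ^+ 2.
  rewrite /trim E min_l ?mulr1 //; first by rewrite -E ler_pdivlMr // mul1r E.
by rewrite /coll tE addrC subrK.
Qed.

Lemma cont_slope q : q.1 != 0 -> slope @ nbhs q --> slope q.
Proof.
move=> q0; have h1 : (fun q : Q => q.1) @ nbhs q --> q.1.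
  exact: (@cvgQ_fst R _ (nbhs q) _ _ _ (@cvg_id _ (nbhs q))).
have h2 : (fun q : Q => q.2) @ nbhs q --> q.2.
  exact: (@cvgQ_snd R _ (nbhs q) _ _ _ (@cvg_id _ (nbhs q))).
have h3 : (fun q : Q => q.1^-1) @ nbhs q --> q.1^-1 by exact: (cvgV q0 h1).
exact: (cvgM h2 h3).
Qed.

Lemma cont_trim q : ~ lam q -> rad 0 q <= r 0 -> trim @ nbhs q --> trim q.
Proof.
move=> hl hq; have [q0 _ _] := b_local hq.
have h1 : (fun q : Q => q.1) @ nbhs q --> q.1.
  exact: (@cvgQ_fst R _ (nbhs q) _ _ _ (@cvg_id _ (nbhs q))).
have hf := @cont_fold R S q hl.
have f1 : (fun q : Q => (fold q).1) @ nbhs q --> (fold q).1.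
  exact: (@cvgQ_fst R _ (nbhs q) _ _ _ hf).
have f2 : (fun q : Q => (fold q).2) @ nbhs q --> (fold q).2.
  exact: (@cvgQ_snd R _ (nbhs q) _ _ _ hf).
have hd : dratio @ nbhs q --> dratio q.
  have k1 : (fun q : Q => disc (fold q)) @ nbhs q --> disc (fold q).
    have g1 := @cvg_exp R _ _ (nbhs_filter q) _ _ 3 f1.
    have g2 := @cvg_exp R _ _ (nbhs_filter q) _ _ 2 f2.
    rewrite /disc; exact: (cvgB g1 g2).
  have k2 : (fun q : Q => (q.1 ^+ 2)^-1) @ nbhs q --> (q.1 ^+ 2)^-1.
    have q02 : q.1 ^+ 2 != 0 by rewrite expf_neq0.
    have g1 := @cvg_exp R _ _ (nbhs_filter q) _ _ 2 h1.
    exact: (cvgV q02 g1).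
  exact: (cvgM k1 k2).
have c0 : cabs (dratio q) != 0 by rewrite cabs_eq0 dratio_neq0.
have hc := @cvg_cabs R _ _ (nbhs_filter q) _ _ hd.
have hs := @cvg_cabs R _ _ (nbhs_filter q) _ _ (cont_slope q0).
have hb : bnd @ nbhs q --> bnd q.
  apply: (@cvgM _ _ (nbhs q)); last exact: cvg_cst.
  exact: (cvg_comp _ _ hs (@exprn_continuous R 2 (cabs (slope q)))).
have hv : (fun q => bnd q / cabs (dratio q)) @ nbhs q --> bnd q / cabs (dratio q).
  have hi := @cvgV _ _ _ (nbhs_filter q) _ _ c0 hc.
  exact: (cvgM hb hi).
have hm : (fun q => Num.min 1 (bnd q / cabs (dratio q))) @ nbhs q -->
    Num.min 1 (bnd q / cabs (dratio q)).
  by apply: (@continuous_min R Q (fun=> 1) (fun q => bnd q / cabs (dratio q)) q) => //; exact: cvg_cst.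
have hr := cvg_comp _ _ hm (@continuous_rc R (Num.min 1 (bnd q / cabs (dratio q)))).
exact: (cvgM hd hr).
Qed.

Lemma cont_coll q : ~ lam q -> rad 0 q <= r 0 -> coll @ nbhs q --> coll q.
Proof.
move=> hl hq; have [q0 _ _] := b_local hq.
have h1 := cont_slope q0; have h2 := cont_trim hl hq.
have h3 : (fun q => slope q ^+ 2 + trim q) @ nbhs q --> slope q ^+ 2 + trim q.
  have g1 := @cvg_exp R _ _ (nbhs_filter q) _ _ 2 h1.
  exact: (cvgD g1 h2).
have h4 := @cvgM _ _ _ (nbhs_filter q) _ _ _ _ h1 h3.
exact: (@cvgQ_pair R _ (nbhs q) _ _ _ _ _ h3 h4).
Qed.

Lemma cont_unwind q : ~ lam q -> {for q, continuous unwind}.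
Proof.
move=> hl; have hf := @cont_fold R S q hl.
have cr := @cont_rad R S 0 q.
case: (ltgtP (rad 0 q) (r 0)) => hq W hW.
- have E : unwind q = coll q by rewrite /unwind (ltW hq).
  rewrite E in hW; have h := cont_coll hl (ltW hq) hW.
  apply: (@filterS2 _ (nbhs q) _ _ _ _ _ (near_lt cr hq) h) => y yr hy.
  by rewrite /= /unwind (ltW yr).
- have E : unwind q = fold q by rewrite /unwind leNgt hq.
  rewrite E in hW.
  apply: (@filterS2 _ (nbhs q) _ _ _ _ _ (near_gt cr hq) (hf _ hW)) => y yr hy.
  by rewrite /= /unwind leNgt yr.
- have hq' : rad 0 q <= r 0 by rewrite hq.
  have E : unwind q = coll q by rewrite /unwind hq'.
  rewrite E in hW; have h := cont_coll hl hq' hW.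
  have hW' : nbhs (fold q) W.
    by rewrite (fold_fund hl (sphere_fund hq)) -(coll_sphere hl hq).
  apply: (@filterS2 _ (nbhs q) _ _ _ _ _ h (hf _ hW')) => y h1 h2.
  by rewrite /= /unwind; case: ifP.
Qed.

Lemma unwind_disc q : ~ lam q -> disc (unwind q) != 0.
Proof.
move=> hl; rewrite /unwind; case: ifP => hq; first exact: coll_disc.
by apply: disc_neq0; [case: (foldP hl) | exact: fold_lam].
Qed.

Lemma unwind_0w (w : C) : ~ lam (0, w) -> unwind (0, w) = (0, w).
Proof.
move=> hl; rewrite /unwind; case: ifP => [/b_local[]|_]; first by rewrite eqxx.
by rewrite fold_fund //; exact: fund0w.
Qed.

(** The simple root near [- 2 s], with [s] the slope, is followed. There the cubic has the value
    [8 s t], with [t] the trim, and the bound by [cabs s ^+ 2 / 64] makes this at most the cube of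
    [cabs s / 2]. *)
Lemma ball_root : exists z : Q -> C,
  root_section [set q | ~ lam q /\ rad 0 q <= r 0]
    (fun q => (unwind q).1) (fun q => (unwind q).2) z.
Proof.
set A := (X in root_section X).
have cu : conton A unwind by apply: conton_at => q [hq _]; exact: cont_unwind.
have c1 : conton A (fun q => (unwind q).1).
  apply: conton_at => q [hq _]; exact: (@cvgQ_fst R _ (nbhs q) _ _ _ (cont_unwind hq)).
have c2 : conton A (fun q => (unwind q).2).
  apply: conton_at => q [hq _]; exact: (@cvgQ_snd R _ (nbhs q) _ _ _ (cont_unwind hq)).
have ca : conton A (fun q => - (2 * slope q)).
  apply: conton_at => q [_ /b_local[q0 _ _]].
  apply: (@cvgN _ _ _ (nbhs q)); apply: (@cvgM _ _ (nbhs q)); first exact: cvg_cst.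
  exact: cont_slope.
have ce : conton A (fun q => 3 / 5 * cabs (slope q)).
  apply: conton_at => q [_ /b_local[q0 _ _]].
  apply: (@cvgM _ _ (nbhs q)); first exact: cvg_cst.
  exact: (@cvg_cabs R _ (nbhs q) _ _ _ (cont_slope q0)).
have [||q z w [hl hq]|z hz _] := select_root (d := fun q => cabs (slope q) / 2) c1 c2 ca ce.
- by move=> q [_ /slope_gt0]; lra.
- move=> q [hl hq]; rewrite /unwind hq /=; have s0 := slope_gt0 hq.
  have := trim_le q; rewrite /bnd.
  move: (slope q) (trim q) s0 => s t s0 ht; apply: cub_near.
    by move: s0; move: (cabs s) => v; lra.
  have -> : cub (s ^+ 2 + t) (s * (s ^+ 2 + t)) (- (2 * s)) = 8 * (s * t).
    by rewrite /cub; ring.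
  rewrite (cabsM 8) (cabsM s) cabs_nat; move: (cabs s) (cabs t) s0 ht => v u v0 ht.
  have : v * u <= v * (v ^+ 2 / 64) by rewrite ler_wpM2l // ltW.
  by rewrite exprMn !exprS expr0; lra.
- rewrite /unwind hq /=; have s0 := slope_gt0 hq; have ht := trim_le q; move: ht; rewrite /bnd.
  move: (slope q) (trim q) s0 => s t s0 ht hz hw za wa.
  apply: contrapT => zw; have := cub_two_roots hz hw zw.
  have sn0 : s != 0 by rewrite -cabs_eq0 gt_eqF.
  pose a := z / s + 2; pose b := w / s + 2.
  have za' : cabs a <= 3 / 5.
    have -> : a = (z - - (2 * s)) / s by rewrite /a; field.
    by rewrite cabsM cabsV ler_pdivrMr.
  have wb' : cabs b <= 3 / 5.
    have -> : b = (w - - (2 * s)) / s by rewrite /b; field.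
    by rewrite cabsM cabsV ler_pdivrMr.
  have tt : cabs (t / s ^+ 2) <= 64^-1.
    by rewrite cabsM cabsV cabsX ler_pdivrMr ?exprn_gt0 // mulrC.
  move=> E.
  (* With [z = s (a - 2)] and [w = s (b - 2)] this is [cub_two_roots]. For offsets of modulus at
     most 3/5 the right side is at most 7.2 + 1.08 + 3/64, which is less than 9. *)
  have K : 9 = 6 * (a + b) + - (a ^+ 2 + a * b + b ^+ 2) + 3 * (t / s ^+ 2).
    have -> : 3 * (t / s ^+ 2) = (z ^+ 2 + z * w + w ^+ 2) / s ^+ 2 - 3 by rewrite E; field.
    by rewrite /a /b; field.
  have aa : cabs a * cabs a <= 3 / 5 * (3 / 5) by rewrite ler_pM ?cabs_ge0.
  have ab : cabs a * cabs b <= 3 / 5 * (3 / 5) by rewrite ler_pM ?cabs_ge0.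
  have bb : cabs b * cabs b <= 3 / 5 * (3 / 5) by rewrite ler_pM ?cabs_ge0.
  have k1 : 9 <= cabs (6 * (a + b) - (a ^+ 2 + a * b + b ^+ 2)) + 3 * cabs (t / s ^+ 2).
    have := cabsD (6 * (a + b) - (a ^+ 2 + a * b + b ^+ 2)) (3 * (t / s ^+ 2)).
    by rewrite -K (cabsM 3) !cabs_nat.
  have k2 : cabs (6 * (a + b) - (a ^+ 2 + a * b + b ^+ 2)) <=
      6 * (cabs a + cabs b) + cabs (a ^+ 2 + a * b + b ^+ 2).
    apply: (le_trans (cabsD _ _)); rewrite cabsN (cabsM 6) cabs_nat lerD2r.
    by rewrite ler_pM2l //; exact: cabsD.
  have k3 : cabs (a ^+ 2 + a * b + b ^+ 2) <= cabs a * cabs a + cabs a * cabs b + cabs b * cabs b.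
    by rewrite -!cabsM -!expr2; apply: (le_trans (cabsD _ _)); rewrite lerD2r; exact: cabsD.
  move: k1 k2 k3 aa ab bb za' wb' tt => *; lra.
- by exists z.
Qed.

End collapse.

(** * The limit set is not tame *)

Section wildness.
Context {R : realType} (S : ball_system R).
Local Notation C := (Cx R).
Local Notation Q := (C * C)%type.
Local Notation P := (proj3 C).
Implicit Types (i j n : nat) (x p q : Q) (a b : seq nat) (w : C).
Local Notation r := (br S).
Local Notation c := (bc S).
Local Notation rad := (rad S).
Local Notation refl := (refl S).
Local Notation lam := (lam S).
Local Notation wact := (wact S).
Local Notation unwind := (unwind S).

Lemma lam_0w w : w != 0 -> ~ lam (0, w).
Proof.
move=> w0 /(lam_fund (fund0w S w))[t [h2 h3] _].
by move: w0; rewrite h3; rewrite (_ : t = 0) ?expr0n ?eqxx //; apply/eqP; rewrite -sqrf_eq0 -h2.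
Qed.

Lemma cont_refl_off i x : x != c i -> {for x, continuous (refl i)}.
Proof. exact: cont_inversion. Qed.

Lemma cvg_chain {T : topologicalType} (F : set_system T) (f g h : T -> T) (y : T) :
  f @ F --> y -> {for y, continuous g} -> {for g y, continuous h} ->
  (fun z => h (g (f z))) @ F --> h (g y).
Proof. by move=> hf hg hh W hW; apply: (hf _ (hg _ (hh _ hW))). Qed.

(** The fixed point lies on the limit set, out of reach of [cont_wact]. Its images under the letters
    alternate between [p] and [refl 0 p], which avoid the centres of the inversions applied to
    them. *)
Lemma cont_alt_fixed n p : rad 0 p < r 0 -> wact (alt 1) p = p ->
  {for p, continuous (wact (rev (alt n)))} /\ wact (rev (alt n)) p = p.
Proof.
move=> p0 E1; have E : refl 1 p = refl 0 p by rewrite -{2}E1 /= reflK.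
have p1 : r 1 < rad 1 p by apply: (@ball_disjoint _ S 1 0) => //; exact: ltW.
have pc : p != c 0.
  apply/eqP => e; move: (refl_out p1); rewrite E e refl_center -e.
  by rewrite ltNge ltW.
have E3 : refl 1 (refl 0 p) = p by rewrite -E reflK.
have qc : refl 0 p != c 1.
  by apply/eqP => e; move: E3; rewrite e refl_center => e'; move: p1; rewrite -e' rad_center ltNge (ltW (br_gt0 S 1)).
elim: n => [|n [IH1 IH2]]; first by split=> [W hW|] /=.
have -> : rev (alt n.+1) = [:: 1, 0 & rev (alt n)]%N by rewrite altS rev_cat.
have E2 : wact [:: 1, 0 & rev (alt n)]%N p = p.
  exact: (etrans (congr1 (fun x => refl 1 (refl 0 x)) IH2) E3).
split; last exact: E2.
have k1 : wact (rev (alt n)) @ nbhs p --> p by rewrite -[X in _ --> X]IH2; exact: IH1.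
have k2 := @cont_refl_off 0%N p pc.
have k3 := @cont_refl_off 1%N (refl 0 p) qc.
have k4 := cvg_chain k1 k2 k3; rewrite E3 in k4.
by move=> W; rewrite E2; exact: k4.
Qed.

Lemma lam_lift_wild : ~ tame (lam_lift S).
Proof.
move=> /tame_cone tc.
have [p [lp p0 fixp limp]] := alt_limit S.
have u0 := base_u (R := R); set u := ((1, 0) : Q) in u0.
have [U nU HU] := tc (pt p u).
have [e e0 he] : exists2 e : R, 0 < e & forall q, nq (q - p) < e -> U (pt q u).
  apply/(nbhsQ p [set q | U (pt q u)]).
  have h1 : (fun=> u) @ nbhs p --> u by exact: (@cvgQ_cst R _ _ (nbhs_filter p) u).
  have h := @cvg_pt R _ _ (nbhs_filter p) id (fun=> u) p u u0 (@cvg_id _ (nbhs p)) h1.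
  exact: (h U nU).
(* The power is chosen once [U] is known, so that the loop lies in [U]; the target of the
   contraction may then depend on the power. *)
have [n hn] := limp e e0.
have [ca wp] := cont_alt_fixed n p0 (fixp 1%N).
pose b := rev (alt n).
(* The inverse power fixes [p], which lies inside the first ball, so it carries all points near [p]
   into that ball. *)
have nW : nbhs (pt p u) [set x | finpt x /\ rad 0 (wact b (tw x)) < r 0].
  have f := finpt_pt p u0; have n1 := near_finpt f.
  have n3 : nbhs (wact b p) [set q | rad 0 q < r 0].
    by rewrite wp; exact: near_lt (@cont_rad R S 0 p) p0.
  have n4 : nbhs p [set q | rad 0 (wact b q) < r 0] by exact: (ca _ n3).
  have n5 : nbhs (tw (pt p u)) [set q | rad 0 (wact b q) < r 0] by rewrite tw_pt.
  have n2 : \forall x \near pt p u, rad 0 (wact b (tw x)) < r 0 by exact: (tw_cont f n5).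
  exact: (@filterI _ _ (nbhs_filter _) _ _ n1 n2).
have [s0 [H [s01 H1 HS HW cH]]] := HU _ nW.
have /andP[s0p s0le] := s01.
pose K (w : C) : P := pt (wact (alt n) (0, w)) u.
have cw0 w : circle w -> w != 0.
  by rewrite /circle /= => h; rewrite -cabs_eq0 h oner_eq0.
have lw w : circle w -> ~ lam (0, w) by move=> cw; exact/lam_0w/cw0.
have lK w : circle w -> ~ lam (wact (alt n) (0, w)) by move=> cw; rewrite wact_lam; exact: lw.
have UK w : circle w -> U (K w) by move=> cw; apply: he; apply: hn; exact: fund0w.
have fK w : circle w -> ~ lam_lift S (K w).
  move=> cw; apply; split; first exact: finpt_pt.
  by rewrite tw_pt //; exact: lK.
have cK : conton circle K.
  apply: conton_at => w cw.
  have h1 : (fun w : C => ((0, w) : Q)) @ nbhs w --> ((0, w) : Q).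
    apply: (@cvgQ_pair R _ (nbhs w)); [exact: cvg_cst | exact: cvg_id].
  have h2 : (fun w : C => wact (alt n) (0, w)) @ nbhs w --> wact (alt n) (0, w).
    exact: (cvg_comp _ _ h1 (@cont_wact R S (alt n) _ (lw w cw))).
  have h3 : (fun=> u) @ nbhs w --> u by exact: (@cvgQ_cst R _ _ (nbhs_filter w) u).
  exact: (@cvg_pt R _ _ (nbhs_filter w) _ _ _ _ u0 h2 h3).
have cHK : conton (`[s0, 1]%classic `*` circle) (fun z : R * C => H z.1 (K z.2)).
  have c1 : conton (`[s0, 1]%classic `*` circle) (fun z : R * C => z.1).
    by apply: conton_at => z _; exact: cvg_fst.
  have c2 : conton (`[s0, 1]%classic `*` circle) (fun z : R * C => K z.2).
    have c3 : conton (`[s0, 1]%classic `*` circle) (fun z : R * C => z.2).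
      by apply: conton_at => z _; exact: cvg_snd.
    by apply: (conton_comp c3 cK) => z [].
  by apply: (conton_comp (conton_pair c1 c2) cH) => z [h1 h2]; split => //; exact: UK.
have fHK z : (`[s0, 1]%classic `*` circle) z -> free_pt S (H z.1 (K z.2)).
  move=> [h1 h2]; apply: contrapT => /HS; apply.
  - exact: UK.
  - exact: fK.
  - by move: h1; rewrite /= in_itv.
pose G (z : R * C) : Q := wact b (tw (H z.1 (K z.2))).
have lG z : (`[s0, 1]%classic `*` circle) z -> ~ lam (G z).
  by move=> /fHK[_ h]; rewrite /G wact_lam.
have cG0 : conton (`[s0, 1]%classic `*` circle) G.
  have c1 : conton [set x : P | free_pt S x] (fun x : P => wact b (tw x)).
    apply: conton_at => x [fx lx] W hW.
    have k2 : nbhs (tw x) (wact b @^-1` W) by exact: (cont_wact lx hW).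
    exact: (tw_cont fx k2).
  exact: (conton_comp cHK c1 fHK).
have cG : conton (`[s0, 1]%classic `*` circle) (fun z => unwind (G z)).
  have c1 : conton [set q | ~ lam q] unwind by apply: conton_at => q; exact: cont_unwind.
  exact: (conton_comp cG0 c1 lG).
have c1Q : conton [set: Q] (fun q : Q => q.1).
  by apply: conton_at => q _; exact: (@cvgQ_fst R _ (nbhs q) _ _ _ (@cvg_id _ (nbhs q))).
have c2Q : conton [set: Q] (fun q : Q => q.2).
  by apply: conton_at => q _; exact: (@cvgQ_snd R _ (nbhs q) _ _ _ (@cvg_id _ (nbhs q))).
have cX : conton (`[s0, 1]%classic `*` circle) (fun z => (unwind (G z)).1).
  by apply: (conton_comp cG c1Q).
have cY : conton (`[s0, 1]%classic `*` circle) (fun z => (unwind (G z)).2).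
  by apply: (conton_comp cG c2Q).
(* At stage [s0] the loop lies in the first ball and has a continuous root by [ball_root]; at stage
   1 it is the loop of points [(0, w)], where the cubic is [z^3 + 2 w]. *)
have [||z [cz zE]] := root_homotopy s0le cX cY.
- by move=> z hz; rewrite -subr_eq0; exact: (unwind_disc (lG z hz)).
- have [z [cz zE]] := ball_root S.
  have hA w : circle w -> ~ lam (G (s0, w)) /\ rad 0 (G (s0, w)) <= r 0.
    move=> cw; split.
      by apply: lG; split => //=; rewrite in_itv /= lexx.
    by have [_ /ltW] := HW _ (UK w cw).
  have cs : conton circle (fun w : C => (s0, w) : R * C).
    by apply: conton_pair; apply: conton_at => w _ //; exact: cst_continuous.
  have cs' : conton circle (fun w : C => G (s0, w)).
    by apply: (conton_comp cs cG0) => w cw; split => //=; rewrite in_itv /= lexx.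
  exists (fun w => z (G (s0, w))); split; last by move=> w cw; apply: zE; exact: hA.
  exact: (conton_comp cs' cz hA).
- apply: (@no_circle_root R); exists z; split => // w cw; have := zE w cw.
  have -> : G (1, w) = (0, w).
    rewrite /G H1; last exact: UK.
    rewrite tw_pt // /b !wactE foldr_rev // => i; exact: reflK.
  by rewrite unwind_0w //; exact: lw.
Qed.

End wildness.

(** * The limit set is a product of spheres *)

Section riemann_sphere.
Context {R : realType}.
Local Notation C := (Cx R).
Local Notation Q := (C * C)%type.
Local Notation E3 := 'rV[R]_3.
Implicit Types (s y : E3) (z t c : C) (h : R) (u : Q).
Local Notation k0 := (@Ordinal 3 0 isT).
Local Notation k1 := (@Ordinal 3 1 isT).
Local Notation k2 := (@Ordinal 3 2 isT).

Definition hor s : C := mkc (s 0 k0) (s 0 k1).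
Definition ht s : R := s 0 k2.
Definition row_hh z h : E3 := \row_i nth 0 [:: re z; im z; h] i.

Lemma hor_row z h : hor (row_hh z h) = z.
Proof. by apply: cxP; rewrite /hor !mxE. Qed.

Lemma ht_row z h : ht (row_hh z h) = h.
Proof. by rewrite /ht !mxE. Qed.

Lemma row_hhE s : row_hh (hor s) (ht s) = s.
Proof.
apply/rowP => -[[|[|[|//]]] hi]; rewrite mxE /=; congr (s 0 _); exact: val_inj.
Qed.

Lemma sphere2E s : sphere2 s <-> cabs (hor s) ^+ 2 + ht s ^+ 2 = 1.
Proof.
rewrite /sphere2 /= !big_ord_recl big_ord0 addr0 sqr_cabs addrA.
have -> : lift ord0 (lift ord0 ord0) = k2 :> 'I_3 by exact: val_inj.
have -> : lift ord0 ord0 = k1 :> 'I_3 by exact: val_inj.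
by have -> : ord0 = k0 :> 'I_3 by exact: val_inj.
Qed.

(* The identification of the complex projective line with the unit sphere. *)
Definition rho u : E3 := row_hh (2 * cj u.1 * u.2 / rc (nq u ^+ 2))
  ((cabs u.1 ^+ 2 - cabs u.2 ^+ 2) / nq u ^+ 2).
Definition eta y : Q := if ht y == -1 then (0, 1) else (rc (1 + ht y), hor y).

Lemma nq2_neq0 u : u != 0 -> nq u ^+ 2 != 0.
Proof. by move=> u0; rewrite sqrf_eq0 nq_eq0. Qed.

Lemma sphere_rho u : u != 0 -> sphere2 (rho u).
Proof.
move=> /nq2_neq0; rewrite sqr_nq => n0; apply/sphere2E; rewrite hor_row ht_row.
rewrite !cabsM cabsV cabs_rc cabs_nat cabs_cj sqr_nq ger0_norm ?addr_ge0 ?sqr_ge0 //.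
by move: (cabs u.1) (cabs u.2) n0 => a b n0; field.
Qed.

Lemma rhoZ c u : c != 0 -> u != 0 -> rho (c *: u) = rho u.
Proof.
move=> c0 u0; have n0 := nq2_neq0 u0.
have cc0 : cabs c ^+ 2 != 0 by rewrite sqrf_eq0 cabs_eq0.
have nE : nq (c *: u) ^+ 2 = cabs c ^+ 2 * nq u ^+ 2.
  by rewrite !sqr_nq /= !cabsM !exprMn mulrDr.
rewrite /rho nE /= !cabsM !exprMn -mulrBr; congr row_hh; last first.
  by rewrite invfM mulrACA divff // mul1r.
have e1 : 2 * cj (c * u.1) * (c * u.2) = rc (cabs c ^+ 2) * (2 * cj u.1 * u.2).
  by rewrite -mul_cj cjM; ring.
have e2 : rc (cabs c ^+ 2) != 0 by rewrite rc_eq0.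
have e3 : rc (nq u ^+ 2) != 0 by rewrite rc_eq0.
rewrite rcM; rewrite [X in X / _](_ : _ = rc (cabs c ^+ 2) * (2 * cj u.1 * u.2)) //.
by rewrite invfM mulrACA divff // mul1r.
Qed.

Lemma eta_neq0 y : eta y != 0.
Proof.
rewrite /eta; case: (ht y =P -1) => h; apply/eqP => e.
  by have /eqP := congr1 snd e; rewrite /= oner_eq0.
have /eqP := congr1 fst e; rewrite /= rc_eq0 addr_eq0 => /eqP e1.
by apply: h; rewrite e1 opprK.
Qed.

Lemma rhoE z t : rho (z, t) = row_hh (2 * cj z * t / rc (cabs z ^+ 2 + cabs t ^+ 2))
  ((cabs z ^+ 2 - cabs t ^+ 2) / (cabs z ^+ 2 + cabs t ^+ 2)).
Proof. by rewrite /rho sqr_nq. Qed.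

Lemma rho_eta y : sphere2 y -> rho (eta y) = y.
Proof.
move=> /sphere2E E; rewrite /eta; case: eqP => h.
  have z0 : hor y = 0.
    apply/eqP; rewrite -cabs_eq0 -sqrf_eq0; apply/eqP.
    by move: E; rewrite h sqrrN expr1n; move: (_ ^+ 2) => a; lra.
  rewrite rhoE cabs0 cabs1 cj0 mulr0 !mul0r -[RHS]row_hhE z0 h.
  by congr row_hh; rewrite expr0n expr1n /= !add0r divr1.
have h1 : 1 + ht y != 0 by rewrite addrC addr_eq0; apply/eqP.
have hz : cabs (hor y) ^+ 2 = 1 - ht y ^+ 2 by rewrite -E addrK.
have n_E : (1 + ht y) ^+ 2 + cabs (hor y) ^+ 2 = 2 * (1 + ht y) by rewrite hz; ring.
rewrite rhoE cabs_rc real_normK ?num_real // n_E -[RHS]row_hhE; congr row_hh.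
  have c1 : rc (1 + ht y) != 0 by rewrite rc_eq0.
  by rewrite cj_rc rcM rc_nat mulrC mulKf // mulf_neq0 // pnatr_eq0.
by rewrite hz; move: (ht y) h1 => a h1; field.
Qed.

Lemma eta_rho u : u != 0 -> exists2 c, c != 0 & eta (rho u) = c *: u.
Proof.
move=> u0; have n0 := nq2_neq0 u0; have nE := sqr_nq u.
have hE : 1 + ht (rho u) = 2 * cabs u.1 ^+ 2 / nq u ^+ 2.
  by rewrite ht_row; move: n0; rewrite nE; move: (cabs u.1) (cabs u.2) => a b n0; field.
rewrite /eta; case: eqP => h.
  have u1 : u.1 = 0.
    apply/eqP; rewrite -cabs_eq0 -sqrf_eq0; move: hE; rewrite h subrr => /esym/eqP.
    by rewrite mulf_eq0 invr_eq0 (negbTE n0) orbF mulf_eq0 pnatr_eq0.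
  have u2 : u.2 != 0.
    by apply: contra_neq u0 => u2; rewrite [u]surjective_pairing u1 u2.
  exists u.2^-1; first by rewrite invr_eq0.
  by apply: qeq; rewrite /= /GRing.scale /= ?u1 ?mulr0 // mulVf.
have u1 : u.1 != 0.
  apply/eqP => u1; apply: h; move: hE; rewrite u1 cabs0 expr0n mulr0 mul0r => /eqP.
  by rewrite addrC addr_eq0 => /eqP.
exists (2 * cj u.1 / rc (nq u ^+ 2)).
  by rewrite !mulf_neq0 ?pnatr_eq0 ?invr_eq0 ?cj_eq0 ?rc_eq0.
have n1 : rc (nq u ^+ 2) != 0 by rewrite rc_eq0.
apply: qeq; rewrite /= /GRing.scale /=.
  rewrite hE rcM rcV rcM rc_nat -mul_cj.
  by move: n1; move: (rc (nq u ^+ 2)) => d n1; ring.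
by rewrite hor_row mulrAC.
Qed.

Definition stereo s : C := hor s / rc (1 - ht s).

Lemma sqr_stereo s : sphere2 s -> ht s != 1 -> cabs (stereo s) ^+ 2 = (1 + ht s) / (1 - ht s).
Proof.
move=> /sphere2E E h; have h1 : 1 - ht s != 0 by rewrite subr_eq0 eq_sym.
rewrite /stereo cabsM cabsV cabs_rc exprMn exprVn real_normK ?num_real //.
have -> : cabs (hor s) ^+ 2 = 1 - ht s ^+ 2 by rewrite -E addrK.
by move: (ht s) h1 => a h1; field.
Qed.

Lemma rho_stereo s : sphere2 s -> ht s != 1 -> rho (cj (stereo s), 1) = s.
Proof.
move=> hs h; have E := sqr_stereo hs h; have h1 : 1 - ht s != 0 by rewrite subr_eq0 eq_sym.
have nE : cabs (stereo s) ^+ 2 + 1 = 2 / (1 - ht s).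
  by rewrite E; move: (ht s) h1 => a h1; field.
rewrite rhoE cabs_cj cabs1 expr1n cjK nE E -[RHS]row_hhE; congr row_hh; last first.
  by move: (ht s) h1 => a h1; field.
have c1 : rc (1 - ht s) != 0 by rewrite rc_eq0.
rewrite /stereo mulr1 rcM rcV rc_nat; move: (hor s) (rc _) c1 => a b b0.
by field.
Qed.

Lemma stereo_rho t : ht (rho (cj t, 1)) != 1 /\ stereo (rho (cj t, 1)) = t.
Proof.
have n0 : cabs t ^+ 2 + 1 != 0 by rewrite gt_eqF // ltr_wpDl ?sqr_ge0.
have rE : rho (cj t, 1) = row_hh (2 * t / rc (cabs t ^+ 2 + 1)) ((cabs t ^+ 2 - 1) / (cabs t ^+ 2 + 1)).
  by rewrite rhoE cabs_cj cabs1 expr1n cjK mulr1.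
have hE : 1 - ht (rho (cj t, 1)) = 2 / (cabs t ^+ 2 + 1).
  by rewrite rE ht_row; move: (_ ^+ 2) n0 => a n0; field.
split.
  by rewrite eq_sym -subr_eq0 hE mulf_neq0 ?invr_eq0 ?pnatr_eq0.
rewrite /stereo hE rE hor_row rcM rcV rc_nat.
have : rc (cabs t ^+ 2 + 1) != 0 by rewrite rc_eq0.
by move: (rc _) => b b0; field.
Qed.

End riemann_sphere.

(** * Homeomorphisms from compact to Hausdorff spaces *)

Section compact_inverse.
Context {T U : topologicalType}.

Lemma conton_inverse (B : set T) (S : set U) (g : T -> U) (f : U -> T) :
  hausdorff_space U -> compact B -> conton B g -> (forall x, S x -> exists2 b, B b & g b = x) ->
  (forall b, B b -> f (g b) = b) -> conton S f.
Proof.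
move=> hU cB cg sg fg x Sx W hW.
have oO : open (W°) by exact: open_interior.
pose D := B `&` ~` W°.
have cD : compact D by apply: compact_closedI => //; exact: open_closedC.
have cgD : {within D, continuous g}.
  apply/contonP => b [Bb Db] V hV; have := cg b Bb V hV.
  by apply: (@filterS _ (nbhs b)) => b' h [Bb' _]; exact: h.
have clD : closed (g @` D) by apply: compact_closed => //; exact: continuous_compact.
have nx : nbhs x (~` (g @` D)).
  apply: open_nbhs_nbhs; split; first exact: closed_openC.
  move=> [b [Bb Db] gb]; apply: Db; rewrite -(fg b Bb) gb; exact: hW.
apply: (@filterS _ (nbhs x) _ _ _ _ nx) => y hy Sy.
have [b Bb gb] := sg y Sy; apply: interior_subset; apply: contrapT => h; apply: hy.
by exists b => //; split => //; rewrite -(fg b Bb) gb.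
Qed.

Lemma homeomorphic_of_compact (B : set T) (S : set U) (g : T -> U) :
  T -> hausdorff_space U -> compact B -> conton B g -> (forall b, B b -> S (g b)) ->
  (forall x, S x -> exists2 b, B b & g b = x) ->
  (forall b b', B b -> B b' -> g b = g b' -> b = b') -> homeomorphic S B.
Proof.
move=> t0 hU cB cg gS sg ig.
have [f fP] : exists f : U -> T, forall x, S x -> B (f x) /\ g (f x) = x.
  have /choice[f fP] : forall x, exists b, S x -> B b /\ g b = x.
    move=> x; have [Sx|nS] := pselect (S x); last by exists t0.
    by have [b Bb gb] := sg x Sx; exists b.
  by exists f.
have fg b : B b -> f (g b) = b.
  by move=> Bb; have [h1 h2] := fP _ (gS b Bb); exact: ig.
exists f; split.
- by apply/contonP; exact: conton_inverse fg.
- split.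
  + by move=> x /fP[].
  + move=> x y; rewrite !inE => /fP[_ e1] /fP[_ e2] e; by rewrite -e1 -e2 e.
  + by move=> b Bb; exists (g b); [exact: gS | exact: fg].
- exists g; split; first exact/contonP.
  by move=> x; rewrite inE => /fP[].
Qed.

End compact_inverse.

(** * Projective space is Hausdorff *)

Section proj3_separated.
Context {R : realType}.
Local Notation C := (Cx R).
Local Notation V := 'rV[C]_4.
Local Notation P := (proj3 C).
Implicit Types (v w : V) (p q : P) (i j : 'I_4).

Lemma hausdorff_separating (T : topologicalType) :
  (forall p q : T, p <> q -> exists2 g : T -> C, continuous g & g p != g q) -> hausdorff_space T.
Proof.
move=> H p q h; apply: contrapT => /H[g cg gpq].
have e0 : 0 < cabs (g p - g q) / 2.
  by rewrite divr_gt0 // lt_neqAle cabs_ge0 andbT eq_sym cabs_eq0 subr_eq0.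
have hp := @cvgCE R _ _ (nbhs_filter p) g (g p) _ (cg p) e0.
have hq := @cvgCE R _ _ (nbhs_filter q) g (g q) _ (cg q) e0.
have [x [/= h1 h2]] := h _ _ hp hq.
have := cabs_tri (g p) (g q) (g x); rewrite (cabsB (g p) (g x)); lra.
Qed.

Definition nsq v : C := \sum_i v 0 i * cj (v 0 i).
(** An entry of the orthogonal projector onto the line of [v]; these entries depend on the line only
    and separate lines. *)
Definition hproj i j v : C := v 0 i * cj (v 0 j) / nsq v.

Lemma nsq_neq0 v : v != 0 -> nsq v != 0.
Proof.
move=> v0; rewrite /nsq.
have -> : \sum_i v 0 i * cj (v 0 i) = rc (\sum_i cabs (v 0 i) ^+ 2).
  rewrite (big_morph (@rc R) (id1 := 0) (op1 := +%R)) ?rc0 //; last exact: rcD.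
  by apply: eq_bigr => i _; rewrite mul_cj.
rewrite rc_eq0 psumr_neq0; last by move=> i _; rewrite sqr_ge0.
apply: contra_neqT v0 => /hasPn h; apply/rowP => i; rewrite mxE.
have := h i (mem_index_enum i); rewrite lt_def sqr_ge0 andbT negbK sqrf_eq0 cabs_eq0.
by move/eqP.
Qed.

Lemma hprojZ i j (c : C) v : c != 0 -> hproj i j (c *: v) = hproj i j v.
Proof.
move=> c0; have E : nsq (c *: v) = c * cj c * nsq v.
  by rewrite /nsq mulr_sumr; apply: eq_bigr => k _; rewrite !mxE cjM; ring.
rewrite /hproj E !mxE cjM.
have -> : c * v 0 i * (cj c * cj (v 0 j)) = (c * cj c) * (v 0 i * cj (v 0 j)) by ring.
by rewrite invfM mulrACA divff ?mul1r // mulf_neq0 // cj_eq0.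
Qed.

Lemma cont_hproj i j v : v != 0 -> hproj i j @ nbhs v --> hproj i j v.
Proof.
move=> v0.
have cv k : (fun u : V => u 0 k) @ nbhs v --> v 0 k by exact: coord_continuous.
have cc k : (fun u : V => cj (u 0 k)) @ nbhs v --> cj (v 0 k).
  exact: (cvg_comp _ _ (cv k) (@continuous_cj R (v 0 k))).
have cn : nsq @ nbhs v --> nsq v.
  by apply: (@cvg_bigsum _ _ _ (nbhs v)) => k; exact: (cvgM (cv k) (cc k)).
have ci : (fun u => (nsq u)^-1) @ nbhs v --> (nsq v)^-1 by exact: (cvgV (nsq_neq0 v0) cn).
exact: (cvgM (cvgM (cv i) (cc j)) ci).
Qed.

Lemma proj3_hausdorff : hausdorff_space P.
Proof.
apply: hausdorff_separating => p q pq.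
have p0 := homog_neq0 p; have q0 := homog_neq0 q.
have cg i j : continuous (fun x : P => hproj i j (homog x)).
  move=> x; rewrite -[x]mk_homog; have x0 := homog_neq0 x; apply: (cont_proj3 x0).
  have E v : v != 0 -> hproj i j (homog (mk v)) = hproj i j v.
    by move=> v0; have [c c0 ->] := homog_mk v0; exact: hprojZ.
  move=> W; rewrite /= E // => hW.
  apply: (@filterS2 _ (nbhs (homog x)) _ _ _ _ _ (nbhs_neq0 x0) (cont_hproj x0 hW)) => v v0 hv.
  by rewrite /= E.
apply: contrapT => h; apply: pq.
have E i j : hproj i j (homog p) = hproj i j (homog q).
  apply: contrapT => /eqP h'; apply: h.
  by exists (fun x : P => hproj i j (homog x)).
have [j pj] : exists j, homog p 0 j != 0.
  apply: contrapT => h'; case/negP: p0; apply/eqP/rowP => j; rewrite mxE.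
  by apply: contrapT => /eqP k; apply: h'; exists j.
have np := nsq_neq0 p0; have nq0 := nsq_neq0 q0.
have pj' : cj (homog p 0 j) != 0 by rewrite cj_eq0.
have qj : homog q 0 j != 0.
  apply/eqP => e; have /eqP := E j j; rewrite /hproj e !mul0r.
  by rewrite !mulf_eq0 invr_eq0 (negbTE pj) (negbTE pj') (negbTE np).
have qj' : cj (homog q 0 j) != 0 by rewrite cj_eq0.
rewrite -[p]mk_homog -[q]mk_homog; apply/mk_eq => //.
exists (cj (homog p 0 j) * nsq (homog q) / (nsq (homog p) * cj (homog q 0 j))).
  by rewrite !mulf_neq0 ?invr_eq0 ?mulf_neq0.
apply/rowP => i; rewrite mxE; have := E i j; rewrite /hproj.
move: (homog p 0 i) (homog q 0 i) (cj (homog p 0 j)) (cj (homog q 0 j)) (nsq (homog p)) (nsq (homog q)) np nq0 pj' qj'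
  => a b c d m n m0 n0 c0 d0 e.
have -> : c * n / (m * d) * a = (a * c / m) * (n / d) by field; rewrite d0 m0.
by rewrite e; field; rewrite d0 n0.
Qed.

End proj3_separated.

(** * Parametrization of the limit set by a product of spheres: continuity *)

Section limit_homeomorphism.
Context {R : realType} (S : ball_system R).
Local Notation C := (Cx R).
Local Notation Q := (C * C)%type.
Local Notation V := 'rV[C]_4.
Local Notation P := (proj3 C).
Local Notation E3 := 'rV[R]_3.
Local Notation f := (limap S).
Implicit Types (s y : E3) (z t c : C) (h u v : Q).

Lemma cont_ht s : {for s, continuous (@ht R)}.
Proof. exact: coord_continuous. Qed.

Lemma cont_hor s : {for s, continuous (@hor R)}.
Proof.
apply: (@cvg_mkc R _ (nbhs s)); exact: coord_continuous.
Qed.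

Lemma sphere2_ht s : sphere2 s -> -1 <= ht s <= 1.
Proof.
move=> /sphere2E E; have : ht s ^+ 2 <= 1 by rewrite -E lerDr sqr_ge0.
by rewrite -ler_norml -{1}(expr1n R 2) -[X in X <= _]real_normK ?num_real // ler_pXn2r ?nnegrE.
Qed.

Lemma compact_sphere2 : compact (@sphere2 R).
Proof.
have K := @rV_compact R 3 (fun _ => `[-1, 1]%classic) (fun _ => @segment_compact R (-1) 1).
apply: (subclosed_compact _ K).
  have -> : @sphere2 R = (fun s => cabs (hor s) ^+ 2 + ht s ^+ 2) @^-1` [set 1].
    by apply/seteqP; split => s; rewrite /= => /sphere2E.
  apply: closed_comp; last exact: closed_eq.
  move=> s _; have h1 := @cvg_cabs R _ _ (nbhs_filter s) _ _ (@cont_hor s).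
  apply: (@cvgD _ _ _ (nbhs s)).
    exact: (cvg_comp _ _ h1 (@exprn_continuous R 2 (cabs (hor s)))).
  exact: (cvg_comp _ _ (@cont_ht s) (@exprn_continuous R 2 (ht s))).
move=> s hs i; rewrite /= in_itv /= -ler_norml -(expr1n R 2).
have : s 0 i ^+ 2 <= 1.
  by rewrite -[leRHS]hs (bigD1 i) //= lerDl sumr_ge0 // => j _; exact: sqr_ge0.
by rewrite -[X in X <= _ -> _]real_normK ?num_real // -{1}(expr1n R 2) ler_pXn2r ?nnegrE // expr1n.
Qed.

Lemma nq_qinv u : nq (qinv u) = (nq u)^-1.
Proof.
rewrite /qinv nqZ nq_qbar ger0_norm ?invr_ge0 ?sqr_ge0 //.
have [->|n0] := eqVneq (nq u) 0; first by rewrite mulr0 invr0.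
by field.
Qed.

(* The coordinate [(q - b)^-1], in which the point at infinity is [0]; the base
   point [b = (0, 1)] lies off the limit set. *)
Local Notation bpt := ((0, 1) : Q).
Definition inv_coord s : Q := if ht s == 1 then 0 else qinv (f (stereo s) - bpt).

Lemma inv_coordE s :
  inv_coord s = if ht s == 1 then 0 else qinv (f (stereo s) - bpt).
Proof. by []. Qed.

Lemma limap_base t : f t - bpt != 0.
Proof.
rewrite subr_eq0; apply/eqP => e; apply: (@base_lam R S); rewrite -e.
by exists t.
Qed.

Lemma cont_stereo s : ht s != 1 -> stereo @ nbhs s --> stereo s.
Proof.
move=> h; have h1 : rc (1 - ht s) != 0 by rewrite rc_eq0 subr_eq0 eq_sym.
have k1 : (fun s => 1 - ht s) @ nbhs s --> 1 - ht s.
  by apply: (@cvgB _ _ _ (nbhs s)); [exact: cvg_cst | exact: cont_ht].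
have k2 := cvg_comp _ _ k1 (@continuous_rc R (1 - ht s)).
have k3 : (fun s => (rc (1 - ht s))^-1) @ nbhs s --> (rc (1 - ht s))^-1.
  exact: (cvgV h1 k2).
exact: (cvgM (@cont_hor s) k3).
Qed.

(** The 3 is the 2 of [limap_proper] plus the norm 1 of the base point. *)
Lemma nq_inv_coord s : sphere2 s -> ht s != 1 -> 3 < cabs (stereo s) ->
  nq (inv_coord s) <= (cabs (stereo s) - 3)^-1.
Proof.
move=> hs h h3; rewrite /inv_coord (negbTE h) nq_qinv lef_pV2 ?posrE ?subr_gt0 //; last first.
  by rewrite lt_neqAle nq_ge0 andbT eq_sym nq_eq0 limap_base.
have := limap_proper S (stereo s); have := nq_sub (f (stereo s)) bpt.
have : nq bpt = 1 by rewrite /nq /= cabs0 cabs1 expr0n expr1n add0r sqrtr1.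
by lra.
Qed.

Lemma cont_inv_coord : conton (@sphere2 R) inv_coord.
Proof.
move=> s hs W hW; have [h|h] := eqVneq (ht s) 1; last first.
  have h1 : ht s < 1 by rewrite lt_neqAle h; case/andP: (sphere2_ht hs).
  have k1 := cont_stereo h.
  have k2 := cvg_comp _ _ k1 (@cont_limap R S (stereo s)).
  have k3 : (fun s => f (stereo s) - bpt) @ nbhs s --> f (stereo s) - bpt.
    exact: (@cvgQ_D R _ _ (nbhs_filter s) _ _ _ _ k2 (@cvgQ_cst R _ _ (nbhs_filter s) (- bpt))).
  have k4 := @cvgQ_inv R _ _ (nbhs_filter s) _ _ (limap_base (stereo s)) k3.
  have hW' : nbhs (qinv (f (stereo s) - bpt)) W by move: hW; rewrite /inv_coord (negbTE h).
  apply: (@filterS2 _ (nbhs s) _ _ _ _ _ (near_lt (@cont_ht s) h1) (k4 _ hW')) => y hy Wy _.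
  by rewrite /inv_coord lt_eqF.
have c0 : inv_coord s = 0 by rewrite /inv_coord h eqxx.
rewrite c0 in hW; have [e e0 he] := (nbhsQ _ _).1 hW.
(* If the stereographic coordinate exceeds [M] in modulus, [nq_inv_coord] bounds the value by the
   inverse of [1 + 1 / e], which is less than [e]. *)
pose M : R := 4 + 1 / e; have M0 : 4 < M by rewrite /M ltrDl divr_gt0.
have M2 : 0 < M ^+ 2 by rewrite exprn_gt0 //; lra.
have h1 : 1 - 1 / M ^+ 2 < ht s by rewrite h ltrBlDr ltrDl divr_gt0.
apply: (@filterS _ (nbhs s) _ _ _ _ (near_gt (@cont_ht s) h1)) => y hy sy.
have [y1|y1] := eqVneq (ht y) 1; first by rewrite /inv_coord y1 eqxx; exact: nbhs_singleton hW.
have yl : ht y < 1 by rewrite lt_neqAle y1; case/andP: (sphere2_ht sy).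
have cM : M < cabs (stereo y).
  have M0' : 0 <= M by lra.
  rewrite -(@ltr_pXn2r _ 2) ?nnegrE ?cabs_ge0 // (sqr_stereo sy y1).
  have y0 : 0 < 1 - ht y by rewrite subr_gt0.
  rewrite ltr_pdivlMr //.
  move: hy; rewrite ltrBlDr -ltrBlDl => hy.
  have : M ^+ 2 * (1 - ht y) < 1.
    by rewrite mulrC -ltr_pdivlMr //; move: hy; rewrite div1r; lra.
  have : 1 / M ^+ 2 <= 1.
    rewrite ler_pdivrMr // mul1r expr2; have : M * 1 <= M * M by rewrite ler_wpM2l //; lra.
    by lra.
  by move: hy; lra.
apply: he; rewrite subr0; apply: (le_lt_trans (nq_inv_coord sy y1 _)); first by lra.
rewrite invf_plt ?posrE //; last by lra.
by move: cM; rewrite /M div1r; lra.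
Qed.

(** Trivializes the twistor bundle off the fibre over [bpt]: for [h] nonzero the slope of this
    vector is [bpt + h^-1], for [h = 0] it lies over infinity, and [u] is the coordinate along the
    fibre. *)
Definition lift4 h u : V := row4 (qmul h u) (u + qmul bpt (qmul h u)).

Lemma lift4Z c h u : lift4 h (c *: u) = c *: lift4 h u.
Proof. by rewrite /lift4 !qmulZr -scalerDr row4Z. Qed.

Lemma lift4_neq0 h u : u != 0 -> lift4 h u != 0.
Proof.
move=> u0; rewrite row4_eq0; apply/negP => /andP[/eqP ->].
by rewrite qmul0 addr0; apply/negP.
Qed.

Definition sphere_map (b : E3 * E3) : P := mk (lift4 (inv_coord b.1) (eta b.2)).

Lemma sphere_mapE b : sphere_map b = mk (lift4 (inv_coord b.1) (eta b.2)).
Proof. by []. Qed.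

(* [eta] is not continuous at the south pole, but it is proportional to a
   continuous vector there. *)
Definition eta' y : Q := (cj (hor y), rc (1 - ht y)).

Lemma eta'_eta y : sphere2 y -> ht y != 1 -> exists2 c, c != 0 & eta' y = c *: eta y.
Proof.
move=> /sphere2E E h; rewrite /eta; case: (ht y =P -1) => h1.
  have z0 : hor y = 0.
    apply/eqP; rewrite -cabs_eq0 -sqrf_eq0; apply/eqP.
    by move: E; rewrite h1 sqrrN expr1n; move: (_ ^+ 2) => a; lra.
  exists 2; first by rewrite pnatr_eq0.
  rewrite /eta' z0 h1 opprK cj0; apply: qeq; rewrite /= /GRing.scale /= ?mulr0 // mulr1.
  by rewrite -rc_nat.
have hn : rc (1 + ht y) != 0 by rewrite rc_eq0 addrC addr_eq0; apply/eqP.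
have hp : rc (1 - ht y) != 0 by rewrite rc_eq0 subr_eq0 eq_sym.
have zz : hor y * cj (hor y) = rc (1 + ht y) * rc (1 - ht y).
  rewrite mul_cj -rcM; congr rc; rewrite (_ : cabs _ ^+ 2 = 1 - ht y ^+ 2); last by rewrite -E addrK.
  by ring.
have z0 : cj (hor y) != 0.
  by apply: contraTneq (mulf_neq0 hn hp) => e; rewrite -zz e mulr0 eqxx.
exists (cj (hor y) / rc (1 + ht y)); first by rewrite mulf_neq0 ?invr_eq0.
have pZ c (a b : C) : c *: ((a, b) : Q) = (c * a, c * b) by [].
rewrite pZ /eta'; congr pair; first by rewrite divfK.
by rewrite -mulrA mulrC -mulrA zz mulKf.
Qed.

Lemma sphere_map_eta' (b : E3 * E3) : sphere2 b.2 -> ht b.2 != 1 ->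
  sphere_map b = mk (lift4 (inv_coord b.1) (eta' b.2)).
Proof.
move=> hb h; have [c c0 ->] := eta'_eta hb h.
by rewrite lift4Z mk_scale // lift4_neq0 // eta_neq0.
Qed.

Lemma cont_lift4 (p : Q * Q) : p.2 != 0 ->
  {for p, continuous (fun p : Q * Q => mk (lift4 p.1 p.2))}.
Proof.
move=> p0.
have k1 : (fun p : Q * Q => p.1) @ nbhs p --> p.1 by exact: cvg_fst.
have k2 : (fun p : Q * Q => p.2) @ nbhs p --> p.2 by exact: cvg_snd.
have k3 : (fun p : Q * Q => qmul p.1 p.2) @ nbhs p --> qmul p.1 p.2.
  exact: (@cvgQ_mul R _ _ (nbhs_filter p) _ _ _ _ k1 k2).
have k4 : (fun p : Q * Q => p.2 + qmul bpt (qmul p.1 p.2)) @ nbhs p -->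
    p.2 + qmul bpt (qmul p.1 p.2).
  apply: (@cvgQ_D R _ _ (nbhs_filter p) _ _ _ _ k2).
  exact: (@cvgQ_mul R _ _ (nbhs_filter p) _ _ _ _ (@cvgQ_cst R _ _ (nbhs_filter p) bpt) k3).
have k5 := @cvg_row4 R _ _ (nbhs_filter p) _ _ _ _ k3 k4.
exact: (cvg_comp _ _ k5 (mk_continuous (lift4_neq0 p.1 p0))).
Qed.

Lemma cont_sphere_map : conton (@sphere2 R `*` @sphere2 R) sphere_map.
Proof.
have c1 : conton (@sphere2 R `*` @sphere2 R) (fun b => inv_coord b.1).
  apply: (conton_comp (B := @sphere2 R) (g := inv_coord) _ cont_inv_coord); last by move=> b [].
  by apply: conton_at => b _; exact: cvg_fst.
have main (g : E3 -> Q) (A : set (E3 * E3)) : (forall y, {for y, continuous g}) ->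
    (forall b, A b -> g b.2 != 0) -> A `<=` @sphere2 R `*` @sphere2 R ->
    conton A (fun b => mk (lift4 (inv_coord b.1) (g b.2))).
  move=> cg g0 AB.
  have c1' : conton A (fun b => inv_coord b.1).
    move=> b /AB hb W hW; have := c1 b hb W hW.
    by apply: (@filterS _ (nbhs b)) => b' hb' /AB; exact: hb'.
  have c2 : conton A (fun b : E3 * E3 => g b.2).
    have c3 : conton A (fun b : E3 * E3 => b.2) by apply: conton_at => b _; exact: cvg_snd.
    by apply: (conton_comp c3 (B := setT) (g := g)) => //; apply: conton_at => y _; exact: cg.
  have c4 : conton [set p : Q * Q | p.2 != 0] (fun p => mk (lift4 p.1 p.2)).
    by apply: conton_at => p; exact: cont_lift4.
  exact: (conton_comp (conton_pair c1' c2) c4 g0).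
have ch1 y : (fun y => rc (1 + ht y)) @ nbhs y --> rc (1 + ht y).
  have k1 : (fun s => 1 + ht s) @ nbhs y --> 1 + ht y.
    by apply: (@cvgD _ _ _ (nbhs y)); [exact: cvg_cst | exact: cont_ht].
  exact: (cvg_comp _ _ k1 (@continuous_rc R (1 + ht y))).
have ch2 y : (fun y => rc (1 - ht y)) @ nbhs y --> rc (1 - ht y).
  have k1 : (fun s => 1 - ht s) @ nbhs y --> 1 - ht y.
    by apply: (@cvgB _ _ _ (nbhs y)); [exact: cvg_cst | exact: cont_ht].
  exact: (cvg_comp _ _ k1 (@continuous_rc R (1 - ht y))).
have cht2 (b : E3 * E3) : {for b, continuous (fun b : E3 * E3 => ht b.2)}.
  have k : (fun b : E3 * E3 => b.2) @ nbhs b --> b.2 by exact: cvg_snd.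
  exact: (cvg_comp _ _ k (@cont_ht b.2)).
move=> b hb W hW; have [h|h] := eqVneq (ht b.2) 1.
  pose A := (@sphere2 R `*` @sphere2 R) `&` [set b : E3 * E3 | -1 < ht b.2].
  have E b' : A b' -> sphere_map b' = mk (lift4 (inv_coord b'.1) ((rc (1 + ht b'.2), hor b'.2) : Q)).
    by move=> [_ /= h']; rewrite /sphere_map /eta gt_eqF.
  have lt1 : -1 < ht b.2 by rewrite h; lra.
  have cA : conton A (fun b => mk (lift4 (inv_coord b.1) ((rc (1 + ht b.2), hor b.2) : Q))).
    apply: (main (fun y => (rc (1 + ht y), hor y))).
    - by move=> y; apply: (@cvgQ_pair R _ _ (nbhs_filter y)); [exact: ch1 | exact: cont_hor].
    - move=> b' [_ /= h']; have := eta_neq0 b'.2; rewrite /eta gt_eqF //.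
    - by move=> b' [].
  rewrite E // in hW; have k := cA b (conj hb lt1) W hW.
  apply: (@filterS2 _ (nbhs b) _ _ _ _ _ (near_gt (cht2 b) lt1) k) => b' h1 h2 hb'.
  by rewrite E //; apply: h2.
pose A := (@sphere2 R `*` @sphere2 R) `&` [set b : E3 * E3 | ht b.2 < 1].
have E b' : A b' -> sphere_map b' = mk (lift4 (inv_coord b'.1) (eta' b'.2)).
  by move=> [[_ h1] /= h']; rewrite sphere_map_eta' // lt_eqF.
have lt1 : ht b.2 < 1 by rewrite lt_neqAle h; case: hb => _ /sphere2_ht/andP[].
have cA : conton A (fun b => mk (lift4 (inv_coord b.1) (eta' b.2))).
  apply: (main eta').
  - move=> y; apply: (@cvgQ_pair R _ _ (nbhs_filter y)); last exact: ch2.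
    exact: (cvg_comp _ _ (@cont_hor y) (@continuous_cj R (hor y))).
  - move=> b' [[_ h1] /= h']; have [|c c0 ->] := eta'_eta h1; first by rewrite lt_eqF.
    by rewrite scalez_eq0 // eta_neq0.
  - by move=> b' [].
rewrite E // in hW; have k := cA b (conj hb lt1) W hW.
apply: (@filterS2 _ (nbhs b) _ _ _ _ _ (near_lt (cht2 b) lt1) k) => b' h1 h2 hb'.
by rewrite E //; apply: h2.
Qed.

End limit_homeomorphism.

(** * Parametrization of the limit set by a product of spheres: bijectivity *)

Section limit_bijection.
Context {R : realType} (S : ball_system R).
Local Notation C := (Cx R).
Local Notation Q := (C * C)%type.
Local Notation P := (proj3 C).
Local Notation E3 := 'rV[R]_3.
Local Notation f := (limap S).
Local Notation lam := (lam S).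
Implicit Types (s y : E3) (z t c : C) (h u v : Q).
Local Notation bpt := ((0, 1) : Q).
Local Notation inv_coord := (inv_coord S).
Local Notation sphere_map := (sphere_map S).

Lemma inv_coord_rho t : inv_coord (rho (cj t, 1)) = qinv (f t - bpt).
Proof. by have [h e] := stereo_rho t; rewrite inv_coordE (negbTE h) e. Qed.

Lemma rho_pole : ht (rho ((1, 0) : C * C)) = 1 :> R.
Proof. by rewrite rhoE ht_row cabs0 cabs1 expr0n expr1n subr0 addr0 divr1. Qed.

Lemma inv_coord_pole : inv_coord (rho ((1, 0) : C * C)) = 0.
Proof.
have key s : ht s = 1 -> inv_coord s = 0 by rewrite inv_coordE => ->; rewrite eqxx.
exact: key rho_pole.
Qed.

Lemma sphere_pole s : sphere2 s -> ht s = 1 -> s = rho ((1, 0) : C * C).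
Proof.
move=> hs h; rewrite -[LHS](rho_eta hs) /eta h; case: (1 =P -1 :> R) => [e|_].
  by move/eqP: e; rewrite -subr_eq0 opprK -(natrD R 1 1) pnatr_eq0.
have z0 : hor s = 0.
  apply/eqP; rewrite -cabs_eq0 -sqrf_eq0; apply/eqP; move/sphere2E: hs.
  by rewrite h expr1n; move: (_ ^+ 2) => a; lra.
rewrite z0 (_ : (rc (1 + 1), 0) = (2 : C) *: ((1, 0) : Q)).
  by rewrite rhoZ ?pnatr_eq0 //; exact: base_u.
have pZ (c a b : C) : c *: ((a, b) : Q) = (c * a, c * b) by [].
by rewrite pZ mulr0 mulr1 -rc_nat.
Qed.

Lemma inv_coord_limap s : sphere2 s -> ht s != 1 -> exists t, s = rho (cj t, 1).
Proof. by move=> hs h; exists (stereo s); rewrite rho_stereo. Qed.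

Lemma inv_coord_inj s s' : sphere2 s -> sphere2 s' -> inv_coord s = inv_coord s' -> s = s'.
Proof.
have qi0 t : qinv (f t - bpt) != 0.
  by rewrite -nq_eq0 nq_qinv invr_eq0 nq_eq0 limap_base.
move=> hs hs'; have [/(sphere_pole hs) ->|/(inv_coord_limap hs)[t ->]] := eqVneq (ht s) 1;
  have [/(sphere_pole hs') ->|/(inv_coord_limap hs')[t' ->]] := eqVneq (ht s') 1.
- by move=> _.
- by rewrite inv_coord_pole inv_coord_rho => /esym/eqP; rewrite (negbTE (qi0 t')).
- by rewrite inv_coord_pole inv_coord_rho => /eqP; rewrite (negbTE (qi0 t)).
rewrite !inv_coord_rho => E.
have d0 := limap_base S t; have d0' := limap_base S t'.
have e : f t - bpt = f t' - bpt.
  have a := qmulV (1, 0) d0; have a' := qmulV (1, 0) d0'; rewrite !qmul1r in a a'.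
  by apply: (qmulI (qi0 t)); rewrite a E a'.
by have /limap_inj -> : f t = f t' by apply: (addIr (- bpt)).
Qed.

Lemma lift4_hd h u : hd (lift4 h u) = qmul h u.
Proof. exact: hd_row4. Qed.

Lemma lift4_dir h u : tl (lift4 h u) - qmul bpt (hd (lift4 h u)) = u.
Proof. by rewrite hd_row4 tl_row4 addrK. Qed.

Lemma lift4_limap t u : lift4 (qinv (f t - bpt)) (qmul (f t - bpt) u) = row4 u (qmul (f t) u).
Proof. by rewrite /lift4 qmulVK ?limap_base // qmulBl subrK. Qed.

Lemma sphere_map_inj b b' : (@sphere2 R `*` @sphere2 R) b -> (@sphere2 R `*` @sphere2 R) b' ->
  sphere_map b = sphere_map b' -> b = b'.
Proof.
case: b => s y; case: b' => s' y' [/= hs hy] [/= hs' hy'].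
move=> /mk_eq[||c c0 E]; try by rewrite lift4_neq0 // eta_neq0.
rewrite /= in E.
have e1 : eta y' = c *: eta y.
  rewrite -[LHS](lift4_dir (inv_coord s')) E hdZ tlZ qmulZr -scalerBr.
  by rewrite lift4_dir.
have yy : y' = y by rewrite -(rho_eta hy') e1 rhoZ ?eta_neq0 // rho_eta.
have cy0 : c *: eta y != 0 by rewrite scalez_eq0 // eta_neq0.
have e2 : qmul (inv_coord s') (c *: eta y) = qmul (inv_coord s) (c *: eta y).
  by rewrite -e1 -lift4_hd E hdZ lift4_hd e1 qmulZr.
by rewrite yy (inv_coord_inj hs' hs (qmulI cy0 e2)).
Qed.

Lemma sphere_map_lam b : (@sphere2 R `*` @sphere2 R) b -> lam_lift S (sphere_map b).
Proof.
case: b => s y [/= hs hy]; rewrite sphere_mapE /=; have e0 := eta_neq0 y.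
have [/(sphere_pole hs) ->|/(inv_coord_limap hs)[t ->]] := eqVneq (ht s) 1.
  rewrite inv_coordE rho_pole eqxx; move=> [hf _]; move: hf.
  by rewrite /lift4 finpt_mk ?lift4_neq0 // qmul0l eqxx.
rewrite inv_coord_rho -(qmulV (eta y) (limap_base S t)) lift4_limap => -[_]; apply.
rewrite tw_pt; first by exists t.
have : qmul (f t - bpt) (qmul (qinv (f t - bpt)) (eta y)) != 0.
  by rewrite qmulV // limap_base.
by rewrite qmul_eq0 negb_or => /andP[].
Qed.

Lemma sphere_map_onto p : lam_lift S p ->
  exists2 b, (@sphere2 R `*` @sphere2 R) b & sphere_map b = p.
Proof.
have mkL (h u : Q) : u != 0 -> mk (lift4 h (eta (rho u))) = mk (lift4 h u).
  by move=> u0; have [c c0 ->] := eta_rho u0; rewrite lift4Z mk_scale // lift4_neq0.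
have t10 t : ((cj t, 1) : Q) != 0.
  by apply/eqP => e; have := oner_neq0 C; rewrite -[1]/(((cj t, 1) : Q).2) e eqxx.
move=> hp; have [pf|pf] := boolP (finpt p).
  have [t _ ft] : lam (tw p) by apply: contrapT => h; apply: hp.
  rewrite (pt_tw pf) -ft; set u := hd (homog p).
  have u0 : qmul (f t - bpt) u != 0 by rewrite qmul_eq0 negb_or limap_base.
  exists (rho (cj t, 1), rho (qmul (f t - bpt) u)).
    by split; apply: sphere_rho.
  by rewrite sphere_mapE /= inv_coord_rho mkL // lift4_limap.
have h0 : hd (homog p) = 0 by move: pf; rewrite /finpt negbK => /eqP.
have pE : p = mk (row4 0 (tl (homog p))) by rewrite -h0 row4_hdtl mk_homog.
have v0 : tl (homog p) != 0.
  by have := homog_neq0 p; rewrite -[X in X != 0 -> _]row4_hdtl row4_eq0 h0 eqxx.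
exists (rho ((1, 0) : C * C), rho (tl (homog p))).
  by split; apply: sphere_rho => //; exact: base_u.
rewrite sphere_mapE /= inv_coordE rho_pole eqxx mkL // [RHS]pE /lift4 qmul0l.
by rewrite qmul0 addr0.
Qed.

Lemma lam_lift_spheres : homeomorphic (lam_lift S) (@sphere2 R `*` @sphere2 R).
Proof.
apply: (homeomorphic_of_compact (g := sphere_map)).
- exact: (0, 0).
- exact: proj3_hausdorff.
- apply: compact_setX; exact: compact_sphere2.
- exact: cont_sphere_map.
- exact: sphere_map_lam.
- exact: sphere_map_onto.
- exact: sphere_map_inj.
Qed.

End limit_bijection.

Theorem theorem8p3 (R : realType) :
  exists Gam : set (proj3 R[i] -> proj3 R[i]),
    complex_kleinian Gam /\ wildly_embedded_S2xS2 (limit_set Gam).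
Proof.
have [S] := @ball_system_exists R.
exists (Gam S); split; first exact: Gam_kleinian.
split; first exact: closed_limit.
  by rewrite limit_setE; exact: lam_lift_spheres.
by rewrite limit_setE; exact: lam_lift_wild.
Qed.
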